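(* Suppose that $X_0\in\chi^r$ has an $n$-multiplicity contact with $\Sigma=\{y=0\}$ at $p=(0,0)$, with $n\ge2$, and let $\delta=\pm1$ be the sign of the first component of $X_0(0,0)$. Assume condition (A) of the context for $X_0$, with the point $q_0=(x_0,y_0)$ and the section $\tau=\{(x_0,y):y\in(y_0-\varepsilon,y_0+\varepsilon)\}$. Then there exist a neighborhood $\mathcal{U}_0$ of $X_0$ in $\chi^r$ and $n-2$ surjective functions $\lambda_i:\mathcal{U}_0\to(-\eta,\eta)$, $i=1,\dots,n-2$ (for some $\eta>0$), depending continuously on $X$, such that for each $X\in\mathcal{U}_0$ there exists a diffeomorphism $h_X:(-\varepsilon,\varepsilon)\to(-\varepsilon,\varepsilon)\times\{0\}$ for which the full transition map $T_X:(-\varepsilon,\varepsilon)\times\{0\}\to\tau$ is given by $$T_X(h_X(x))=\Big(x_0,\;\lambda_0(X)+\kappa(X)x^n+\sum_{i=1}^{n-2}\lambda_i(X)x^i+\mathcal{O}(x^{n+1})\Big),$$ where $\lambda_0(X)=\pi_2\circ T_X(0,0)$ and $\operatorname{sgn}(\kappa(X))=-\delta^n\operatorname{sgn}(X^nh(0,0))$.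
   Context: $M\subset\mathbb{R}^2$ is open with coordinates $(x,y)$ near the origin in which $h(x,y)=y$, $\Sigma=h^{-1}(0)$, $M^\pm=\{\pm h>0\}$; $\pi_2(x,y)=y$. $\chi^r$ is the space of $C^r$ vector fields on $M$ with the $C^r$ topology ($r$ large enough for the expansions). $Xh=\langle X,\nabla h\rangle$, $X^ih=X(X^{i-1}h)$. $X$ has an $n$-multiplicity contact with $\Sigma$ at $p\in\Sigma$ if $X^ih(p)=0$ for $i=1,\dots,n-1$ and $X^nh(p)\ne0$ (and $X(p)\ne0$). Let $V$ be a small neighborhood of the origin $O$ on which the first component of $X_0$ does not vanish. Condition (A) for $X_0$: with $\varphi_{X_0}$ the flow, there is $T_0>0$ such that $q_0=\varphi_{X_0}(T_0;0,0)$ or $q_0=\varphi_{X_0}(-T_0;0,0)$, and the arc of orbit between $O$ and $q_0$ lies in $V$ and, except for $O$, in one of $M^+$, $M^-$. $\varepsilon>0$ is small, $\tau\subset V\cap M^\pm$, transverse to $X_0$. For $X$ near $X_0$, the full transition map $T_X$ sends $(x,0)$, $x\in(-\varepsilon,\varepsilon)$, to the point of $\tau$ reached by following the orbit of $X$ through $(x,0)$ for a time close to $T_0$ (resp. $-T_0$), with no requirement that this orbit stay on one side of $\Sigma$.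
   Formalization: The formula λ_0(X)=π_2∘T_X(0,0) fails for general X near X_0 (e.g. n=2); it is proved as λ_0(X)=π_2(T_X(h_X(0))), with the original formula only for X that still has an n-multiplicity contact at the origin. *)

(* Defs.v *)
From Stdlib Require Export Reals List.
From Coquelicot Require Export Coquelicot.
Open Scope R_scope.

(* A vector field on an open set M of the plane, by its two components.  The
   values outside M are junk: everything below only looks at points of M. *)
Record vfield : Type := VField { vx : R -> R -> R; vy : R -> R -> R }.

(* On an open set, [ex_diff_n f r] at every point says that all iterated
   partial derivatives of f of order at most r exist and are continuous. *)
Definition Cr_vfield (M : R * R -> Prop) (r : nat) (X : vfield) : Prop :=
  forall x y : R, M (x, y) ->
    ex_diff_n (vx X) r x y /\ ex_diff_n (vy X) r x y.

Definition compact_set (K : R * R -> Prop) : Prop :=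
  forall (I : Type) (O : I -> R * R -> Prop),
    (forall i, open (O i)) ->
    (forall p, K p -> exists i, O i p) ->
    exists l : list I, forall p, K p -> exists i, In i l /\ O i p.

Definition Cr_close (K : R * R -> Prop) (r : nat) (e : R) (X Y : vfield) : Prop :=
  forall (i j : nat) (x y : R), (i + j <= r)%nat -> K (x, y) ->
    Rabs (partial_derive i j (vx Y) x y - partial_derive i j (vx X) x y) < e /\
    Rabs (partial_derive i j (vy Y) x y - partial_derive i j (vy X) x y) < e.

(* Neighbourhood filter of X in the space of C^r vector fields on M, for the
   topology of uniform convergence on compact subsets of M of all partial
   derivatives of order at most r.  Fields that agree on M have the same
   neighbourhoods, so a continuous real function only depends on the
   restriction of the field to M. *)
Definition Cr_nbhs (M : R * R -> Prop) (r : nat) (X : vfield)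
    (U : vfield -> Prop) : Prop :=
  exists (K : R * R -> Prop) (e : R),
    compact_set K /\ (forall p, K p -> M p) /\ 0 < e /\
    forall Y, Cr_vfield M r Y -> Cr_close K r e X Y -> U Y.

Definition Cr_open (M : R * R -> Prop) (r : nat) (U : vfield -> Prop) : Prop :=
  (forall X, U X -> Cr_vfield M r X) /\ (forall X, U X -> Cr_nbhs M r X U).

Definition height (x y : R) : R := y.

Definition switching (M : R * R -> Prop) (p : R * R) : Prop :=
  M p /\ height (fst p) (snd p) = 0.

(* M^+ for s = 1 and M^- for s = -1. *)
Definition side (M : R * R -> Prop) (s : R) (p : R * R) : Prop :=
  M p /\ 0 < s * height (fst p) (snd p).

Definition lie (X : vfield) (f : R -> R -> R) (x y : R) : R :=
  vx X x y * Derive (fun u => f u y) x + vy X x y * Derive (fun v => f x v) y.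

Fixpoint lie_iter (X : vfield) (i : nat) (f : R -> R -> R) : R -> R -> R :=
  match i with
  | O => f
  | S k => lie X (lie_iter X k f)
  end.

Definition multiplicity_contact (M : R * R -> Prop) (X : vfield) (n : nat)
    (p : R * R) : Prop :=
  switching M p /\
  (vx X (fst p) (snd p), vy X (fst p) (snd p)) <> (0, 0) /\
  (forall i : nat, (1 <= i <= n - 1)%nat ->
     lie_iter X i height (fst p) (snd p) = 0) /\
  lie_iter X n height (fst p) (snd p) <> 0.

(* [flow M X t p q] : the local flow of X on M satisfies phi_X(t; p) = q, where
   t may be negative.  M being open, asking for two-sided derivatives at the
   end points of the time interval is no restriction. *)
Definition flow (M : R * R -> Prop) (X : vfield) (t : R) (p q : R * R) : Prop :=
  exists g : R -> R * R,
    g 0 = p /\ g t = q /\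
    forall u : R, Rmin 0 t <= u <= Rmax 0 t ->
      M (g u) /\
      is_derive (fun v => fst (g v)) u (vx X (fst (g u)) (snd (g u))) /\
      is_derive (fun v => snd (g v)) u (vy X (fst (g u)) (snd (g u))).

(* q0 = phi_X(sigma * T0; 0, 0), and the arc of orbit between the origin and q0
   lies in V and, except for the origin, in M^s. *)
Definition condition_A (M V : R * R -> Prop) (X : vfield) (T0 sigma s : R)
    (q0 : R * R) : Prop :=
  0 < T0 /\ (sigma = 1 \/ sigma = -1) /\ (s = 1 \/ s = -1) /\
  flow M X (sigma * T0) (0, 0) q0 /\
  forall (u : R) (q : R * R), 0 <= u <= T0 -> flow M X (sigma * u) (0, 0) q ->
    V q /\ (u <> 0 -> side M s q).

Definition section (x0 y0 eps : R) (q : R * R) : Prop :=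
  fst q = x0 /\ y0 - eps < snd q < y0 + eps.

(* T is the full transition map from (-eps, eps) x {0} to tau along X, for times
   at distance less than rho from t0; the orbit may cross the line y = 0. *)
Definition full_transition_map (M : R * R -> Prop) (X : vfield) (t0 rho eps : R)
    (tau : R * R -> Prop) (T : R * R -> R * R) : Prop :=
  forall x : R, - eps < x < eps ->
    tau (T (x, 0)) /\
    (exists t : R, Rabs (t - t0) < rho /\ flow M X t (x, 0) (T (x, 0))) /\
    (forall (t : R) (q : R * R),
       Rabs (t - t0) < rho -> flow M X t (x, 0) q -> tau q -> q = T (x, 0)).

Definition Cr_on_interval (r : nat) (eps : R) (f : R -> R) : Prop :=
  forall x : R, - eps < x < eps ->
    (forall k : nat, (k <= r)%nat -> ex_derive_n f k x) /\
    continuous (Derive_n f r) x.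

Definition Cr_diffeo (r : nat) (eps : R) (h : R -> R * R) : Prop :=
  exists g k : R -> R,
    Cr_on_interval r eps g /\ Cr_on_interval r eps k /\
    (forall x : R, - eps < x < eps ->
       h x = (g x, 0) /\ - eps < g x < eps /\ k (g x) = x) /\
    (forall u : R, - eps < u < eps -> - eps < k u < eps /\ g (k u) = u).

(* Main.v *)
Require Import Defs.
From Stdlib Require Import Reals Factorial Lra Lia ClassicalEpsilon FunctionalExtensionality.
From Coquelicot Require Import Coquelicot.
Open Scope R_scope.

(** Near the arc the first component P of X does not vanish, so orbits are graphs of
    solutions of y' = F(x, y), F = Q / P.  If G(a) is the height at x0 of the solution
    through (a, 0), then G'(a) = Q(a, 0) u(a) with u of the sign opposite to P; since the
    contact order of X0 is the order of vanishing of Q(., 0), G has a critical point of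
    order n at 0, and the sign of its n-th derivative is -delta^n sgn(X^n h).  For X near
    X0 the (n-1)-st derivative of G has a unique zero a(X) near 0; translating a(X) to 0
    removes the term of degree n - 1, and the other Taylor coefficients at a(X) are the
    lambda_i.  They are onto because perturbing Q by mu i x^(i-1) p(x), where the
    polynomial p inverts u at X0 to order n - 2, moves lambda_i by mu + o(mu) and the
    others by o(mu).  The analytic part is that G and all its derivatives are jointly
    continuous in (X, a): the derivative of the solution in a is an explicit expression in
    the solution itself, which bootstraps its regularity. *)

(** * Real induction, compactness and Gronwall's inequality *)

(** A field is meaningful only on M, and its orbits may leave any given region. The field is
    therefore composed with a retraction onto a compact tube around the arc: the slope becomes
    globally bounded and Lipschitz, and its solutions are true orbits as long as they stay in the
    open tube. The fields C^r close to X0 on the tube form a uniform space, so dependence on X is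
    ordinary continuity. Differentiability in a is elementary: the difference of two solutions obeys
    a linear equation, hence is an explicit exponential times a factor that vanishes when the
    abscissas agree. The translation by a(X) does not preserve (-eps, eps); h_X is x + a (1 -
    (x/eps)^(2N)), which fixes both ends and differs from the translation by O(x^(n+1)). So h_X(0) =
    (a(X), 0), and lambda_0(X) is the height reached from this point; it is the one reached from the
    origin when X itself has contact n there, because then a(X) = 0. Finally each lambda_i has to
    sweep (-eta, eta) while the others stay inside it, whence the explicit error bound |mu|/4. *)

Lemma real_induction (Q : R -> Prop) (a b : R) :
  (forall u, a <= u <= b -> (forall v, a <= v < u -> Q v) ->
     locally u (fun v => a <= v <= b -> Q v)) ->
  forall u, a <= u <= b -> Q u.
Proof.
  intros H u Hu.
  (* The supremum m of E satisfies the induction hypothesis, so Q spreads past m, which forces m =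
     b. At u = a the induction hypothesis is empty and provides the base case. *)
  set (E := fun w => a <= w <= b /\ forall v, a <= v < w -> Q v).
  destruct (completeness E) as [m [Hm1 Hm2]].
  { exists b. intros w [Hw _]. lra. }
  { exists a. split; [lra|]. intros v Hv; lra. }
  assert (Ham : a <= m). { apply Hm1. split; [lra|]. intros v Hv; lra. }
  assert (Hmb : m <= b). { apply Hm2. intros w [Hw _]. lra. }
  assert (Hbelow : forall v, a <= v < m -> Q v).
  { intros v Hv. destruct (classic (exists w, E w /\ v < w)) as [[w [[Hw1 Hw2] Hw3]]|Hn].
    - apply Hw2. lra.
    - exfalso. assert (m <= v); [|lra]. apply Hm2. intros w Hw.
      destruct (Rle_lt_dec w v) as [Hl|Hl]; [exact Hl|]. exfalso. apply Hn. exists w; tauto. }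
  destruct (H m (conj Ham Hmb) Hbelow) as [e He].
  assert (Hnext : forall v, a <= v <= b -> v < m + e -> Q v).
  { intros v Hv Hve. destruct (Rlt_le_dec v m) as [Hl|Hl]; [apply Hbelow; lra|].
    apply He; [|exact Hv]. apply Rabs_def1; unfold minus, plus, opp; simpl; lra. }
  destruct (Rlt_le_dec m b) as [Hl|Hl].
  - exfalso. assert (Hw : Rmin b (m + e / 2) <= m).
    { apply Hm1. pose proof (cond_pos e).
      split; [split; [apply Rmin_glb; lra | apply Rmin_l]|].
      intros v Hv. pose proof (Rmin_l b (m + e / 2)). pose proof (Rmin_r b (m + e / 2)).
      apply Hnext; lra. }
    pose proof (cond_pos e). revert Hw. unfold Rmin. destruct Rle_dec; lra.
  - apply Hnext; [lra|]. pose proof (cond_pos e). lra.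
Qed.

(** Compactness of [a, b] by real induction on the right end point: the neighbourhood of p valid up
    to u - e/2 is intersected with the one valid around u. *)
Lemma tube_lemma {T : UniformSpace} (P : T -> R -> Prop) (p : T) (a b : R) :
  (forall u, a <= u <= b -> locally (p, u) (fun q => P (fst q) (snd q))) ->
  locally p (fun q => forall u, a <= u <= b -> P q u).
Proof.
  intros H. destruct (Rle_lt_dec a b) as [Hab|Hab].
  2:{ apply filter_forall. intros q u Hu. lra. }
  apply (real_induction (fun u => locally p (fun q => forall v, a <= v <= u -> P q v)) a b);
    [|lra].
  intros u Hu IH. destruct (H u Hu) as [e He].
  exists e. intros v Hv Hvab.
  assert (Hv' : Rabs (v - u) < e) by exact Hv.
  apply Rabs_def2 in Hv'.
  assert (Hc : locally p (fun q => forall w, a <= w <= b -> u - e < w < u + e -> P q w)).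
  { exists e. intros q Hq w _ Hw. apply (He (q, w)). split; [exact Hq|].
    apply Rabs_def1; unfold minus, plus, opp; simpl; lra. }
  destruct (Rlt_le_dec (u - e / 2) a) as [Hl|Hl].
  - pose proof (cond_pos e).
    eapply filter_imp; [|exact Hc]. intros q Hq w Hw. apply Hq; lra.
  - pose proof (cond_pos e).
    generalize (filter_and _ _ Hc (IH (u - e / 2) ltac:(lra))).
    apply filter_imp. intros q [Hq1 Hq2] w Hw.
    destruct (Rle_lt_dec w (u - e / 2)); [apply Hq2; lra | apply Hq1; lra].
Qed.

Lemma continuous_R {T : UniformSpace} (f : T -> R) (p : T) :
  continuous f p <-> forall e, 0 < e -> locally p (fun q => Rabs (f q - f p) < e).
Proof.
  split.
  - intros H e He. apply (H (fun y => Rabs (y - f p) < e)).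
    exists (mkposreal e He). intros y Hy. exact Hy.
  - intros H P [e He]. unfold filtermap. generalize (H e (cond_pos e)). apply filter_imp.
    intros q Hq. apply He. exact Hq.
Qed.

Lemma continuous_pair_r {U V W : UniformSpace} (f : U * V -> W) (x : U) (y : V) :
  continuous f (x, y) -> continuous (fun v => f (x, v)) y.
Proof.
  intros Hf. apply (continuous_comp (fun v => (x, v)) f); [|exact Hf].
  intros P [d Hd]. exists d. intros v Hv. apply Hd. split; [apply ball_center | exact Hv].
Qed.

Lemma is_derive_continuous (f : R -> R) (x l : R) : is_derive f x l -> continuous f x.
Proof. intros H. apply (ex_derive_continuous f). exists l. exact H. Qed.

Lemma is_derive_continuity_pt (f : R -> R) (x l : R) : is_derive f x l -> continuity_pt f x.
Proof. intros H. eapply continuity_pt_filterlim, is_derive_continuous, H. Qed.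

Lemma is_derive_linear (k x : R) : is_derive (fun v : R => k * v) x k.
Proof. auto_derive; [exact I | ring]. Qed.

(** The tube lemma makes [g q] uniformly close to [g p] on [0, 1]. Joint continuity at (p, u) is
    used twice, since both [g q v] and [g p v] are compared with [g p u]. *)
Lemma continuous_RInt_01 {T : UniformSpace} (g : T -> R -> R) (p : T) :
  locally p (fun q => ex_RInt (g q) 0 1) ->
  (forall u, 0 <= u <= 1 -> continuous (fun q => g (fst q) (snd q)) (p, u)) ->
  continuous (fun q => RInt (g q) 0 1) p.
Proof.
  intros Hex Hc. apply continuous_R. intros e He.
  assert (H : locally p (fun q => forall u, 0 <= u <= 1 -> Rabs (g q u - g p u) <= e / 2)).
  { apply (tube_lemma (fun q u => Rabs (g q u - g p u) <= e / 2)). intros u Hu.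
    assert (Hc1 := proj1 (continuous_R _ _) (Hc u Hu) (e / 4) ltac:(lra)). simpl in Hc1.
    assert (Hc2 : locally (p, u) (fun q : T * R => Rabs (g p (snd q) - g p u) < e / 4)).
    { destruct Hc1 as [d Hd]. exists d. intros [q v] [_ Hv]. simpl.
      apply (Hd (p, v)). split; [apply ball_center | exact Hv]. }
    generalize (filter_and _ _ Hc1 Hc2). apply filter_imp. intros [q v]; simpl.
    intros [H1 H2]. apply Rabs_def2 in H1. apply Rabs_def2 in H2.
    apply Rabs_le. lra. }
  generalize (filter_and _ _ Hex H). apply filter_imp. intros q [Hq1 Hq2].
  assert (Hex0 := locally_singleton _ _ Hex).
  change (Rabs (minus (RInt (g q) 0 1) (RInt (g p) 0 1)) < e).
  rewrite <- RInt_minus by assumption.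
  apply Rle_lt_trans with ((1 - 0) * (e / 2)); [|lra].
  apply abs_RInt_le_const; [lra | apply @ex_RInt_minus; assumption | exact Hq2].
Qed.

Lemma ex_RInt_cont (f : R -> R) (a b : R) :
  (forall z, Rmin a b <= z <= Rmax a b -> continuous f z) -> ex_RInt f a b.
Proof. apply (@ex_RInt_continuous R_CompleteNormedModule). Qed.

Lemma RInt_affine (f : R -> R) (a b : R) :
  (forall z, Rmin a b <= z <= Rmax a b -> continuous f z) ->
  RInt f a b = (b - a) * RInt (fun t => f (a + t * (b - a))) 0 1.
Proof.
  intros Hf.
  assert (Hex : ex_RInt f ((b - a) * 0 + a) ((b - a) * 1 + a)).
  { replace ((b - a) * 0 + a) with a by ring. replace ((b - a) * 1 + a) with b by ring.
    apply ex_RInt_cont. exact Hf. }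
  assert (H := RInt_comp_lin f (b - a) a 0 1 Hex).
  replace ((b - a) * 0 + a) with a in H by ring. replace ((b - a) * 1 + a) with b in H by ring.
  rewrite <- H.
  transitivity (RInt (fun t => scal (b - a) (f (a + t * (b - a)))) 0 1).
  { apply RInt_ext. intros x _. f_equal. f_equal. ring. }
  apply (@RInt_scal R_CompleteNormedModule). apply ex_RInt_cont. intros z Hz.
  rewrite Rmin_left, Rmax_right in Hz by lra.
  apply (continuous_comp (fun t => a + t * (b - a)) f).
  - apply (continuous_plus (fun _ : R => a) (fun t : R => t * (b - a))).
    + apply continuous_const.
    + apply (continuous_mult (fun t : R => t) (fun _ : R => b - a));
        [apply continuous_id | apply continuous_const].
  - apply Hf. unfold Rmin, Rmax. destruct Rle_dec; nra.
Qed.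

Lemma between_affine (a b t : R) :
  0 <= t <= 1 -> Rmin a b <= a + t * (b - a) <= Rmax a b.
Proof. intros Ht. unfold Rmin, Rmax. destruct Rle_dec; nra. Qed.

(** The affine substitution onto [0, 1] moves the variable end points into the integrand. *)
Lemma continuous_RInt_param {T : UniformSpace} (f : T -> R -> R) (a b : T -> R) (p : T) :
  continuous a p -> continuous b p ->
  (forall z, Rmin (a p) (b p) <= z <= Rmax (a p) (b p) ->
     continuous (fun q => f (fst q) (snd q)) (p, z)) ->
  locally p (fun q => forall z, Rmin (a q) (b q) <= z <= Rmax (a q) (b q) ->
     continuous (f q) z) ->
  continuous (fun q => RInt (f q) (a q) (b q)) p.
Proof.
  intros Ha Hb Hf Hloc.
  assert (Hcomp : locally p (fun q => forall u, 0 <= u <= 1 ->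
            continuous (fun t => f q (a q + t * (b q - a q))) u)).
  { revert Hloc. apply filter_imp. intros q Hq u Hu.
    apply (continuous_comp (fun t => a q + t * (b q - a q)) (f q)).
    - apply (continuous_plus (fun _ : R => a q) (fun t : R => t * (b q - a q))).
      + apply continuous_const.
      + apply (continuous_mult (fun t : R => t) (fun _ : R => b q - a q));
          [apply continuous_id | apply continuous_const].
    - apply Hq. apply between_affine, Hu. }
  apply continuous_ext_loc with
    (fun q => (b q - a q) * RInt (fun t => f q (a q + t * (b q - a q))) 0 1).
  { revert Hloc. apply filter_imp. intros q Hq. symmetry. apply RInt_affine. exact Hq. }
  apply (continuous_mult (fun q => b q - a q)).
  - apply (continuous_minus b a); assumption.
  - apply continuous_RInt_01.
    + revert Hcomp. apply filter_imp. intros q Hq. apply ex_RInt_cont.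
      rewrite Rmin_left, Rmax_right by lra. exact Hq.
    + intros u Hu.
      apply (continuous_comp_2 (fun q : T * R => fst q)
               (fun q : T * R => a (fst q) + snd q * (b (fst q) - a (fst q)))
               f (p, u)).
      * apply continuous_fst.
      * assert (Ha' : continuous (fun q : T * R => a (fst q)) (p, u)).
        { apply (continuous_comp fst a); [apply continuous_fst | exact Ha]. }
        assert (Hb' : continuous (fun q : T * R => b (fst q)) (p, u)).
        { apply (continuous_comp fst b); [apply continuous_fst | exact Hb]. }
        apply (continuous_plus (fun q : T * R => a (fst q))); [exact Ha'|].
        apply (continuous_mult (fun q : T * R => snd q)); [apply continuous_snd|].
        apply (continuous_minus (fun q : T * R => b (fst q))); assumption.
      * apply Hf. apply between_affine, Hu.
Qed.

(* The square avoids differentiating [Rabs D]. *)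
Lemma gronwall (D D' : R -> R) (L e s1 s : R) :
  0 <= L -> 0 <= e ->
  (forall t, Rmin s1 s < t < Rmax s1 s ->
     is_derive D t (D' t) /\ Rabs (D' t) <= L * Rabs (D t) + e) ->
  (forall t, Rmin s1 s <= t <= Rmax s1 s -> continuity_pt D t) ->
  D s ^ 2 <= (D s1 ^ 2 + e ^ 2) * exp ((2 * L + 1) * Rabs (s - s1)).
Proof.
  intros HL He HD HC.
  (* The derivative of D^2 is at most 2 L D^2 + 2 |D| e in absolute value, and 2 |D| e <= D^2 + e^2
     accounts for the extra 1. *)
  set (C := 2 * L + 1).
  set (k := if Rle_dec s1 s then 1 else -1).
  set (phi := fun t => (D t ^ 2 + e ^ 2) * exp (- k * C * (t - s1))).
  set (dphi := fun t => exp (- k * C * (t - s1)) *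
                 (2 * D t * D' t - k * C * (D t ^ 2 + e ^ 2))).
  (* [MVT_gen] may return an end point, where nothing is assumed about D'. Putting 0 there makes the
     required inequality trivial in that case. *)
  set (df := fun t => if excluded_middle_informative (Rmin s1 s < t < Rmax s1 s)
                      then dphi t else 0).
  destruct (MVT_gen phi s1 s df) as [c [Hc Heq]].
  - intros t Ht. unfold df. destruct excluded_middle_informative as [_|n]; [|tauto].
    destruct (HD t Ht) as [Hd _]. unfold phi, dphi.
    auto_derive; [exists (D' t); exact Hd|].
    replace (Derive (fun x : R => D x) t) with (D' t)
      by (symmetry; apply is_derive_unique; exact Hd). unfold Rminus; simpl; ring.
  - intros t Ht. specialize (HC t Ht).
    unfold phi. apply continuity_pt_mult.
    + apply continuity_pt_plus; [|apply continuity_pt_const; intros ? ?; reflexivity].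
      apply (continuity_pt_ext (fun t => D t * D t)); [intros; ring|].
      apply continuity_pt_mult; assumption.
    + apply derivable_continuous_pt. exists (- k * C * exp (- k * C * (t - s1))).
      apply is_derive_Reals. auto_derive; [exact I|]. unfold Rminus; ring.
  - assert (Hneg : df c * (s - s1) <= 0).
    { unfold df. destruct excluded_middle_informative as [Hopen|_]; [|lra].
      destruct (HD c Hopen) as [_ Hb]. unfold dphi.
      assert (Hp := exp_pos (- k * C * (c - s1))).
      set (E := exp (- k * C * (c - s1))) in *.
      assert (Hbound : Rabs (2 * D c * D' c) <= C * (D c ^ 2 + e ^ 2)).
      { rewrite !Rabs_mult, (Rabs_right 2) by lra.
        pose proof (Rabs_pos (D c)). rewrite <- (pow2_abs (D c)).
        unfold C.
        apply Rle_trans with (2 * Rabs (D c) * (L * Rabs (D c) + e)).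
        - apply Rmult_le_compat_l; [lra|exact Hb].
        - assert (0 <= (Rabs (D c) - e) ^ 2) by apply pow2_ge_0.
          assert (0 <= L * e ^ 2) by (apply Rmult_le_pos; [lra|apply pow2_ge_0]).
          nra. }
      apply Rabs_le_between in Hbound.
      revert Hc Hopen. unfold k, Rmin, Rmax. destruct Rle_dec; intros.
      - assert (E * (2 * D c * D' c - 1 * C * (D c ^ 2 + e ^ 2)) <= 0); [|nra].
        assert (2 * D c * D' c - 1 * C * (D c ^ 2 + e ^ 2) <= 0) by lra. nra.
      - assert (0 <= E * (2 * D c * D' c - -1 * C * (D c ^ 2 + e ^ 2))); [|nra].
        apply Rmult_le_pos; lra. }
    rewrite <- Heq in Hneg. unfold phi in Hneg.
    replace (s1 - s1) with 0 in Hneg by ring. rewrite Rmult_0_r, exp_0 in Hneg.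
    replace (Rabs (s - s1)) with (k * (s - s1)).
    2:{ unfold k. destruct Rle_dec; [rewrite Rabs_right|rewrite Rabs_left]; lra. }
    replace (C * (k * (s - s1))) with (k * C * (s - s1)) by ring.
    assert (Hp := exp_pos (k * C * (s - s1))).
    assert (Hinv : exp (- k * C * (s - s1)) * exp (k * C * (s - s1)) = 1).
    { rewrite <- exp_plus. replace (- k * C * (s - s1) + k * C * (s - s1)) with 0 by ring.
      apply exp_0. }
    assert (0 <= e ^ 2) by apply pow2_ge_0.
    apply Rle_trans with ((D s ^ 2 + e ^ 2) * (exp (- k * C * (s - s1)) * exp (k * C * (s - s1)))).
    + rewrite Hinv. lra.
    + rewrite <- Rmult_assoc. apply Rmult_le_compat_r; lra.
Qed.

Lemma gronwall_zero (D D' : R -> R) (L s1 s : R) :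
  0 <= L ->
  (forall t, Rmin s1 s < t < Rmax s1 s ->
     is_derive D t (D' t) /\ Rabs (D' t) <= L * Rabs (D t)) ->
  (forall t, Rmin s1 s <= t <= Rmax s1 s -> continuity_pt D t) ->
  D s1 = 0 -> D s = 0.
Proof.
  intros HL HD HC H0.
  assert (H := gronwall D D' L 0 s1 s HL (Rle_refl 0)).
  rewrite H0 in H.
  assert (Hs : D s ^ 2 <= 0).
  { eapply Rle_trans; [apply H|]; [|exact HC|right; ring].
    intros t Ht. destruct (HD t Ht). split; [assumption|lra]. }
  assert (0 <= D s ^ 2) by apply pow2_ge_0. nra.
Qed.

(** * Existence and continuous dependence of solutions *)

(** Integration gains a factor 1/C in the norm weighted by exp(C |t - a|). With a large C the Picard
    operator contracts on the whole line at once, without gluing short intervals. *)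
Lemma abs_RInt_le_exp (f : R -> R) (a s K C : R) :
  0 < C -> (forall t, continuous f t) ->
  (forall t, Rabs (f t) <= K * exp (C * Rabs (t - a))) ->
  Rabs (RInt f a s) <= K / C * exp (C * Rabs (s - a)).
Proof.
  intros HC Hf Hb.
  assert (HK : 0 <= K).
  { assert (H := Hb a). assert (H1 := Rabs_pos (f a)).
    assert (H2 := exp_pos (C * Rabs (a - a))). nra. }
  set (k := if Rle_dec a s then 1 else -1).
  assert (Hmain : forall e, e = 1 \/ e = -1 ->
            e * RInt f a s <= K / C * (exp (C * Rabs (s - a)) - 1)).
  { intros e He.
    assert (Hder : forall t, is_derive (fun t => e * RInt f a t - K / C * exp (k * C * (t - a))) t
              (e * f t - k * K * exp (k * C * (t - a)))).
    { intros t. apply (is_derive_minus (fun t => e * RInt f a t)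
        (fun t => K / C * exp (k * C * (t - a)))).
      - apply (is_derive_scal (fun t => RInt f a t)).
        apply is_derive_RInt with a; [|apply Hf].
        apply filter_forall. intros u. apply (@RInt_correct R_CompleteNormedModule), ex_RInt_cont.
        intros; apply Hf.
      - auto_derive; [exact I|]. unfold Rminus. field. lra. }
    destruct (MVT_gen _ a s _ (fun t _ => Hder t)
                (fun t _ => is_derive_continuity_pt _ t _ (Hder t))) as [c [Hc Heq]].
    assert (Hneg : (e * f c - k * K * exp (k * C * (c - a))) * (s - a) <= 0).
    { assert (Hbc := Hb c). revert Hc Heq Hbc. unfold k, Rmin, Rmax.
      destruct Rle_dec; intros Hc _ Hbc.
      - rewrite (Rabs_right (c - a)) in Hbc by lra. apply Rabs_le_between in Hbc.
        replace (1 * C * (c - a)) with (C * (c - a)) by ring.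
        assert (e * f c - 1 * K * exp (C * (c - a)) <= 0) by (destruct He; subst; lra). nra.
      - rewrite (Rabs_left1 (c - a)) in Hbc by lra. apply Rabs_le_between in Hbc.
        replace (-1 * C * (c - a)) with (C * - (c - a)) by ring.
        assert (0 <= e * f c - -1 * K * exp (C * - (c - a))) by (destruct He; subst; lra). nra. }
    rewrite <- Heq in Hneg. rewrite RInt_point in Hneg. unfold zero in Hneg; simpl in Hneg.
    replace (a - a) with 0 in Hneg by ring. rewrite !Rmult_0_r, exp_0 in Hneg.
    replace (k * C * (s - a)) with (C * Rabs (s - a)) in Hneg; [lra|].
    unfold k. destruct Rle_dec; [rewrite Rabs_right|rewrite Rabs_left]; lra. }
  assert (0 <= K / C) by (apply Rdiv_le_0_compat; lra).
  apply Rabs_le. assert (H1 := Hmain 1 (or_introl eq_refl)).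
  assert (H2 := Hmain (-1) (or_intror eq_refl)). lra.
Qed.

Lemma continuous_field_along (F : R -> R -> R) (u : R -> R) (t : R) :
  (forall p : R * R, continuous (fun q => F (fst q) (snd q)) p) ->
  continuous u t -> continuous (fun s => F s (u s)) t.
Proof.
  intros HF Hu. apply (continuous_comp_2 (fun s : R => s) u F).
  - apply continuous_id.
  - exact Hu.
  - apply HF.
Qed.

Lemma continuous_of_lipschitz (u : R -> R) (B : R) :
  (forall s t, Rabs (u s - u t) <= B * Rabs (s - t)) -> forall t, continuous u t.
Proof.
  intros H t. assert (HB : 0 <= B).
  { assert (H1 := H 1 0). assert (H2 := Rabs_pos (u 1 - u 0)).
    rewrite Rminus_0_r, Rabs_R1 in H1. lra. }
  apply continuous_R. intros e He.
  assert (Hd : 0 < e / (B + 1)) by (apply Rdiv_lt_0_compat; lra).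
  exists (mkposreal _ Hd). intros y Hy. assert (Hy' : Rabs (y - t) < e / (B + 1)) by exact Hy.
  eapply Rle_lt_trans; [apply H|].
  apply Rle_lt_trans with (B * (e / (B + 1))).
  - apply Rmult_le_compat_l; lra.
  - apply Rlt_le_trans with ((B + 1) * (e / (B + 1))); [|right; field; lra].
    apply Rmult_lt_compat_r; lra.
Qed.

Section Picard.
Variables (F : R -> R -> R) (B L a : R).
Hypothesis Fcont : forall p : R * R, continuous (fun q => F (fst q) (snd q)) p.
Hypothesis Fbound : forall x y, Rabs (F x y) <= B.
Hypothesis Flip : forall x y z, Rabs (F x y - F x z) <= L * Rabs (y - z).
Hypothesis HL : 1 <= L.

Fixpoint picard (k : nat) (s : R) : R :=
  match k with
  | O => 0
  | S j => RInt (fun t => F t (picard j t)) a s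
  end.

Lemma RInt_lipschitz (f : R -> R) :
  (forall t, continuous f t) -> (forall t, Rabs (f t) <= B) ->
  forall s t, Rabs (RInt f a s - RInt f a t) <= B * Rabs (s - t).
Proof.
  intros Hf Hb s t.
  assert (Hex : forall x y, ex_RInt f x y) by (intros; apply ex_RInt_cont; intros; apply Hf).
  replace (RInt f a s - RInt f a t) with (RInt f t s).
  2:{ assert (H : RInt f a t + RInt f t s = RInt f a s) by (apply (RInt_Chasles f); apply Hex).
      lra. }
  destruct (Rle_lt_dec t s).
  - rewrite (Rabs_right (s - t)) by lra. rewrite Rmult_comm. apply abs_RInt_le_const; auto.
  - assert (H : - RInt f s t = RInt f t s) by (apply (opp_RInt_swap f); apply Hex).
    rewrite <- H, Rabs_Ropp.
    rewrite (Rabs_left (s - t)) by lra.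
    replace (B * - (s - t)) with ((t - s) * B) by ring.
    apply abs_RInt_le_const; [lra| |]; auto.
Qed.

Lemma picard_lipschitz k s t : Rabs (picard k s - picard k t) <= B * Rabs (s - t).
Proof.
  revert s t; induction k as [|k IH]; intros s t.
  - simpl. rewrite Rminus_0_r, Rabs_R0.
    apply Rmult_le_pos; [|apply Rabs_pos]. eapply Rle_trans; [apply Rabs_pos | apply (Fbound 0 0)].
  - apply RInt_lipschitz; [|intros; apply Fbound].
    intros r. apply continuous_field_along; [exact Fcont|].
    exact (continuous_of_lipschitz _ B IH r).
Qed.

Lemma picard_continuous k t : continuous (picard k) t.
Proof. exact (continuous_of_lipschitz _ B (picard_lipschitz k) t). Qed.

(** The weight 2L is chosen against the Lipschitz constant L so that the contraction factor is
    1/2. *)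
Lemma RInt_field_diff (u v : R -> R) (K s : R) :
  (forall t, continuous u t) -> (forall t, continuous v t) ->
  (forall t, Rabs (u t - v t) <= K * exp (2 * L * Rabs (t - a))) ->
  Rabs (RInt (fun t => F t (u t)) a s - RInt (fun t => F t (v t)) a s) <=
  K / 2 * exp (2 * L * Rabs (s - a)).
Proof.
  intros Hu Hv Huv.
  assert (Cu := fun t => continuous_field_along F u t Fcont (Hu t)).
  assert (Cv := fun t => continuous_field_along F v t Fcont (Hv t)).
  change (Rabs (minus (RInt (fun t => F t (u t)) a s) (RInt (fun t => F t (v t)) a s)) <=
          K / 2 * exp (2 * L * Rabs (s - a))).
  rewrite <- RInt_minus by (apply ex_RInt_cont; intros; auto).
  replace (K / 2) with ((L * K) / (2 * L)) by (field; lra).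
  apply abs_RInt_le_exp; [lra| |].
  - intros t. apply @continuous_minus; auto.
  - intros t. unfold minus, plus, opp; simpl.
    eapply Rle_trans; [apply Flip|]. rewrite Rmult_assoc.
    apply Rmult_le_compat_l; [lra | apply Huv].
Qed.

Lemma picard_step k s :
  Rabs (picard (S k) s - picard k s) <= B * (/ 2) ^ k * exp (2 * L * Rabs (s - a)).
Proof.
  revert s; induction k as [|k IH]; intros s.
  - assert (HB : 0 <= B) by (eapply Rle_trans; [apply Rabs_pos | apply (Fbound 0 0)]).
    replace (picard 1 s - picard 0 s) with (picard 1 s - picard 1 a).
    2:{ simpl. rewrite RInt_point. reflexivity. }
    eapply Rle_trans; [apply picard_lipschitz|].
    rewrite pow_O, Rmult_1_r. apply Rmult_le_compat_l; [exact HB|].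
    assert (H := exp_ineq1_le (2 * L * Rabs (s - a))).
    assert (0 <= Rabs (s - a)) by apply Rabs_pos. nra.
  - change (Rabs (RInt (fun t => F t (picard (S k) t)) a s - RInt (fun t => F t (picard k t)) a s)
            <= B * (/ 2) ^ S k * exp (2 * L * Rabs (s - a))).
    replace (B * (/ 2) ^ S k) with ((B * (/ 2) ^ k) / 2) by (simpl; field).
    apply RInt_field_diff; auto using picard_continuous.
Qed.

(** The factor 1 - (/ 2)^m keeps the partial geometric sum exact, so that the induction on m
    closes. *)
Lemma picard_tail k m s :
  Rabs (picard (k + m) s - picard k s) <=
  2 * B * (/ 2) ^ k * (1 - (/ 2) ^ m) * exp (2 * L * Rabs (s - a)).
Proof.
  induction m as [|m IH].
  - rewrite Nat.add_0_r, Rminus_diag, Rabs_R0, pow_O. right. ring.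
  - rewrite Nat.add_succ_r.
    replace (picard (S (k + m)) s - picard k s) with
      ((picard (S (k + m)) s - picard (k + m) s) + (picard (k + m) s - picard k s)) by ring.
    eapply Rle_trans; [apply Rabs_triang|].
    assert (H := picard_step (k + m) s). rewrite pow_add in H.
    simpl pow. lra.
Qed.

Lemma picard_tail' k j s : (k <= j)%nat ->
  Rabs (picard j s - picard k s) <= 2 * B * (/ 2) ^ k * exp (2 * L * Rabs (s - a)).
Proof.
  intros Hkj. replace j with (k + (j - k))%nat by lia.
  eapply Rle_trans; [apply picard_tail|].
  assert (HB : 0 <= B) by (eapply Rle_trans; [apply Rabs_pos | apply (Fbound 0 0)]).
  assert (H1 : 0 <= (/ 2) ^ (j - k)) by (apply pow_le; lra).
  assert (H2 : 0 <= (/ 2) ^ k) by (apply pow_le; lra).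
  apply Rmult_le_compat_r; [left; apply exp_pos|].
  rewrite <- (Rmult_1_r (2 * B * (/ 2) ^ k)) at 2.
  apply Rmult_le_compat_l; [|lra]. apply Rmult_le_pos; lra.
Qed.

Lemma half_pow_small (K e : R) : 0 < e -> exists k, forall j, (k <= j)%nat -> K * (/ 2) ^ j < e.
Proof.
  intros He.
  destruct (pow_lt_1_zero (/ 2) ltac:(rewrite Rabs_right; lra) (e / (Rabs K + 1))) as [k Hk].
  { apply Rdiv_lt_0_compat; [lra|]. pose proof (Rabs_pos K). lra. }
  exists k. intros j Hj. specialize (Hk j Hj).
  assert (H0 : 0 < (/ 2) ^ j) by (apply pow_lt; lra).
  rewrite Rabs_right in Hk by lra.
  assert (0 <= Rabs K) by apply Rabs_pos.
  apply Rle_lt_trans with ((Rabs K + 1) * (/ 2) ^ j).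
  - apply Rmult_le_compat_r; [lra|]. pose proof (Rle_abs K). lra.
  - apply Rlt_le_trans with ((Rabs K + 1) * (e / (Rabs K + 1))); [|right; field; lra].
    apply Rmult_lt_compat_l; lra.
Qed.

Lemma picard_cvg s : ex_finite_lim_seq (fun k => picard k s).
Proof.
  apply ex_lim_seq_cauchy_corr. intros e.
  destruct (half_pow_small (2 * B * exp (2 * L * Rabs (s - a))) (e / 2)) as [k Hk].
  { pose proof (cond_pos e). lra. }
  assert (Hk' := Hk k (le_n k)). exists k. intros n m Hn Hm.
  replace (picard n s - picard m s) with
    ((picard n s - picard k s) - (picard m s - picard k s)) by ring.
  eapply Rle_lt_trans; [apply Rabs_triang|]. rewrite Rabs_Ropp.
  assert (H1 := picard_tail' k n s Hn). assert (H2 := picard_tail' k m s Hm). lra.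
Qed.

Lemma ode_exists :
  exists u : R -> R, u a = 0 /\ forall s, is_derive u s (F s (u s)).
Proof.
  set (u := fun s => real (Lim_seq (fun k => picard k s))).
  assert (Hlim : forall s, is_lim_seq (fun k => picard k s) (u s)).
  { intros s. apply Lim_seq_correct', picard_cvg. }
  assert (Hdist : forall k s,
    Rabs (u s - picard k s) <= 2 * B * (/ 2) ^ k * exp (2 * L * Rabs (s - a))).
  { intros k s.
    assert (H1 : is_lim_seq (fun j => Rabs (picard (j + k) s - picard k s))
                   (Rabs (u s - picard k s))).
    { apply (is_lim_seq_abs _ (Finite (u s - picard k s))).
      apply is_lim_seq_minus'; [|apply is_lim_seq_const].
      apply is_lim_seq_incr_n with (u := fun j => picard j s). apply Hlim. }
    assert (H2 := is_lim_seq_le _ _ _ _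
      (fun j => picard_tail' k (j + k) s ltac:(lia)) H1 (is_lim_seq_const _)).
    exact H2. }
  (* The iterates share the Lipschitz constant B, which passes to the pointwise limit; no theorem on
     uniform limits is called upon. *)
  assert (Hulip : forall s t, Rabs (u s - u t) <= B * Rabs (s - t)).
  { intros s t.
    assert (H1 : is_lim_seq (fun j => Rabs (picard j s - picard j t)) (Rabs (u s - u t))).
    { apply (is_lim_seq_abs _ (Finite (u s - u t))). apply is_lim_seq_minus'; apply Hlim. }
    exact (is_lim_seq_le _ _ _ _ (fun j => picard_lipschitz j s t) H1 (is_lim_seq_const _)). }
  assert (Hucont := continuous_of_lipschitz u B Hulip).
  (* Both sides are within a multiple of (/ 2)^k of [picard (S k) s], for every k. *)
  assert (Hint : forall s, u s = RInt (fun t => F t (u t)) a s).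
  { intros s. apply Rminus_diag_uniq.
    destruct (Req_dec (u s - RInt (fun t => F t (u t)) a s) 0) as [|Hne]; [assumption|].
    exfalso. set (d := Rabs (u s - RInt (fun t => F t (u t)) a s)).
    assert (Hd : 0 < d) by (apply Rabs_pos_lt, Hne).
    destruct (half_pow_small (2 * B * exp (2 * L * Rabs (s - a))) (d / 2)) as [k Hk]; [lra|].
    specialize (Hk k (le_n k)).
    assert (H1 := Hdist (S k) s).
    assert (H2 := RInt_field_diff u (picard k) (2 * B * (/ 2) ^ k) s Hucont
                    (picard_continuous k) (Hdist k)).
    change (RInt (fun t => F t (picard k t)) a s) with (picard (S k) s) in H2.
    assert (H3 : d <= Rabs (u s - picard (S k) s) +
      Rabs (RInt (fun t => F t (u t)) a s - picard (S k) s)).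
    { unfold d. replace (u s - RInt (fun t => F t (u t)) a s) with
        ((u s - picard (S k) s) - (RInt (fun t => F t (u t)) a s - picard (S k) s)) by ring.
      eapply Rle_trans; [apply Rabs_triang|]. rewrite Rabs_Ropp. lra. }
    simpl pow in H1. lra. }
  exists u. split.
  - rewrite Hint. exact (RInt_point a (fun t => F t (u t))).
  - intros s. apply is_derive_ext with (fun s => RInt (fun t => F t (u t)) a s).
    { intros t. symmetry. apply Hint. }
    assert (C := fun t => continuous_field_along F u t Fcont (Hucont t)).
    apply (is_derive_RInt (fun t => F t (u t)) _ a); [|apply C].
    apply filter_forall. intros t. apply (@RInt_correct R_CompleteNormedModule), ex_RInt_cont. intros; apply C.
Qed.

End Picard.

Definition cont3 {T : UniformSpace} (f : T -> R -> R -> R) (X : T) (s a : R) : Prop :=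
  continuous (fun q : T * (R * R) => f (fst q) (fst (snd q)) (snd (snd q))) (X, (s, a)).

Lemma cont3_eps {T : UniformSpace} (f : T -> R -> R -> R) X s a :
  cont3 f X s a <->
  forall e, 0 < e -> exists d : posreal, forall Y u b,
    ball X d Y -> Rabs (u - s) < d -> Rabs (b - a) < d -> Rabs (f Y u b - f X s a) < e.
Proof.
  unfold cont3. rewrite continuous_R. split; intros H e He; destruct (H e He) as [d Hd]; exists d.
  - intros Y u b HY Hu Hb. apply (Hd (Y, (u, b))). split; [exact HY|]. split; assumption.
  - intros [Y [u b]] [HY [Hu Hb]]. exact (Hd Y u b HY Hu Hb).
Qed.

Lemma cont3_comp {T : UniformSpace} (f u v : T -> R -> R -> R) X s a :
  cont3 u X s a -> cont3 v X s a -> cont3 f X (u X s a) (v X s a) ->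
  cont3 (fun X s a => f X (u X s a) (v X s a)) X s a.
Proof.
  rewrite !cont3_eps. intros Hu Hv Hf e He.
  destruct (Hf e He) as [d Hd].
  destruct (Hu d (cond_pos d)) as [d1 Hd1]. destruct (Hv d (cond_pos d)) as [d2 Hd2].
  assert (Hm : 0 < Rmin d (Rmin d1 d2)) by (repeat apply Rmin_glb_lt; apply cond_pos).
  exists (mkposreal _ Hm). simpl. intros Y t b HY Ht Hb.
  pose proof (Rmin_l d (Rmin d1 d2)). pose proof (Rmin_r d (Rmin d1 d2)).
  pose proof (Rmin_l d1 d2). pose proof (Rmin_r d1 d2).
  apply Hd.
  - apply ball_le with (2 := HY). lra.
  - apply Hd1; [apply ball_le with (2 := HY)| |]; lra.
  - apply Hd2; [apply ball_le with (2 := HY)| |]; lra.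
Qed.

Section Solution.
Context {T : UniformSpace}.
Variables (F : T -> R -> R -> R) (B L : R).
Hypothesis Fcont : forall X x y, cont3 F X x y.
Hypothesis Fbound : forall X x y, Rabs (F X x y) <= B.
Hypothesis Flip : forall X x y z, Rabs (F X x y - F X x z) <= L * Rabs (y - z).
Hypothesis HL : 1 <= L.

Lemma bounded_derive_lipschitz (u du : R -> R) (K : R) :
  (forall s, is_derive u s (du s)) -> (forall s, Rabs (du s) <= K) ->
  forall s t, Rabs (u s - u t) <= K * Rabs (s - t).
Proof.
  intros Hu Hb s t. destruct (MVT_gen u t s du) as [c [_ Hc]].
  - intros; apply Hu.
  - intros x _. apply derivable_continuous_pt. exists (du x). apply is_derive_Reals, Hu.
  - rewrite Hc, Rabs_mult. apply Rmult_le_compat_r; [apply Rabs_pos | apply Hb].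
Qed.

Lemma field_continuous X : forall p : R * R, continuous (fun q => F X (fst q) (snd q)) p.
Proof.
  intros [x y].
  exact (continuous_pair_r (fun q : T * (R * R) => F (fst q) (fst (snd q)) (snd (snd q)))
    X (x, y) (Fcont X x y)).
Qed.

(** Continuity in (X, s, a) together: the solutions for (X, a) and (X1, a1) are compared by Gronwall
    from the abscissa a1, where they differ by at most B |a - a1|. The forcing term is the change of
    the field along the fixed solution, uniformly small by the tube lemma. *)
Lemma flow_graph_exists :
  exists Y : T -> R -> R -> R,
    (forall X a, Y X a a = 0) /\
    (forall X s a, is_derive (fun s => Y X s a) s (F X s (Y X s a))) /\
    (forall X s a, cont3 Y X s a).
Proof.
  assert (Hex : forall (X : T) (a : R), { u : R -> R | u a = 0 /\ forall s, is_derive u s (F X s (u s)) }).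
  { intros X a. apply constructive_indefinite_description.
    apply (ode_exists (F X) B L a (field_continuous X)); auto. }
  set (Y := fun X s a => proj1_sig (Hex X a) s).
  assert (H0 : forall X a, Y X a a = 0).
  { intros X a. unfold Y. destruct (Hex X a) as [u [Hu1 Hu2]]. exact Hu1. }
  assert (HY : forall X s a, is_derive (fun s => Y X s a) s (F X s (Y X s a))).
  { intros X s a. unfold Y. destruct (Hex X a) as [u [Hu1 Hu2]]. exact (Hu2 s). }
  exists Y. split; [exact H0|]. split; [exact HY|].
  (* B bounds an absolute value, hence is nonnegative as soon as there is a parameter. *)
  assert (HB : 0 <= B \/ ~ inhabited T).
  { destruct (classic (inhabited T)) as [[X]|]; [left|right; assumption].
    eapply Rle_trans; [apply Rabs_pos | apply (Fbound X 0 0)]. }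
  intros X1 s1 a1. destruct HB as [HB|HB]; [|exfalso; apply HB; constructor; exact X1].
  assert (Hlip : forall X a s t, Rabs (Y X s a - Y X t a) <= B * Rabs (s - t)).
  { intros X a s t. apply (bounded_derive_lipschitz (fun s => Y X s a) (fun s => F X s (Y X s a))).
    - intros; apply HY.
    - intros; apply Fbound. }
  apply cont3_eps. intros e He.
  set (lo := Rmin a1 s1 - 1). set (hi := Rmax a1 s1 + 1).
  set (M := exp ((2 * L + 1) * (hi - lo))).
  assert (Hlohi : lo < hi).
  { unfold lo, hi, Rmin, Rmax. destruct Rle_dec; lra. }
  assert (HM : 1 <= M).
  { unfold M. eapply Rle_trans; [|apply exp_ineq1_le]. nra. }
  (* With both errors at most e', Gronwall bounds the squared difference by 2 e'^2 M = e^2 / (8 M)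
     <= (e / 2)^2. *)
  set (e' := e / (4 * M)).
  assert (He' : 0 < e') by (apply Rdiv_lt_0_compat; lra).
  assert (Htube : locally X1 (fun X => forall t, lo <= t <= hi ->
            Rabs (F X t (Y X1 t a1) - F X1 t (Y X1 t a1)) <= e')).
  { apply (tube_lemma (fun X t => Rabs (F X t (Y X1 t a1) - F X1 t (Y X1 t a1)) <= e')).
    intros t _.
    assert (HC : cont3 (fun X t (_ : R) => F X t (Y X1 t a1)) X1 t 0).
    { apply (cont3_comp F (fun _ t _ => t) (fun _ t _ => Y X1 t a1)); [| |apply Fcont].
      - apply cont3_eps. intros d Hd. exists (mkposreal d Hd). tauto.
      - apply cont3_eps. intros d Hd.
        assert (Hp : 0 < d / (B + 1)) by (apply Rdiv_lt_0_compat; lra).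
        exists (mkposreal _ Hp). simpl. intros _ u _ _ Hu _.
        eapply Rle_lt_trans; [apply Hlip|].
        apply Rle_lt_trans with (B * (d / (B + 1))); [apply Rmult_le_compat_l; lra|].
        apply Rlt_le_trans with ((B + 1) * (d / (B + 1))); [|right; field; lra].
        apply Rmult_lt_compat_r; lra. }
    destruct (proj1 (cont3_eps _ _ _ _) HC (e' / 2) ltac:(lra)) as [d Hd].
    exists d. intros [X u] [HX Hu]. simpl in *.
    assert (A1 := Hd X u 0 HX Hu ltac:(rewrite Rminus_diag, Rabs_R0; apply cond_pos)).
    assert (A2 := Hd X1 u 0 (ball_center _ _) Hu ltac:(rewrite Rminus_diag, Rabs_R0; apply cond_pos)).
    simpl in *. apply Rabs_def2 in A1. apply Rabs_def2 in A2. apply Rabs_le. lra. }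
  destruct Htube as [d Hd].
  (* The last term makes B r at most e', for the error at a1, and at most e/4, for the move from s
     to s1. The bound 1 keeps s in [lo, hi]. *)
  set (r := Rmin (Rmin d 1) (Rmin e' (e / 4) / (B + 1))).
  assert (Hr : 0 < r).
  { unfold r. pose proof (cond_pos d). apply Rmin_glb_lt; [apply Rmin_glb_lt; lra|].
    apply Rdiv_lt_0_compat; [|lra]. apply Rmin_glb_lt; lra. }
  exists (mkposreal r Hr). simpl. intros X s a HX Hs Ha.
  assert (Hr1 : r <= d). { unfold r. eapply Rle_trans; apply Rmin_l. }
  assert (Hr2 : r <= 1). { unfold r. eapply Rle_trans; [apply Rmin_l|apply Rmin_r]. }
  assert (Hr3 : B * r <= Rmin e' (e / 4)).
  { assert (Hz : 0 < Rmin e' (e / 4)) by (apply Rmin_glb_lt; lra).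
    assert (r <= Rmin e' (e / 4) / (B + 1)) by apply Rmin_r.
    apply Rle_trans with ((B + 1) * (Rmin e' (e / 4) / (B + 1))); [|right; field; lra].
    apply Rmult_le_compat; lra. }
  pose proof (Rmin_l e' (e / 4)) as Hm1. pose proof (Rmin_r e' (e / 4)) as Hm2.
  assert (Hdiff : Rabs (Y X s a - Y X1 s a1) <= e / 2).
  { set (D := fun t => Y X t a - Y X1 t a1).
    assert (Hrange : forall t, Rmin a1 s <= t <= Rmax a1 s -> lo <= t <= hi).
    { apply Rabs_def2 in Hs. intros t. unfold lo, hi, Rmin, Rmax.
      destruct (Rle_dec a1 s); destruct (Rle_dec a1 s1); lra. }
    assert (HD : forall t, is_derive D t (F X t (Y X t a) - F X1 t (Y X1 t a1))).
    { intros t. apply (is_derive_minus (fun t => Y X t a)); apply HY. }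
    assert (G := gronwall D (fun t => F X t (Y X t a) - F X1 t (Y X1 t a1)) L e' a1 s
                   ltac:(lra) ltac:(lra)).
    assert (G1 : D s ^ 2 <= (D a1 ^ 2 + e' ^ 2) * exp ((2 * L + 1) * Rabs (s - a1))).
    { apply G.
      - intros t Ht. split; [apply HD|].
        replace (F X t (Y X t a) - F X1 t (Y X1 t a1)) with
          ((F X t (Y X t a) - F X t (Y X1 t a1)) + (F X t (Y X1 t a1) - F X1 t (Y X1 t a1))) by ring.
        eapply Rle_trans; [apply Rabs_triang|]. apply Rplus_le_compat; [apply Flip|].
        apply Hd; [apply ball_le with (2 := HX); exact Hr1 | apply Hrange; lra].
      - intros t _. eapply is_derive_continuity_pt, HD. }
    assert (G2 : exp ((2 * L + 1) * Rabs (s - a1)) <= M).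
    { assert (Hx : Rabs (s - a1) <= hi - lo).
      { assert (X1' := Hrange s ltac:(unfold Rmin, Rmax; destruct Rle_dec; lra)).
        assert (X2' := Hrange a1 ltac:(unfold Rmin, Rmax; destruct Rle_dec; lra)).
        apply Rabs_le. lra. }
      unfold M. destruct (Rle_lt_or_eq_dec _ _ Hx) as [Hlt|Heq].
      - left. apply exp_increasing. apply Rmult_lt_compat_l; lra.
      - rewrite Heq. lra. }
    assert (G3 : D a1 ^ 2 <= e' ^ 2).
    { rewrite <- (pow2_abs (D a1)). apply pow_incr. split; [apply Rabs_pos|].
      unfold D. rewrite H0. rewrite <- (H0 X a). eapply Rle_trans; [apply Hlip|].
      rewrite Rabs_minus_sym. apply Rle_trans with (B * r); [apply Rmult_le_compat_l; lra|lra]. }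
    assert (G4 : D s ^ 2 <= (e / 2) ^ 2).
    { eapply Rle_trans; [exact G1|].
      assert (0 <= D a1 ^ 2) by apply pow2_ge_0. assert (0 < e' ^ 2) by (apply pow_lt; lra).
      apply Rle_trans with ((2 * e' ^ 2) * M).
      - apply Rmult_le_compat; [lra | left; apply exp_pos | lra | exact G2].
      - unfold e'. replace (2 * (e / (4 * M)) ^ 2 * M) with (e ^ 2 / 8 * / M) by (field; lra).
        replace ((e / 2) ^ 2) with (e ^ 2 / 4 * 1) by field.
        assert (0 < e ^ 2) by (apply pow_lt; lra).
        apply Rmult_le_compat; [lra | left; apply Rinv_0_lt_compat; lra | lra |].
        rewrite <- Rinv_1. apply Rinv_le_contravar; lra. }
    fold (D s). rewrite <- (pow2_abs (D s)) in G4.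
    apply Rnot_lt_le. intros Hlt. apply (Rle_not_lt _ _ G4).
    assert (0 < e / 2) by lra. nra. }
  replace (Y X s a - Y X1 s1 a1) with ((Y X s a - Y X1 s a1) + (Y X1 s a1 - Y X1 s1 a1)) by ring.
  eapply Rle_lt_trans; [apply Rabs_triang|].
  assert (Hl := Hlip X1 a1 s s1).
  assert (B * Rabs (s - s1) <= e / 4).
  { apply Rle_trans with (B * r); [apply Rmult_le_compat_l; lra|lra]. }
  lra.
Qed.

End Solution.

(** * Calculus of jointly continuous families of smooth functions *)

Definition open2 (D : R -> R -> Prop) : Prop := forall s a, D s a -> locally_2d D s a.

(** Families whose partial derivatives in (s, a) up to order k are continuous in (X, s, a) jointly;
    nothing is differentiated in X. The derivatives are existential witnesses, so each calculus rule
    supplies its own formula and the order is lowered by structural recursion. *)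
Fixpoint Ck {T : UniformSpace} (D : R -> R -> Prop) (k : nat) (f : T -> R -> R -> R) : Prop :=
  (forall X s a, D s a -> cont3 f X s a) /\
  match k with
  | O => True
  | S j => exists f1 f2 : T -> R -> R -> R,
      (forall X s a, D s a -> is_derive (fun s => f X s a) s (f1 X s a)) /\
      (forall X s a, D s a -> is_derive (fun a => f X s a) a (f2 X s a)) /\
      Ck D j f1 /\ Ck D j f2
  end.

Lemma is_derive_comp_2 (f f1 f2 : R -> R -> R) (u v : R -> R) (t du dv : R) :
  locally_2d (fun x y => is_derive (fun z => f z y) x (f1 x y)) (u t) (v t) ->
  is_derive (fun z => f (u t) z) (v t) (f2 (u t) (v t)) ->
  continuity_2d_pt f1 (u t) (v t) ->
  is_derive u t du -> is_derive v t dv ->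
  is_derive (fun z => f (u z) (v z)) t (f1 (u t) (v t) * du + f2 (u t) (v t) * dv).
Proof.
  intros H1 H2 Hc Hu Hv. apply is_derive_Reals.
  apply derivable_pt_lim_comp_2d; [|apply is_derive_Reals, Hu|apply is_derive_Reals, Hv].
  apply filterdiff_differentiable_pt_lim.
  apply (is_derive_filterdiff f (u t) (v t) f1 (f2 (u t) (v t))).
  - apply locally_2d_locally in H1. exact H1.
  - exact H2.
  - apply continuity_2d_pt_filterlim in Hc. exact Hc.
Qed.

Section Calculus.
Context {T : UniformSpace}.
Implicit Types (f g : T -> R -> R -> R) (D E : R -> R -> Prop).

Lemma Ck_cont D k f X s a : Ck D k f -> D s a -> cont3 f X s a.
Proof. destruct k; intros [H _]; apply H. Qed.

Lemma Ck_S D k f : Ck D (S k) f -> Ck D k f.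
Proof.
  revert f; induction k as [|k IH]; intros f.
  - intros [H _]. split; [exact H|exact I].
  - intros [H [f1 [f2 [H1 [H2 [H3 H4]]]]]]. split; [exact H|].
    exists f1, f2. split; [|split; [|split]]; auto.
Qed.

Lemma Ck_le D j k f : (j <= k)%nat -> Ck D k f -> Ck D j f.
Proof. induction 1 as [|k _ IH]; [auto|]. intros H. apply IH, Ck_S, H. Qed.

Lemma locally_2d_fst (P : R -> R -> Prop) s a :
  locally_2d P s a -> locally s (fun u => P u a).
Proof.
  intros [d Hd]. exists d. intros u Hu. apply Hd; [exact Hu|].
  rewrite Rminus_diag, Rabs_R0. apply cond_pos.
Qed.

Lemma locally_2d_snd (P : R -> R -> Prop) s a :
  locally_2d P s a -> locally a (fun b => P s b).
Proof.
  intros [d Hd]. exists d. intros u Hu. apply Hd; [|exact Hu].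
  rewrite Rminus_diag, Rabs_R0. apply cond_pos.
Qed.

Lemma Ck_ext D k f g : open2 D -> (forall X s a, D s a -> f X s a = g X s a) ->
  Ck D k f -> Ck D k g.
Proof.
  intros HD Hfg Hf.
  assert (Hc : forall X s a, D s a -> cont3 g X s a).
  { intros X s a Hsa. apply continuous_ext_loc with
      (fun q : T * (R * R) => f (fst q) (fst (snd q)) (snd (snd q))).
    - destruct (HD s a Hsa) as [d Hd]. exists d. intros [Y [u b]] [_ [Hu Hb]].
      simpl. apply Hfg. apply Hd; assumption.
    - exact (Ck_cont D k f X s a Hf Hsa). }
  destruct k as [|k]; split; auto.
  destruct Hf as [_ [f1 [f2 [H1 [H2 [H3 H4]]]]]]. exists f1, f2.
  split; [|split]; [| |auto]; intros X s a Hsa.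
  - apply is_derive_ext_loc with (fun s => f X s a); [|auto].
    generalize (locally_2d_fst _ _ _ (HD s a Hsa)). apply filter_imp. intros u Hu. auto.
  - apply is_derive_ext_loc with (fun a => f X s a); [|auto].
    generalize (locally_2d_snd _ _ _ (HD s a Hsa)). apply filter_imp. intros u Hu. auto.
Qed.

Lemma Ck_const D k c : Ck D k (fun (_ : T) _ _ => c).
Proof.
  revert c; induction k as [|k IH]; intros c;
    (split; [intros X s a _; apply continuous_const|]); [exact I|].
  exists (fun _ _ _ => 0), (fun _ _ _ => 0).
  split; [|split; [|split; apply IH]]; intros; apply @is_derive_const.
Qed.

Lemma Ck_fst D k : Ck D k (fun (_ : T) s _ => s).
Proof.
  assert (Hc : forall (X : T) s a, D s a -> cont3 (fun (_ : T) s _ => s) X s a).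
  { intros X s a _. apply cont3_eps. intros e He. exists (mkposreal e He). tauto. }
  destruct k; split; auto.
  exists (fun _ _ _ => 1), (fun _ _ _ => 0).
  split; [|split; [|split; apply Ck_const]]; intros;
    [apply @is_derive_id | apply @is_derive_const].
Qed.

Lemma Ck_snd D k : Ck D k (fun (_ : T) _ a => a).
Proof.
  assert (Hc : forall (X : T) s a, D s a -> cont3 (fun (_ : T) _ a => a) X s a).
  { intros X s a _. apply cont3_eps. intros e He. exists (mkposreal e He). tauto. }
  destruct k; split; auto.
  exists (fun _ _ _ => 0), (fun _ _ _ => 1).
  split; [|split; [|split; apply Ck_const]]; intros;
    [apply @is_derive_const | apply @is_derive_id].
Qed.

Lemma Ck_plus D k f g : Ck D k f -> Ck D k g -> Ck D k (fun X s a => f X s a + g X s a).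
Proof.
  revert f g; induction k as [|k IH]; intros f g Hf Hg;
    (split; [intros X s a Hsa; apply @continuous_plus; [apply (Ck_cont _ _ _ _ _ _ Hf Hsa)
      | apply (Ck_cont _ _ _ _ _ _ Hg Hsa)]|]); [exact I|].
  destruct Hf as [_ [f1 [f2 [H1 [H2 [H3 H4]]]]]].
  destruct Hg as [_ [g1 [g2 [K1 [K2 [K3 K4]]]]]].
  exists (fun X s a => f1 X s a + g1 X s a), (fun X s a => f2 X s a + g2 X s a).
  split; [|split; [|split]]; auto; intros X s a Hsa.
  - apply (is_derive_plus (fun s => f X s a) (fun s => g X s a)); auto.
  - apply (is_derive_plus (fun a => f X s a) (fun a => g X s a)); auto.
Qed.

Lemma Ck_mult D k f g : Ck D k f -> Ck D k g -> Ck D k (fun X s a => f X s a * g X s a).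
Proof.
  revert f g; induction k as [|k IH]; intros f g Hf Hg;
    (split; [intros X s a Hsa; apply @continuous_mult; [apply (Ck_cont _ _ _ _ _ _ Hf Hsa)
      | apply (Ck_cont _ _ _ _ _ _ Hg Hsa)]|]); [exact I|].
  assert (Hf' := Ck_S _ _ _ Hf). assert (Hg' := Ck_S _ _ _ Hg).
  destruct Hf as [_ [f1 [f2 [H1 [H2 [H3 H4]]]]]].
  destruct Hg as [_ [g1 [g2 [K1 [K2 [K3 K4]]]]]].
  exists (fun X s a => f1 X s a * g X s a + f X s a * g1 X s a),
         (fun X s a => f2 X s a * g X s a + f X s a * g2 X s a).
  split; [|split; [|split; apply Ck_plus; auto]]; intros X s a Hsa.
  - apply (is_derive_mult (fun s => f X s a) (fun s => g X s a)); auto. intros; apply Rmult_comm.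
  - apply (is_derive_mult (fun a => f X s a) (fun a => g X s a)); auto. intros; apply Rmult_comm.
Qed.

Lemma Ck_opp D k f : Ck D k f -> Ck D k (fun X s a => - f X s a).
Proof.
  intros Hf. assert (H := Ck_mult D k _ _ (Ck_const D k (-1)) Hf).
  replace (fun X s a => - f X s a) with (fun X s a => -1 * f X s a); [exact H|].
  do 3 (apply functional_extensionality; intro). ring.
Qed.

Lemma cont3_2d f X s a : cont3 f X s a -> continuity_2d_pt (f X) s a.
Proof.
  intros H e. destruct (proj1 (cont3_eps _ _ _ _) H e (cond_pos e)) as [d Hd].
  exists d. intros u v Hu Hv. apply Hd; auto. apply ball_center.
Qed.

(** With projections and constants as g and h this also restricts a family to the diagonal, to the
    axis y = 0 or to a fixed abscissa. *)
Lemma Ck_comp D E k f g h : open2 E -> Ck E k f -> Ck D k g -> Ck D k h ->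
  (forall X s a, D s a -> E (g X s a) (h X s a)) ->
  Ck D k (fun X s a => f X (g X s a) (h X s a)).
Proof.
  intros HE Hf Hg Hh HDE. revert f Hf g h Hg Hh HDE.
  induction k as [|k IH]; intros f Hf g h Hg Hh HDE;
   (split; [intros X s a Hsa; apply cont3_comp;
       [apply (Ck_cont _ _ _ _ _ _ Hg Hsa) | apply (Ck_cont _ _ _ _ _ _ Hh Hsa)
       | apply (Ck_cont _ _ _ _ _ _ Hf (HDE _ _ _ Hsa))]|]); [exact I|].
  assert (Hg' := Ck_S _ _ _ Hg). assert (Hh' := Ck_S _ _ _ Hh).
  destruct Hf as [_ [f1 [f2 [H1 [H2 [H3 H4]]]]]].
  destruct Hg as [_ [g1 [g2 [K1 [K2 [K3 K4]]]]]].
  destruct Hh as [_ [h1 [h2 [L1 [L2 [L3 L4]]]]]].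
  exists (fun X s a => f1 X (g X s a) (h X s a) * g1 X s a + f2 X (g X s a) (h X s a) * h1 X s a),
         (fun X s a => f1 X (g X s a) (h X s a) * g2 X s a + f2 X (g X s a) (h X s a) * h2 X s a).
  split; [|split; [|split; apply Ck_plus; apply Ck_mult; auto]]; intros X s a Hsa;
    assert (HEsa := HDE X s a Hsa).
  - apply (is_derive_comp_2 (f X) (f1 X) (f2 X) (fun s => g X s a) (fun s => h X s a)); auto.
    + generalize (HE _ _ HEsa). apply locally_2d_impl, locally_2d_forall. auto.
    + apply cont3_2d, (Ck_cont _ _ _ _ _ _ H3 HEsa).
  - apply (is_derive_comp_2 (f X) (f1 X) (f2 X) (fun a => g X s a) (fun a => h X s a)); auto.
    + generalize (HE _ _ HEsa). apply locally_2d_impl, locally_2d_forall. auto.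
    + apply cont3_2d, (Ck_cont _ _ _ _ _ _ H3 HEsa).
Qed.

Lemma open2_True : open2 (fun _ _ => True).
Proof. intros s a _. apply locally_2d_forall. auto. Qed.

Lemma Ck_exp D k f : Ck D k f -> Ck D k (fun X s a => exp (f X s a)).
Proof.
  (* A function of one variable is regarded as a family constant in the second variable; the second
     inner function is a filler. *)
  intros Hf. apply (Ck_comp D (fun _ _ => True) k (fun (_ : T) x _ => exp x) f f);
    auto using open2_True.
  clear Hf. induction k as [|k IH].
  all: assert (Hc : forall (X : T) s a, True -> cont3 (fun (_ : T) x _ => exp x) X s a).
  1,3: intros X s a _;
    apply (continuous_comp (fun q : T * (R * R) => fst (snd q)) exp);
    [apply (continuous_comp (fun q : T * (R * R) => snd q) fst);
      [apply continuous_snd | apply continuous_fst]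
    | apply continuous_exp].
  - split; auto.
  - split; [exact Hc|]. exists (fun (_ : T) x _ => exp x), (fun _ _ _ => 0).
    split; [|split; [|split; [exact IH | apply Ck_const]]]; intros.
    + apply is_derive_exp.
    + apply @is_derive_const.
Qed.

Lemma Ck_inv D k f : (forall X s a, D s a -> f X s a <> 0) ->
  Ck D k f -> Ck D k (fun X s a => / f X s a).
Proof.
  intros Hne Hf. set (E := fun x (_ : R) => x <> 0).
  assert (HE : open2 E).
  { intros x y Hx. exists (mkposreal (Rabs x) (Rabs_pos_lt x Hx)). simpl. intros u _ Hu _ H0.
    rewrite H0 in Hu. replace (0 - x) with (- x) in Hu by ring. rewrite Rabs_Ropp in Hu. lra. }
  apply (Ck_comp D E k (fun (_ : T) x _ => / x) f f); auto. clear Hf Hne.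
  assert (Hc : forall (X : T) s a, E s a -> cont3 (fun (_ : T) x _ => / x) X s a).
  { intros X s a Hsa. apply (continuous_comp (fun q : T * (R * R) => fst (snd q)) Rinv).
    - apply (continuous_comp (fun q : T * (R * R) => snd q) fst);
        [apply continuous_snd | apply continuous_fst].
    - apply continuous_Rinv. exact Hsa. }
  induction k as [|k IH]; [split; auto|].
  split; [exact Hc|]. exists (fun _ x _ => - (/ x * / x)), (fun _ _ _ => 0).
  split; [|split; [|split; [|apply Ck_const]]]; intros.
  - unfold E in H. auto_derive; [exact H|]. field. exact H.
  - apply @is_derive_const.
  - apply Ck_opp, Ck_mult; exact IH.
Qed.

(** The abscissa [a] is at once the lower end point and the second argument of f, because a solution
    is labelled by the abscissa from which it starts. Its derivative in [a] thus has a boundary term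
    on the diagonal. *)
Definition path_integral f : T -> R -> R -> R := fun X s a => RInt (fun z => f X z a) a s.

Lemma cont3_slice f X s a : cont3 f X s a -> continuous (fun z => f X z a) s.
Proof.
  intros H. apply continuous_R. intros e He.
  destruct (proj1 (cont3_eps _ _ _ _) H e He) as [d Hd]. exists d. intros z Hz.
  apply Hd; [apply ball_center | exact Hz |]. rewrite Rminus_diag, Rabs_R0. apply cond_pos.
Qed.

Section Integral.
Variable D : R -> R -> Prop.
Hypothesis HD : open2 D.
(** The horizontal segment of integration, from the diagonal point (a, a) to (s, a), lies in the
    domain. *)
Hypothesis Hconv : forall s a z, D s a -> Rmin a s <= z <= Rmax a s -> D z a.

(** Differentiating an integral whose end point moves requires some room beyond both ends of the
    segment, uniformly for nearby abscissas. *)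
Lemma domain_margin s a : D s a -> exists e : posreal, locally a (fun b =>
  forall z, Rmin a s - e <= z <= Rmax a s + e -> D z b).
Proof.
  intros Hsa.
  assert (H1 : D (Rmin a s) a).
  { apply (Hconv s); [exact Hsa|]. unfold Rmin, Rmax. destruct Rle_dec; lra. }
  assert (H2 : D (Rmax a s) a).
  { apply (Hconv s); [exact Hsa|]. unfold Rmin, Rmax. destruct Rle_dec; lra. }
  destruct (HD _ _ H1) as [d1 Hd1]. destruct (HD _ _ H2) as [d2 Hd2].
  assert (He : 0 < Rmin d1 d2 / 2).
  { apply Rdiv_lt_0_compat; [|lra]. apply Rmin_glb_lt; apply cond_pos. }
  exists (mkposreal _ He). simpl. pose proof (Rmin_l d1 d2). pose proof (Rmin_r d1 d2).
  apply (tube_lemma (fun b z => D z b)). intros z Hz.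
  assert (Hz' : D z a).
  { assert (Hz0 : Rabs (a - a) = 0) by (rewrite Rminus_diag; apply Rabs_R0).
    pose proof (cond_pos d1). pose proof (cond_pos d2).
    destruct (Rlt_le_dec z (Rmin a s)).
    - apply Hd1; [apply Rabs_def1; lra | rewrite Hz0; lra].
    - destruct (Rlt_le_dec (Rmax a s) z).
      + apply Hd2; [apply Rabs_def1; lra | rewrite Hz0; lra].
      + apply (Hconv s); auto. }
  destruct (HD _ _ Hz') as [d Hd]. exists d. intros [b u] [Hb Hu]. apply Hd; assumption.
Qed.

Lemma path_integral_cont f k X s a : Ck D k f -> D s a -> cont3 (path_integral f) X s a.
Proof.
  intros Hf Hsa. unfold cont3, path_integral.
  apply (continuous_RInt_param (fun (q : T * (R * R)) z => f (fst q) z (snd (snd q)))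
           (fun q => snd (snd q)) (fun q => fst (snd q)) (X, (s, a))).
  - apply (continuous_comp (fun q : T * (R * R) => snd q) snd); apply continuous_snd.
  - apply (continuous_comp (fun q : T * (R * R) => snd q) fst);
      [apply continuous_snd | apply continuous_fst].
  - simpl. intros z Hz.
    assert (Hc := Ck_cont _ _ _ X _ _ Hf (Hconv _ _ _ Hsa Hz)).
    apply continuous_R. intros e He.
    destruct (proj1 (cont3_eps _ _ _ _) Hc e He) as [d Hd]. exists d.
    intros [[Y [u b]] w] [[HY [Hu Hb]] Hw]. apply Hd; assumption.
  - destruct (HD s a Hsa) as [d Hd]. exists d. intros [Y [u b]] [HY [Hu Hb]] z Hz. simpl in *.
    apply cont3_slice, (Ck_cont _ _ _ _ _ _ Hf). apply (Hconv u); [|exact Hz].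
    apply Hd; assumption.
Qed.

Lemma path_integral_derive_1 f k X s a : Ck D k f -> D s a ->
  is_derive (fun s => path_integral f X s a) s (f X s a).
Proof.
  intros Hf Hsa. apply (is_derive_RInt (fun z => f X z a) (fun s => path_integral f X s a) a).
  - generalize (locally_2d_fst _ _ _ (HD s a Hsa)). apply filter_imp. intros u Hu.
    apply (@RInt_correct R_CompleteNormedModule), ex_RInt_cont. intros z Hz.
    apply cont3_slice, (Ck_cont _ _ _ _ _ _ Hf). apply (Hconv u); assumption.
  - apply cont3_slice, (Ck_cont _ _ _ _ _ _ Hf Hsa).
Qed.

Lemma path_integral_derive_2 f f2 k X s a :
  Ck D k f -> Ck D k f2 ->
  (forall X s a, D s a -> is_derive (fun a => f X s a) a (f2 X s a)) ->
  D s a ->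
  is_derive (fun a => path_integral f X s a) a (- f X a a + path_integral f2 X s a).
Proof.
  intros Hf Hf2 Hder Hsa.
  destruct (domain_margin s a Hsa) as [e He].
  assert (He0 := cond_pos e).
  assert (Hin : forall z, Rmin a s - e <= z <= Rmax a s + e -> D z a)
    by exact (locally_singleton _ _ He).
  assert (Hm : Rmin a s <= a <= Rmax a s /\ Rmin a s <= s <= Rmax a s).
  { unfold Rmin, Rmax. destruct Rle_dec; lra. }
  assert (Hint : forall c d, Rmin a s - e <= c <= Rmax a s + e ->
     Rmin a s - e <= d <= Rmax a s + e -> locally a (fun b => ex_RInt (fun z => f X z b) c d)).
  { intros c d Hc Hd. revert He. apply filter_imp. intros b Hb. apply ex_RInt_cont.
    intros z Hz. apply cont3_slice, (Ck_cont _ _ _ _ _ _ Hf). apply Hb.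
    revert Hz. unfold Rmin at 1, Rmax at 1. destruct (Rle_dec c d); lra. }
  assert (Hcont2 : forall b z, D z b ->
            continuity_2d_pt (fun u v : R => Derive (fun w : R => f X v w) u) b z).
  { intros b z Hbz.
    apply continuity_2d_pt_ext_loc with (fun u v => f2 X v u).
    - destruct (HD _ _ Hbz) as [d Hd]. exists d. intros u v Hu Hv.
      symmetry. apply is_derive_unique, Hder, Hd; assumption.
    - intros eps. destruct (proj1 (cont3_eps _ _ _ _)
        (Ck_cont _ _ _ X _ _ Hf2 Hbz) eps (cond_pos eps)) as [d Hd].
      exists d. intros u v Hu Hv. apply Hd; auto. apply ball_center. }
  assert (Hder2 : is_derive (fun b => RInt (fun z => f X z b) b s) a
    (RInt (fun z => Derive (fun b => f X z b) a) a s + - f X a a * 1 + f X s a * 0)).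
  { apply (is_derive_RInt_param_bound_comp (fun b z => f X z b) (fun b => b) (fun _ => s)).
    - apply Hint; lra.
    - exists e. apply Hint; lra.
    - exists e. apply Hint; lra.
    - apply @is_derive_id.
    - apply @is_derive_const.
    - exists e. revert He. apply filter_imp. intros b Hb z Hz. exists (f2 X z b). apply Hder, Hb.
      revert Hz. unfold Rmin, Rmax. destruct (Rle_dec a s);
        destruct (Rle_dec (a - e) (s - e)); destruct (Rle_dec (a + e) (s + e)); lra.
    - intros z Hz. apply Hcont2, Hin. lra.
    - destruct (HD a a (Hin a ltac:(lra))) as [d Hd]. exists d. intros u v Hu Hv.
      apply Hcont2, Hd; assumption.
    - destruct (HD s a Hsa) as [d Hd]. exists d. intros u v Hu Hv.
      apply Hcont2, Hd; assumption.
    - apply continuity_pt_filterlim, cont3_slice, (Ck_cont _ _ _ _ _ _ Hf), Hin. lra.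
    - apply continuity_pt_filterlim, cont3_slice, (Ck_cont _ _ _ _ _ _ Hf), Hsa. }
  replace (- f X a a + path_integral f2 X s a) with
    (RInt (fun z => Derive (fun b => f X z b) a) a s + - f X a a * 1 + f X s a * 0);
    [exact Hder2|].
  unfold path_integral.
  replace (RInt (fun z => Derive (fun b => f X z b) a) a s) with (RInt (fun z => f2 X z a) a s);
    [ring|].
  apply RInt_ext. intros z Hz. symmetry. apply is_derive_unique, Hder, Hin. lra.
Qed.

(** The derivative in s is f itself, and the one in a is a path integral of the derivative of f
    minus the diagonal trace of f, so the class is stable under the recursion. *)
Lemma Ck_path_integral k f : Ck D k f -> Ck D k (path_integral f).
Proof.
  revert f; induction k as [|k IH]; intros f Hf;
    (split; [intros X s a Hsa; exact (path_integral_cont _ _ _ _ _ Hf Hsa)|]); [exact I|].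
  assert (Hf' := Ck_S _ _ _ Hf).
  assert (Hf0 := Hf). destruct Hf as [_ [f1 [f2 [H1 [H2 [H3 H4]]]]]].
  exists f, (fun X s a => - f X a a + path_integral f2 X s a).
  split; [|split; [|split; [exact Hf'|]]].
  - intros X s a Hsa. exact (path_integral_derive_1 _ _ _ _ _ Hf' Hsa).
  - intros X s a Hsa. exact (path_integral_derive_2 _ _ _ _ _ _ Hf' H4 H2 Hsa).
  - apply Ck_plus; [|apply IH, H4]. apply Ck_opp.
    apply (Ck_comp D D k f (fun _ _ a => a) (fun _ _ a => a)); auto using Ck_snd.
    intros X s a Hsa. apply (Hconv s); [exact Hsa|].
    unfold Rmin, Rmax. destruct Rle_dec; lra.
Qed.

End Integral.
End Calculus.

(** * Dependence of the solutions on the initial abscissa *)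

Lemma cont3_pair {T : UniformSpace} (f : T -> R -> R -> R) X s a :
  cont3 f X s a -> continuous (fun q : R * R => f X (fst q) (snd q)) (s, a).
Proof.
  intros H.
  exact (continuous_pair_r (fun q : T * (R * R) => f (fst q) (fst (snd q)) (snd (snd q))) X (s, a) H).
Qed.

(** As p vanishes at a, the quotient p(b) q(b) / (b - a) tends to p'(a) q(a) once q is continuous.
    This permits differentiating a solution in its abscissa before the exponential factor is known
    to be differentiable. *)
Lemma is_derive_mult_zero (p q : R -> R) (a l : R) :
  is_derive p a l -> p a = 0 -> continuous q a -> is_derive (fun b => p b * q b) a (l * q a).
Proof.
  intros Hp H0 Hq. apply is_derive_Reals in Hp.
  apply is_derive_Reals.
  intros e He. set (M := Rabs l + 1).
  assert (HM : 0 < M) by (unfold M; pose proof (Rabs_pos l); lra).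
  destruct (proj1 (continuous_R _ _) Hq (e / (2 * M)) ltac:(apply Rdiv_lt_0_compat; lra)) as [d1 Hd1].
  set (e2 := Rmin 1 (e / (2 * (Rabs (q a) + 1)))).
  assert (Hqa := Rabs_pos (q a)).
  assert (He2 : 0 < e2) by (apply Rmin_glb_lt; [lra | apply Rdiv_lt_0_compat; lra]).
  destruct (Hp e2 He2) as [d2 Hd2].
  assert (Hd : 0 < Rmin d1 d2) by (apply Rmin_glb_lt; apply cond_pos).
  exists (mkposreal _ Hd). simpl. intros h Hh Hhd.
  pose proof (Rmin_l d1 d2). pose proof (Rmin_r d1 d2).
  assert (A1 : Rabs (q (a + h) - q a) < e / (2 * M)).
  { apply Hd1. unfold ball; simpl. unfold AbsRing_ball, abs, minus, plus, opp; simpl.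
    replace (a + h + - a) with h by ring. lra. }
  assert (A2 := Hd2 h Hh ltac:(lra)). rewrite H0, Rminus_0_r in A2.
  rewrite H0, Rmult_0_l, Rminus_0_r.
  set (w := p (a + h) / h) in *.
  replace (p (a + h) * q (a + h) / h) with (w * q (a + h)) by (unfold w; field; exact Hh).
  replace (w * q (a + h) - l * q a) with (w * (q (a + h) - q a) + (w - l) * q a) by ring.
  eapply Rle_lt_trans; [apply Rabs_triang|]. rewrite !Rabs_mult.
  assert (B1 : Rabs w <= M).
  { unfold M. replace w with (l + (w - l)) by ring. eapply Rle_trans; [apply Rabs_triang|].
    assert (e2 <= 1) by apply Rmin_l. lra. }
  assert (B2 : Rabs w * Rabs (q (a + h) - q a) < e / 2).
  { apply Rle_lt_trans with (M * Rabs (q (a + h) - q a)).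
    - apply Rmult_le_compat_r; [apply Rabs_pos | exact B1].
    - apply Rlt_le_trans with (M * (e / (2 * M))); [|right; field; lra].
      apply Rmult_lt_compat_l; lra. }
  assert (B3 : Rabs (w - l) * Rabs (q a) <= e / 2).
  { apply Rle_trans with (e / (2 * (Rabs (q a) + 1)) * (Rabs (q a) + 1)); [|right; field; lra].
    assert (e2 <= e / (2 * (Rabs (q a) + 1))) by apply Rmin_r.
    apply Rmult_le_compat; try apply Rabs_pos; lra. }
  lra.
Qed.

Section Smooth.
Context {T : UniformSpace}.
Variables (F F2 Y : T -> R -> R -> R) (W D : R -> R -> Prop) (m : nat).
Hypothesis Y_start : forall X a, Y X a a = 0.
Hypothesis Y_ode : forall X s a, is_derive (fun s => Y X s a) s (F X s (Y X s a)).
Hypothesis Y_cont : forall X s a, cont3 Y X s a.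
Hypothesis HW : open2 W.
Hypothesis W_conv : forall x y1 y2 t,
  W x y1 -> W x y2 -> 0 <= t <= 1 -> W x ((1 - t) * y1 + t * y2).
Hypothesis HD : open2 D.
Hypothesis D_conv : forall s a z, D s a -> Rmin a s <= z <= Rmax a s -> D z a.
Hypothesis DW : forall X s a, D s a -> W s (Y X s a).
Hypothesis F_C0 : Ck W (S m) F.
Hypothesis F_der2 : forall X x y, W x y -> is_derive (fun y => F X x y) y (F2 X x y).
Hypothesis F2_Cm : Ck W m F2.

(** Hadamard's quotient: the average of the derivative of F in y over the segment between two
    solutions. It makes their difference a solution of a linear equation. *)
Let mean (X : T) (a b z : R) : R :=
  RInt (fun t => F2 X z ((1 - t) * Y X z a + t * Y X z b)) 0 1.

Lemma segment_continuous X a b z t : D z a -> D z b -> 0 <= t <= 1 ->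
  continuous (fun q : R * R * R =>
    F2 X (snd (fst q)) ((1 - snd q) * Y X (snd (fst q)) a + snd q * Y X (snd (fst q)) (fst (fst q))))
    ((b, z), t).
Proof.
  intros Ha Hb Ht.
  assert (Cz : continuous (fun q : R * R * R => snd (fst q)) (b, z, t)).
  { apply (continuous_comp (fun q : R * R * R => fst q) snd);
      [apply continuous_fst | apply continuous_snd]. }
  assert (Cb : continuous (fun q : R * R * R => fst (fst q)) (b, z, t)).
  { apply (continuous_comp (fun q : R * R * R => fst q) fst);
      [apply continuous_fst | apply continuous_fst]. }
  assert (Ct : continuous (fun q : R * R * R => snd q) (b, z, t)) by apply continuous_snd.
  apply (continuous_comp_2 (fun q : R * R * R => snd (fst q))
    (fun q : R * R * R => (1 - snd q) * Y X (snd (fst q)) a + snd q * Y X (snd (fst q)) (fst (fst q)))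
    (F2 X)).
  - exact Cz.
  - apply (continuous_plus (fun q : R * R * R => (1 - snd q) * Y X (snd (fst q)) a)).
    + apply (continuous_mult (fun q : R * R * R => 1 - snd q)).
      * apply (continuous_minus (fun _ : R * R * R => 1)); [apply continuous_const | exact Ct].
      * apply (continuous_comp (fun q : R * R * R => snd (fst q)) (fun z => Y X z a)); [exact Cz|].
        apply cont3_slice, Y_cont.
    + apply (continuous_mult (fun q : R * R * R => snd q)); [exact Ct|].
      apply (continuous_comp_2 (fun q : R * R * R => snd (fst q)) (fun q => fst (fst q)) (Y X));
        [exact Cz | exact Cb | apply cont3_pair, Y_cont].
  - simpl. apply cont3_pair. apply (Ck_cont _ _ _ _ _ _ F2_Cm). apply W_conv; auto.
Qed.

Lemma mean_continuous X a b z : D z a -> D z b ->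
  continuous (fun q : R * R => mean X a (fst q) (snd q)) (b, z).
Proof.
  intros Ha Hb.
  apply (continuous_RInt_01 (fun (q : R * R) t =>
    F2 X (snd q) ((1 - t) * Y X (snd q) a + t * Y X (snd q) (fst q))) (b, z)).
  - destruct (HD _ _ Ha) as [d1 Hd1]. destruct (HD _ _ Hb) as [d2 Hd2].
    assert (Hd : 0 < Rmin d1 d2) by (apply Rmin_glb_lt; apply cond_pos).
    exists (mkposreal _ Hd). intros [b' z'] [Hb' Hz'].
    change (Rabs (b' - b) < Rmin d1 d2) in Hb'. change (Rabs (z' - z) < Rmin d1 d2) in Hz'.
    pose proof (Rmin_l d1 d2). pose proof (Rmin_r d1 d2).
    assert (Da : D z' a).
    { apply Hd1; [lra|]. rewrite Rminus_diag, Rabs_R0. apply cond_pos. }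
    assert (Db : D z' b') by (apply Hd2; lra).
    apply ex_RInt_cont. rewrite Rmin_left, Rmax_right by lra. intros t Ht. simpl.
    exact (continuous_pair_r _ (b', z') t (segment_continuous X a b' z' t ltac:(assumption) ltac:(assumption) Ht)).
  - intros t Ht. apply segment_continuous; assumption.
Qed.

Lemma mean_spec X a b z : D z a -> D z b ->
  F X z (Y X z b) - F X z (Y X z a) = mean X a b z * (Y X z b - Y X z a).
Proof.
  intros Ha Hb.
  set (p := fun t => (1 - t) * Y X z a + t * Y X z b).
  assert (HWp : forall t, 0 <= t <= 1 -> W z (p t)) by (intros; apply W_conv; auto).
  assert (Hc : forall t, 0 <= t <= 1 -> continuous (fun t => F2 X z (p t)) t).
  { intros t Ht. exact (continuous_pair_r _ (b, z) t (segment_continuous X a b z t ltac:(assumption) ltac:(assumption) Ht)). }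
  assert (H : is_RInt (fun t => (Y X z b - Y X z a) * F2 X z (p t)) 0 1
                (minus (F X z (p 1)) (F X z (p 0)))).
  { apply (is_RInt_derive (fun t => F X z (p t))); rewrite Rmin_left, Rmax_right by lra; intros t Ht.
    - apply (is_derive_comp (fun y => F X z y) p t); [apply F_der2; auto|].
      unfold p. auto_derive; [exact I|]. ring.
    - apply (continuous_mult (fun _ => Y X z b - Y X z a)); [apply continuous_const | auto]. }
  apply (@is_RInt_unique R_CompleteNormedModule) in H.
  unfold p in H at 2 3. unfold minus, plus, opp in H; simpl in H.
  replace ((1 - 1) * Y X z a + 1 * Y X z b) with (Y X z b) in H by ring.
  replace ((1 - 0) * Y X z a + 0 * Y X z b) with (Y X z a) in H by ring.
  unfold Rminus at 1. rewrite <- H. rewrite Rmult_comm. unfold mean.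
  apply (@RInt_scal R_CompleteNormedModule (fun t => F2 X z (p t))).
  apply ex_RInt_cont. rewrite Rmin_left, Rmax_right by lra. auto.
Qed.

(** The solution with value 1 at s = a of the variational equation w' = F_y(s, Y) w. *)
Definition variation : T -> R -> R -> R :=
  fun X s a => exp (path_integral (fun X z a => F2 X z (Y X z a)) X s a).

(** The difference d of the two solutions satisfies d' = [mean] d, so d exp(-J) is constant. It is
    evaluated at z = b, where one of the solutions is 0. *)
Lemma difference_formula X s a b :
  (forall z, Rmin b s <= z <= Rmax b s -> D z a /\ D z b) ->
  Y X s b - Y X s a = - Y X b a * exp (RInt (mean X a b) b s).
Proof.
  intros Hz.
  set (J := fun z => RInt (mean X a b) b z).
  set (G := fun z => (Y X z b - Y X z a) * exp (- J z)).
  assert (Hmc : forall z, Rmin b s <= z <= Rmax b s -> continuous (mean X a b) z).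
  { intros z Hzz. destruct (Hz z Hzz) as [Ha Hb].
    apply (continuous_pair_r (fun q : R * R => mean X a (fst q) (snd q))), mean_continuous; assumption. }
  (* Derivatives are two-sided even at the end points b and s, so the integrand has to be continuous
     slightly beyond them. *)
  assert (HmcL : forall z, Rmin b s <= z <= Rmax b s -> locally z (fun w =>
     forall v, Rmin b w <= v <= Rmax b w -> continuous (mean X a b) v)).
  { intros z Hzz. destruct (Hz z Hzz) as [Ha Hb].
    destruct (HD _ _ Ha) as [d1 Hd1]. destruct (HD _ _ Hb) as [d2 Hd2].
    assert (Hd : 0 < Rmin d1 d2) by (apply Rmin_glb_lt; apply cond_pos).
    exists (mkposreal _ Hd). intros w Hw v Hv. change (Rabs (w - z) < Rmin d1 d2) in Hw.
    pose proof (Rmin_l d1 d2). pose proof (Rmin_r d1 d2).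
    assert (Hbz : forall v, Rmin b z <= v <= Rmax b z -> continuous (mean X a b) v).
    { intros v' Hv'. apply Hmc. revert Hzz Hv'. unfold Rmin, Rmax.
      destruct (Rle_dec b s); destruct (Rle_dec b z); lra. }
    destruct (classic (Rmin b z <= v <= Rmax b z)) as [Hin|Hout]; [auto|].
    assert (Hvz : Rabs (v - z) < Rmin d1 d2).
    { apply Rabs_def2 in Hw. apply Rabs_def1; revert Hv Hout; unfold Rmin at 1 2, Rmax at 1 2;
        destruct (Rle_dec b w); destruct (Rle_dec b z); lra. }
    assert (Da : D v a).
    { apply Hd1; [lra|]. rewrite Rminus_diag, Rabs_R0. apply cond_pos. }
    assert (Db : D v b).
    { apply Hd2; [lra|]. rewrite Rminus_diag, Rabs_R0. apply cond_pos. }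
    apply (continuous_pair_r (fun q : R * R => mean X a (fst q) (snd q))), mean_continuous; assumption. }
  assert (HJ : forall z, Rmin b s <= z <= Rmax b s -> is_derive J z (mean X a b z)).
  { intros z Hzz. apply (is_derive_RInt (mean X a b) J b); [|auto].
    generalize (HmcL z Hzz). apply filter_imp. intros w Hw.
    apply (@RInt_correct R_CompleteNormedModule), ex_RInt_cont, Hw. }
  assert (HG : forall z, Rmin b s <= z <= Rmax b s -> is_derive G z 0).
  { intros z Hzz. destruct (Hz z Hzz) as [Ha Hb].
    assert (H1 := Y_ode X z b). assert (H2 := Y_ode X z a). assert (H3 := HJ z Hzz).
    replace 0 with ((F X z (Y X z b) - F X z (Y X z a)) * exp (- J z)
      + (Y X z b - Y X z a) * (- mean X a b z * exp (- J z))).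
    - apply (is_derive_mult (fun z => Y X z b - Y X z a) (fun z => exp (- J z))).
      + apply (is_derive_minus (fun z => Y X z b) (fun z => Y X z a)); assumption.
      + apply (is_derive_comp exp (fun z => - J z)); [apply is_derive_exp|].
        apply (is_derive_opp J). assumption.
      + intros; apply Rmult_comm.
    - rewrite mean_spec by assumption. ring. }
  assert (HGs : G s = G b).
  { destruct (MVT_gen G b s (fun _ => 0)) as [c [_ Hc]].
    - intros z Hzz. apply HG. lra.
    - intros z Hzz. apply (is_derive_continuity_pt G z 0), HG, Hzz.
    - lra. }
  unfold G in HGs. rewrite Y_start in HGs.
  assert (HJb : J b = 0) by apply (RInt_point b (mean X a b)).
  rewrite HJb, Ropp_0, exp_0 in HGs.
  change (RInt (mean X a b) b s) with (J s).
  assert (HE : exp (- J s) * exp (J s) = 1).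
  { rewrite <- exp_plus. replace (- J s + J s) with 0 by ring. apply exp_0. }
  transitivity ((Y X s b - Y X s a) * (exp (- J s) * exp (J s))); [rewrite HE; ring|].
  rewrite <- Rmult_assoc, HGs. ring.
Qed.

(** In the difference formula the factor [Y X b a] vanishes at b = a with derivative [F X a 0] in b,
    while the exponential only has to be continuous; its value at b = a is [variation]. *)
Lemma flow_graph_derive_2 X s a : D s a ->
  is_derive (fun a => Y X s a) a (- F X a 0 * variation X s a).
Proof.
  intros Hsa.
  destruct (domain_margin D HD D_conv s a Hsa) as [e He].
  assert (He0 := cond_pos e).
  assert (Hina := locally_singleton _ _ He). simpl in Hina.
  assert (Hnear : locally a (fun b => forall z, Rmin b s <= z <= Rmax b s -> D z a /\ D z b)).
  { assert (Hb : locally a (fun b => Rabs (b - a) < e)) by (exists e; intros y Hy; exact Hy).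
    generalize (filter_and _ _ He Hb). apply filter_imp. intros b [H1 H2] z Hz.
    apply Rabs_def2 in H2.
    assert (Rmin a s - e <= z <= Rmax a s + e).
    { revert Hz. unfold Rmin, Rmax. destruct (Rle_dec b s); destruct (Rle_dec a s); lra. }
    auto. }
  set (q := fun b => exp (RInt (mean X a b) b s)).
  apply is_derive_ext_loc with (fun b => Y X s a + - Y X b a * q b).
  { revert Hnear. apply filter_imp. intros b Hb.
    assert (H := difference_formula X s a b Hb). unfold q. simpl in H |- *. lra. }
  assert (Hq : continuous q a).
  { unfold q. apply (continuous_comp (fun b => RInt (mean X a b) b s) exp); [|apply continuous_exp].
    apply (continuous_RInt_param (mean X a) (fun b => b) (fun _ => s)).
    - apply continuous_id.
    - apply continuous_const.
    - intros z Hz. apply mean_continuous; apply Hina; lra.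
    - revert Hnear. apply filter_imp. intros b Hb z Hz. destruct (Hb z Hz) as [H1 H2].
      apply (continuous_pair_r (fun q : R * R => mean X a (fst q) (snd q))), mean_continuous; assumption. }
  assert (Hqa : q a = variation X s a).
  { unfold q, variation, path_integral. f_equal. apply RInt_ext. intros z Hz. unfold mean.
    transitivity (RInt (fun _ => F2 X z (Y X z a)) 0 1).
    - apply RInt_ext. intros t _. f_equal. ring.
    - rewrite RInt_const. unfold scal; simpl. unfold mult; simpl. ring. }
  rewrite <- Hqa.
  replace (- F X a 0 * q a) with (0 + - F X a 0 * q a) by ring.
  apply (is_derive_plus (fun _ => Y X s a) (fun b => - Y X b a * q b)); [apply @is_derive_const|].
  apply (is_derive_mult_zero (fun b => - Y X b a) q).
  - apply (is_derive_opp (fun b => Y X b a)). assert (H := Y_ode X a a). rewrite Y_start in H. exact H.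
  - rewrite Y_start. ring.
  - exact Hq.
Qed.

Lemma D_diag s a : D s a -> D a a.
Proof. intros H. apply (D_conv s); [exact H|]. unfold Rmin, Rmax. destruct Rle_dec; lra. Qed.

(** Both partial derivatives of Y are expressions in F, F2 and Y without any derivative of Y, so
    they inherit the regularity that Y already has. *)
Lemma flow_graph_smooth_step k : (k <= m)%nat -> Ck D k Y -> Ck D k variation /\ Ck D (S k) Y.
Proof.
  intros Hk HY.
  assert (HV : Ck D k variation).
  { apply Ck_exp, Ck_path_integral; [exact HD | exact D_conv|].
    apply (Ck_comp D W k F2 (fun _ z _ => z) Y); auto using Ck_fst.
    apply Ck_le with m; assumption. }
  split; [exact HV|]. split; [intros; apply Y_cont|].
  exists (fun X s a => F X s (Y X s a)), (fun X s a => - F X a 0 * variation X s a).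
  split; [|split; [|split]].
  - intros X s a _. apply Y_ode.
  - intros X s a Hsa. apply flow_graph_derive_2, Hsa.
  - apply (Ck_comp D W k F (fun _ z _ => z) Y); auto using Ck_fst.
    apply Ck_le with (S m); [lia | exact F_C0].
  - apply Ck_mult; [|exact HV]. apply Ck_opp.
    apply (Ck_comp D W k F (fun _ _ a => a) (fun _ _ _ => 0)); auto using Ck_snd, Ck_const.
    + apply Ck_le with (S m); [lia | exact F_C0].
    + intros X s a Hsa. rewrite <- (Y_start X a). apply DW, D_diag with s, Hsa.
Qed.

Lemma flow_graph_smooth : Ck D (S m) Y /\ Ck D m variation.
Proof.
  assert (H : forall k, (k <= S m)%nat -> Ck D k Y).
  { induction k as [|k IH]; intros Hk.
    - split; [intros; apply Y_cont | exact I].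
    - apply flow_graph_smooth_step; [lia|]. apply IH. lia. }
  split; [apply H; lia|].
  apply flow_graph_smooth_step; [lia|]. apply H. lia.
Qed.

End Smooth.

(** * Inverse functions, jets and Taylor expansions *)

(** Expansion makes f unbounded on both sides, hence onto, and makes the inverse Lipschitz with
    constant 1/c. *)
Lemma expanding_inverse (f : R -> R) (c : R) :
  0 < c -> continuity f -> (forall x y, x <= y -> c * (y - x) <= f y - f x) ->
  exists g : R -> R, (forall x, g (f x) = x) /\ (forall y, f (g y) = y) /\
    (forall t, continuous g t).
Proof.
  intros Hc Hf Hexp.
  assert (Hsurj : forall y, exists x, f x = y).
  { intros y. set (N := (Rabs (y - f 0) + 1) / c).
    assert (HN : 0 < N). { apply Rdiv_lt_0_compat; [|lra]. pose proof (Rabs_pos (y - f 0)). lra. }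
    assert (HcN : c * N = Rabs (y - f 0) + 1) by (unfold N; field; lra).
    assert (H1 := Hexp 0 N ltac:(lra)). assert (H2 := Hexp (- N) 0 ltac:(lra)).
    assert (H3 := Rle_abs (y - f 0)). assert (H4 := Rle_abs (- (y - f 0))).
    rewrite Rabs_Ropp in H4.
    destruct (IVT_gen f (- N) N y Hf) as [x [_ Hx]]; [|exists x; exact Hx].
    rewrite Rmin_left, Rmax_right by lra. lra. }
  set (g := fun y => proj1_sig (constructive_indefinite_description _ (Hsurj y))).
  assert (Hfg : forall y, f (g y) = y).
  { intros y. unfold g. destruct constructive_indefinite_description as [x Hx]. exact Hx. }
  exists g. split; [|split; [exact Hfg|]].
  - intros x. assert (H := Hfg (f x)).
    destruct (Rle_lt_dec x (g (f x))).
    + assert (H1 := Hexp x (g (f x)) ltac:(lra)). nra.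
    + assert (H1 := Hexp (g (f x)) x ltac:(lra)). nra.
  - apply (continuous_of_lipschitz g (/ c)).
    intros s t. rewrite <- (Hfg s) at 2. rewrite <- (Hfg t) at 2.
    assert (Hic : 0 < / c) by (apply Rinv_0_lt_compat; exact Hc).
    assert (Hcc : / c * c = 1) by (field; lra).
    destruct (Rle_lt_dec (g t) (g s)) as [Hle|Hle].
    + assert (H1 := Hexp _ _ Hle). rewrite (Rabs_right (g s - g t)) by lra.
      apply Rle_trans with (/ c * (c * (g s - g t))); [right; rewrite <- Rmult_assoc, Hcc; ring|].
      apply Rmult_le_compat_l; [lra|]. eapply Rle_trans; [exact H1 | apply Rle_abs].
    + assert (H1 := Hexp _ _ (Rlt_le _ _ Hle)). rewrite (Rabs_left (g s - g t)) by lra.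
      apply Rle_trans with (/ c * (c * (g t - g s))); [right; rewrite <- Rmult_assoc, Hcc; ring|].
      apply Rmult_le_compat_l; [lra|]. rewrite Rabs_minus_sym.
      eapply Rle_trans; [exact H1 | apply Rle_abs].
Qed.

Lemma is_derive_inverse (f g : R -> R) (y l : R) :
  locally y (fun z => f (g z) = z) -> continuous g y -> is_derive f (g y) l -> l <> 0 ->
  is_derive g y (/ l).
Proof.
  intros Hfg Hg Hf Hl. apply is_derive_Reals. apply is_derive_Reals in Hf.
  intros e He. assert (Hal := Rabs_pos_lt l Hl).
  (* The first bound keeps the quotient w at least |l|/2 in size; with it the second one makes |1/w
     - 1/l| at most e/2. *)
  set (e' := Rmin (Rabs l / 2) (e * Rabs l * Rabs l / 4)).
  assert (He' : 0 < e').
  { apply Rmin_glb_lt; [lra|]. apply Rdiv_lt_0_compat; [|lra].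
    repeat apply Rmult_lt_0_compat; lra. }
  assert (He1 : e' <= Rabs l / 2) by apply Rmin_l.
  assert (He2 : e' <= e * Rabs l * Rabs l / 4) by apply Rmin_r.
  destruct (Hf e' He') as [d Hd].
  destruct (proj1 (continuous_R _ _) Hg d (cond_pos d)) as [d1 Hd1].
  destruct Hfg as [d2 Hd2].
  assert (Hm : 0 < Rmin d1 d2) by (apply Rmin_glb_lt; apply cond_pos).
  exists (mkposreal _ Hm). simpl. intros h Hh Hhd.
  pose proof (Rmin_l d1 d2). pose proof (Rmin_r d1 d2).
  set (k := g (y + h) - g y).
  assert (Hball : forall r : posreal, Rabs h < r -> ball y r (y + h)).
  { intros r Hr. unfold ball; simpl. unfold AbsRing_ball, abs, minus, plus, opp; simpl.
    replace (y + h + - y) with h by ring. exact Hr. }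
  assert (E1 : f (g y) = y) by (apply Hd2, ball_center).
  assert (E2 : f (g (y + h)) = y + h) by (apply Hd2, Hball; lra).
  assert (Hk : k <> 0).
  { intros Hk0. apply Hh. unfold k in Hk0. replace (g (y + h)) with (g y) in E2 by lra. lra. }
  assert (Hkd : Rabs k < d) by (apply Hd1, Hball; lra).
  assert (A := Hd k Hk Hkd). replace (g y + k) with (g (y + h)) in A by (unfold k; ring).
  rewrite E1, E2 in A. replace (y + h - y) with h in A by ring.
  set (w := h / k) in *.
  assert (Hw : Rabs l / 2 <= Rabs w).
  { assert (H1 := Rabs_triang (w) (l - w)). replace (w + (l - w)) with l in H1 by ring.
    rewrite (Rabs_minus_sym l w) in H1. lra. }
  assert (Hw0 : w <> 0). { intros Hw0. rewrite Hw0, Rabs_R0 in Hw. lra. }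
  replace (k / h - / l) with ((l - w) / (w * l)) by (unfold w; field; auto).
  unfold Rdiv. rewrite Rabs_mult, Rabs_inv, Rabs_mult, Rabs_minus_sym.
  apply Rle_lt_trans with (Rabs (w - l) * / (Rabs l / 2 * Rabs l)).
  - apply Rmult_le_compat_l; [apply Rabs_pos|]. apply Rinv_le_contravar; [nra|].
    apply Rmult_le_compat_r; lra.
  - apply Rle_lt_trans with ((e * Rabs l * Rabs l / 4) * / (Rabs l / 2 * Rabs l)).
    + apply Rmult_le_compat_r; [|lra]. left. apply Rinv_0_lt_compat. nra.
    + replace (e * Rabs l * Rabs l / 4 * / (Rabs l / 2 * Rabs l)) with (e / 2) by (field; lra). lra.
Qed.

Fixpoint smooth (e : R) (k : nat) (f : R -> R) : Prop :=
  match k with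
  | O => True
  | S j => exists f', (forall x, Rabs x < e -> is_derive f x (f' x)) /\ smooth e j f'
  end.

(* [jet e k c f]: the derivatives of f of order less than k vanish at 0, and the
   k-th one is c. *)
Fixpoint jet (e : R) (k : nat) (c : R) (f : R -> R) : Prop :=
  match k with
  | O => f 0 = c
  | S j => f 0 = 0 /\
      exists f', (forall x, Rabs x < e -> is_derive f x (f' x)) /\ jet e j c f'
  end.

Section Jets.
Variable e : R.
Hypothesis He : 0 < e.

Lemma locally_ball_0 x : Rabs x < e -> locally x (fun y => Rabs y < e).
Proof.
  intros Hx. assert (Hd : 0 < e - Rabs x) by lra. exists (mkposreal _ Hd). intros y Hy.
  change (Rabs (y - x) < e - Rabs x) in Hy.
  replace y with (x + (y - x)) by ring. eapply Rle_lt_trans; [apply Rabs_triang|]. lra.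
Qed.

Lemma is_derive_ext_ball (f g : R -> R) (x l : R) : (forall y, Rabs y < e -> f y = g y) -> Rabs x < e ->
  is_derive f x l -> is_derive g x l.
Proof.
  intros Hfg Hx. apply is_derive_ext_loc.
  generalize (locally_ball_0 x Hx). apply filter_imp. exact Hfg.
Qed.

Lemma jet_ext k c f g : (forall x, Rabs x < e -> f x = g x) -> jet e k c f -> jet e k c g.
Proof.
  intros Hfg. assert (H0 : f 0 = g 0) by (apply Hfg; rewrite Rabs_R0; exact He).
  destruct k; simpl; [congruence|]. intros [H1 [f' [H2 H3]]]. split; [congruence|].
  exists f'. split; [|exact H3]. intros x Hx. apply is_derive_ext_ball with f; auto.
Qed.

Lemma jet_derive k c f f' : (forall x, Rabs x < e -> is_derive f x (f' x)) ->
  jet e (S k) c f -> jet e k c f'.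
Proof.
  intros Hf [_ [f1 [H1 H2]]]. apply jet_ext with f1; [|exact H2].
  intros x Hx. rewrite <- (is_derive_unique _ _ _ (Hf x Hx)). symmetry.
  apply is_derive_unique. auto.
Qed.

Lemma smooth_ext k f g : (forall x, Rabs x < e -> f x = g x) -> smooth e k f -> smooth e k g.
Proof.
  intros Hfg. destruct k; simpl; [auto|]. intros [f' [H2 H3]].
  exists f'. split; [|exact H3]. intros x Hx. apply is_derive_ext_ball with f; auto.
Qed.

Lemma smooth_S k f : smooth e (S k) f -> smooth e k f.
Proof.
  revert f; induction k as [|k IH]; intros f; [simpl; auto|].
  intros [f' [H1 H2]]. exists f'. auto.
Qed.

Lemma smooth_le j k f : (j <= k)%nat -> smooth e k f -> smooth e j f.
Proof. induction 1 as [|k _ IH]; [auto|]. intros H. apply IH, smooth_S, H. Qed.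

Lemma jet_plus k c d f g :
  jet e k c f -> jet e k d g -> jet e k (c + d) (fun x => f x + g x).
Proof.
  revert f g; induction k as [|k IH]; intros f g; simpl; [intros; subst; reflexivity|].
  intros [H1 [f' [H2 H3]]] [K1 [g' [K2 K3]]]. split; [rewrite H1, K1; ring|].
  exists (fun x => f' x + g' x). split; [|auto].
  intros x Hx. apply (is_derive_plus f g); auto.
Qed.

Lemma jet_lower k c f : jet e (S k) c f -> jet e k 0 f.
Proof.
  revert f; induction k as [|k IH]; intros f; [simpl; tauto|].
  intros [H1 [f' [H2 H3]]]. split; [exact H1|]. exists f'. auto.
Qed.

Lemma jet_lt j k c f : (j < k)%nat -> jet e k c f -> jet e j 0 f.
Proof.
  intros Hjk. revert c. induction Hjk as [|k _ IH]; intros c H.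
  - apply jet_lower in H. exact H.
  - apply (IH 0), (jet_lower _ c), H.
Qed.

(** In the Leibniz rule only the derivative of highest order of f survives at 0: the part f g' has
    vanishing jet, since f is one order flatter than f'. *)
Lemma jet_mult k c f g : jet e k c f -> smooth e k g -> jet e k (c * g 0) (fun x => f x * g x).
Proof.
  revert c f g; induction k as [|k IH]; intros c f g; simpl; [intros; subst; reflexivity|].
  intros [H1 [f' [H2 H3]]] [g' [K1 K2]]. split; [rewrite H1; ring|].
  exists (fun x => f' x * g x + f x * g' x). split.
  - intros x Hx. apply (is_derive_mult f g); auto. intros; apply Rmult_comm.
  - replace (c * g 0) with (c * g 0 + 0 * g' 0) by ring. apply jet_plus.
    + apply IH; [exact H3|]. apply smooth_S. exists g'. auto.
    + apply IH; [|exact K2]. apply jet_lower with c. split; [exact H1|]. exists f'. auto.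
Qed.

Lemma jet_raise k f : jet e k 0 f -> smooth e (S k) f -> exists c, jet e (S k) c f.
Proof.
  revert f; induction k as [|k IH]; intros f H1 [f' [H2 H3]].
  - exists (f' 0). split; [exact H1|]. exists f'. split; [exact H2|reflexivity].
  - destruct (IH f') as [c Hc]; [apply jet_derive with f; assumption | exact H3|].
    exists c. split; [apply H1|]. exists f'. auto.
Qed.

Lemma jet_pow k : jet e k (INR (fact k)) (fun x => x ^ k).
Proof.
  induction k as [|k IH]; [reflexivity|].
  split; [simpl; ring|]. exists (fun x => x ^ k * INR (S k)). split.
  - intros x _. assert (H := is_derive_pow (fun x => x) (S k) x 1 (is_derive_id x)).
    change (Nat.pred (S k)) with k in H.
    replace (x ^ k * INR (S k)) with (INR (S k) * 1 * x ^ k) by ring. exact H.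
  - rewrite fact_simpl, mult_INR, Rmult_comm.
    apply (jet_mult k _ (fun x => x ^ k) (fun _ => INR (S k)) IH).
    clear IH. generalize (INR (S k)). induction k as [|k IH]; intros c; [exact I|].
    exists (fun _ => 0). split; [intros; apply @is_derive_const|]. apply IH.
Qed.

Lemma smooth_mult k f g : smooth e k f -> smooth e k g -> smooth e k (fun x => f x * g x).
Proof.
  assert (Hplus : forall k f g, smooth e k f -> smooth e k g -> smooth e k (fun x => f x + g x)).
  { clear. induction k as [|k IH]; intros f g; simpl; [auto|].
    intros [f' [H2 H3]] [g' [K2 K3]]. exists (fun x => f' x + g' x). split; [|auto].
    intros x Hx. apply (is_derive_plus f g); auto. }
  revert f g; induction k as [|k IH]; intros f g Hf Hg; [exact I|].
  assert (Hf' := smooth_S _ _ Hf). assert (Hg' := smooth_S _ _ Hg).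
  destruct Hf as [f' [H2 H3]]. destruct Hg as [g' [K2 K3]].
  exists (fun x => f' x * g x + f x * g' x). split; [|apply Hplus; apply IH; assumption].
  intros x Hx. apply (is_derive_mult f g); auto. intros; apply Rmult_comm.
Qed.

End Jets.

(** Polynomials with the constant coefficient first. They serve as profiles of the perturbations of
    the field, being smooth on all of M. *)
Fixpoint horner (l : list R) (x : R) : R :=
  match l with
  | nil => 0
  | c :: l' => c + x * horner l' x
  end.

Lemma horner_monomial c k : exists l, forall x, horner l x = c * x ^ k.
Proof.
  induction k as [|k [l Hl]].
  - exists (c :: nil). intros x. simpl. ring.
  - exists (0 :: l). intros x. simpl. rewrite Hl. ring.
Qed.

Lemma horner_plus l1 l2 : exists l, forall x, horner l x = horner l1 x + horner l2 x.
Proof.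
  revert l2; induction l1 as [|c1 l1 IH]; intros l2.
  - exists l2. intros; simpl; ring.
  - destruct l2 as [|c2 l2].
    + exists (c1 :: l1). intros; simpl; ring.
    + destruct (IH l2) as [l Hl]. exists (c1 + c2 :: l). intros x. simpl. rewrite Hl. ring.
Qed.

(* Truncated power series inversion: each step cancels the next coefficient of p u - 1. *)
Lemma horner_inverse e k u : 0 < e -> smooth e k u -> u 0 <> 0 ->
  exists l, jet e k 0 (fun x => horner l x * u x - 1).
Proof.
  intros He Hu Hu0.
  assert (Hsm : forall l j, smooth e j (horner l)).
  { induction l as [|c l IH]; intros j.
    - change (smooth e j (fun _ => 0)). generalize 0.
      induction j as [|j IHj]; intros c; [exact I|]. exists (fun _ => 0).
      split; [intros; apply @is_derive_const | apply IHj].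
    - assert (Hx : smooth e j (fun x => x * horner l x)).
      { apply smooth_mult; [|apply IH]. destruct j as [|j]; [exact I|].
        exists (fun _ => 1). split; [intros; apply @is_derive_id|]. generalize 1.
        induction j as [|j IHj]; intros c'; [exact I|]. exists (fun _ => 0).
        split; [intros; apply @is_derive_const | apply IHj]. }
      destruct j as [|j]; [exact I|]. destruct Hx as [f' [H1 H2]]. exists f'. split; [|exact H2].
      intros x Hx. simpl. replace (f' x) with (0 + f' x) by ring.
      apply (is_derive_plus (fun _ => c) (fun x => x * horner l x)); [apply @is_derive_const|auto]. }
  assert (Hsm2 : forall l j, smooth e j u -> smooth e j (fun x => horner l x * u x - 1)).
  { intros l j Hj. assert (H := smooth_mult e j _ _ (Hsm l j) Hj).
    destruct j as [|j]; [exact I|]. destruct H as [f' [H1 H2]]. exists f'. split; [|exact H2].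
    intros x Hx. replace (f' x) with (f' x - 0) by ring.
    apply (is_derive_minus (fun x => horner l x * u x) (fun _ => 1)); [auto|apply @is_derive_const]. }
  assert (Hmain : forall j, (j <= k)%nat -> exists l, jet e j 0 (fun x => horner l x * u x - 1)).
  { induction j as [|j IH]; intros Hj.
    - exists (/ u 0 :: nil). simpl. field. exact Hu0.
    - destruct (IH ltac:(lia)) as [l Hl].
      destruct (jet_raise e He j _ Hl (Hsm2 l (S j) (smooth_le e (S j) k u Hj Hu))) as [c Hc].
      (* The derivative of order j + 1 at 0 of w x^(j+1) u(x) is (j+1)! w u(0), and the lower ones
         vanish; this w cancels c and leaves the lower orders alone. *)
      destruct (horner_monomial (- c / (INR (fact (S j)) * u 0)) (S j)) as [l1 Hl1].
      destruct (horner_plus l l1) as [l2 Hl2].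
      exists l2.
      assert (Hfact := INR_fact_neq_0 (S j)).
      set (w := - c / (INR (fact (S j)) * u 0)) in *.
      assert (Hw : c + INR (fact (S j)) * (w * u 0) = 0) by (unfold w; field; auto).
      rewrite <- Hw.
      apply (jet_ext e He _ _ (fun x => (horner l x * u x - 1) + x ^ S j * (w * u x))).
      { intros x _. rewrite Hl2, Hl1. ring. }
      apply jet_plus; [exact Hc|].
      apply (jet_mult e (S j) _ (fun x => x ^ S j) (fun x => w * u x) (jet_pow e (S j))).
      apply (smooth_mult e (S j) (fun _ => w) u); [|apply smooth_le with k; assumption].
      generalize w (S j). clear.
      intros c n; revert c; induction n as [|n IHn]; intros c; [exact I|]. exists (fun _ => 0).
      split; [intros; apply @is_derive_const | apply IHn]. }
  apply (Hmain k). lia.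
Qed.

(* Induction on the order: the derivative of the remainder is the remainder of
   the derivative. *)
Lemma taylor_bound (e B : R) (k : nat) (Fs : nat -> R -> R) :
  (forall j x, (j < S k)%nat -> Rabs x < e -> is_derive (Fs j) x (Fs (S j) x)) ->
  (forall x, Rabs x < e -> Rabs (Fs (S k) x) <= B) ->
  forall x, Rabs x < e ->
    Rabs (Fs O x - sum_n (fun i => Fs i 0 / INR (fact i) * x ^ i) k) <= B * Rabs x ^ S k.
Proof.
  revert Fs; induction k as [|k IH]; intros Fs Hd Hb x Hx.
  - rewrite sum_O. simpl. destruct (MVT_gen (Fs O) 0 x (Fs 1%nat)) as [c [Hc Heq]].
    + intros z Hz. apply Hd; [lia|]. apply Rabs_def2 in Hx. apply Rabs_def1;
        revert Hz; unfold Rmin, Rmax; destruct Rle_dec; lra.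
    + intros z Hz. apply is_derive_continuity_pt with (Fs 1%nat z). apply Hd; [lia|].
      apply Rabs_def2 in Hx. apply Rabs_def1;
        revert Hz; unfold Rmin, Rmax; destruct Rle_dec; lra.
    + replace (Fs O x - Fs O 0 / 1 * 1) with (Fs O x - Fs O 0) by field.
      rewrite Heq, Rminus_0_r, Rabs_mult, Rmult_1_r.
      apply Rmult_le_compat_r; [apply Rabs_pos|]. apply Hb.
      apply Rabs_def2 in Hx. apply Rabs_def1;
        revert Hc; unfold Rmin, Rmax; destruct Rle_dec; lra.
  - assert (IH' := IH (fun j => Fs (S j)) ltac:(intros; apply Hd; [lia|assumption]) Hb).
    simpl in IH'. clear IH.
    set (R0 := fun x => Fs O x - sum_n (fun i => Fs i 0 / INR (fact i) * x ^ i) (S k)).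
    set (R1 := fun x => Fs 1%nat x - sum_n (fun i => Fs (S i) 0 / INR (fact i) * x ^ i) k).
    assert (HR : forall z, Rabs z < e -> is_derive R0 z (R1 z)).
    { intros z Hz. apply (is_derive_minus (Fs O)); [apply Hd; [lia|exact Hz]|].
      clear - z. induction k as [|k IH].
      - rewrite sum_O. apply is_derive_ext with (fun x => Fs O 0 / 1 * 1 + Fs 1%nat 0 / 1 * (x * 1)).
        { intros t. unfold sum_n. rewrite sum_n_Sm, sum_n_n by lia. reflexivity. }
        simpl. auto_derive; [exact I|]. field.
      - apply is_derive_ext with (fun x => sum_n (fun i => Fs i 0 / INR (fact i) * x ^ i) (S k)
            + Fs (S (S k)) 0 / INR (fact (S (S k))) * x ^ S (S k)).
        { intros t. symmetry. exact (sum_Sn (fun i => Fs i 0 / INR (fact i) * t ^ i) (S k)). }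
        rewrite sum_Sn.
        apply (is_derive_plus (fun x => sum_n (fun i => Fs i 0 / INR (fact i) * x ^ i) (S k)));
          [exact IH|].
        assert (H := is_derive_scal (fun x => x ^ S (S k)) z (Fs (S (S k)) 0 / INR (fact (S (S k)))) _
          (is_derive_pow (fun x => x) (S (S k)) z 1 (is_derive_id z))).
        change (Nat.pred (S (S k))) with (S k) in H.
        assert (H0 : INR (S (S k)) <> 0) by (apply not_0_INR; lia).
        assert (H1 := INR_fact_neq_0 (S k)).
        replace (Fs (S (S k)) 0 / INR (fact (S k)) * z ^ S k) with
          (Fs (S (S k)) 0 / INR (fact (S (S k))) * (INR (S (S k)) * 1 * z ^ S k)); [exact H|].
        rewrite (fact_simpl (S k)), mult_INR.
        revert H0 H1. generalize (INR (S (S k))) (INR (fact (S k))) (z ^ S k) (Fs (S (S k)) 0).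
        intros; field; auto. }
    destruct (MVT_gen R0 0 x R1) as [c [Hc Heq]].
    + intros z Hz. apply HR. apply Rabs_def2 in Hx. apply Rabs_def1;
        revert Hz; unfold Rmin, Rmax; destruct Rle_dec; lra.
    + intros z Hz. apply is_derive_continuity_pt with (R1 z). apply HR.
      apply Rabs_def2 in Hx. apply Rabs_def1;
        revert Hz; unfold Rmin, Rmax; destruct Rle_dec; lra.
    + assert (HR00 : R0 0 = 0).
      { unfold R0. unfold sum_n. rewrite sum_Sn_m by lia.
        rewrite (sum_n_m_ext_loc _ (fun _ : nat => zero)).
        - rewrite sum_n_m_const_zero. unfold plus, zero; simpl. field.
        - intros i Hi. rewrite pow_i by lia. apply Rmult_0_r. }
      rewrite HR00, !Rminus_0_r in Heq. fold (R0 x). rewrite Heq.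
      assert (Hcx : Rabs c <= Rabs x).
      { revert Hc. unfold Rmin, Rmax. destruct Rle_dec; intros.
        - rewrite !Rabs_right; lra.
        - rewrite !Rabs_left1; lra. }
      rewrite Rabs_mult. assert (H1 := IH' c ltac:(lra)). fold (R1 c) in H1.
      assert (HB : 0 <= B).
      { eapply Rle_trans; [apply Rabs_pos | apply (Hb x Hx)]. }
      change (Rabs x ^ S (S k)) with (Rabs x * Rabs x ^ S k).
      replace (B * (Rabs x * Rabs x ^ S k)) with ((B * Rabs x ^ S k) * Rabs x) by ring.
      apply Rmult_le_compat_r; [apply Rabs_pos|]. eapply Rle_trans; [exact H1|].
      apply Rmult_le_compat_l; [exact HB|]. change (Rabs c ^ S k <= Rabs x ^ S k). apply pow_incr. split; [apply Rabs_pos|exact Hcx].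
Qed.

(** * Families in one variable, and the regularity notions of the statement *)

Definition cont2 {T : UniformSpace} (f : T -> R -> R) (X : T) (a : R) : Prop :=
  continuous (fun q : T * R => f (fst q) (snd q)) (X, a).

Lemma cont2_eps {T : UniformSpace} (f : T -> R -> R) X a :
  cont2 f X a <->
  forall e, 0 < e -> exists d : posreal, forall Y b,
    ball X d Y -> Rabs (b - a) < d -> Rabs (f Y b - f X a) < e.
Proof.
  unfold cont2. rewrite continuous_R. split; intros H e He; destruct (H e He) as [d Hd]; exists d.
  - intros Y b HY Hb. apply (Hd (Y, b)). split; assumption.
  - intros [Y b] [HY Hb]. exact (Hd Y b HY Hb).
Qed.

Lemma cont3_cont2 {T : UniformSpace} (f : T -> R -> R -> R) X s a :
  cont3 f X s a -> cont2 (fun X a => f X s a) X a.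
Proof.
  rewrite cont3_eps, cont2_eps. intros H e He. destruct (H e He) as [d Hd]. exists d.
  intros Y b HY Hb. apply Hd; auto. rewrite Rminus_diag, Rabs_R0. apply cond_pos.
Qed.

(** A sequence of jointly continuous derivatives can be evaluated at a base point that moves with X,
    which the coefficients at a(X) require. *)
Lemma Ck_seq {T : UniformSpace} (D : R -> R -> Prop) (m : nat) (f : T -> R -> R -> R) (s e : R) :
  (forall a, Rabs a < e -> D s a) -> Ck D m f ->
  exists Gs : nat -> T -> R -> R,
    (forall X a, Gs O X a = f X s a) /\
    (forall j X a, (j < m)%nat -> Rabs a < e -> is_derive (Gs j X) a (Gs (S j) X a)) /\
    (forall j X a, (j <= m)%nat -> Rabs a < e -> cont2 (Gs j) X a).
Proof.
  intros HD. revert f; induction m as [|m IH]; intros f Hf.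
  - exists (fun _ X a => f X s a). split; [reflexivity|]. split; [lia|].
    intros j X a _ Ha. apply cont3_cont2, (Ck_cont _ _ _ _ _ _ Hf), HD, Ha.
  - assert (Hf0 := Hf). destruct Hf as [_ [f1 [f2 [H1 [H2 [H3 H4]]]]]].
    destruct (IH f2 H4) as [Gs [G1 [G2 G3]]].
    exists (fun j => match j with O => fun X a => f X s a | S i => Gs i end).
    split; [reflexivity|]. split.
    + intros [|j] X a Hj Ha; [rewrite G1; apply H2, HD, Ha | apply G2; [lia|exact Ha]].
    + intros [|j] X a Hj Ha; [|apply G3; [lia|exact Ha]].
      apply cont3_cont2, (Ck_cont _ _ _ _ _ _ Hf0), HD, Ha.
Qed.

Lemma Derive_n_seq (g : nat -> R -> R) (e : R) (m : nat) :
  (forall j a, (j < m)%nat -> Rabs a < e -> is_derive (g j) a (g (S j) a)) ->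
  forall j a, (j <= m)%nat -> Rabs a < e -> Derive_n (g O) j a = g j a.
Proof.
  intros Hg j. induction j as [|j IH]; intros a Hj Ha; [reflexivity|].
  simpl. apply is_derive_unique. apply is_derive_ext_ball with e (g j); [|exact Ha|].
  - intros y Hy. symmetry. apply IH; [lia|exact Hy].
  - apply Hg; [lia|exact Ha].
Qed.

Lemma Cr_on_interval_seq (r : nat) (e : R) (g : nat -> R -> R) :
  (forall j a, (j < r)%nat -> Rabs a < e -> is_derive (g j) a (g (S j) a)) ->
  (forall a, Rabs a < e -> continuous (g r) a) -> Cr_on_interval r e (g O).
Proof.
  intros Hg Hc a Ha. assert (Ha' : Rabs a < e) by (apply Rabs_def1; lra). split.
  - intros [|k] Hk; [exact I|]. simpl. exists (g (S k) a).
    apply is_derive_ext_ball with e (g k); [|exact Ha'|].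
    + intros y Hy. symmetry. apply (Derive_n_seq g e r Hg); [lia|exact Hy].
    + apply Hg; [lia|exact Ha'].
  - apply continuous_ext_loc with (g r); [|apply Hc, Ha'].
    generalize (locally_ball_0 e a Ha'). apply filter_imp. intros y Hy.
    symmetry. apply (Derive_n_seq g e r Hg); [lia|exact Hy].
Qed.

Lemma Ck_Cr_on_interval (r : nat) (e : R) (h : R -> R) :
  Ck (fun _ a => Rabs a < e) r (fun (_ : R) (_ : R) a => h a) -> Cr_on_interval r e h.
Proof.
  intros Hh. destruct (Ck_seq _ r _ 0 e (fun a Ha => Ha) Hh) as [Gs [G1 [G2 G3]]].
  assert (H : Cr_on_interval r e (Gs O 0)).
  { apply (Cr_on_interval_seq r e (fun j => Gs j 0)).
    - intros; apply G2; assumption.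
    - intros a Ha. assert (Hc := G3 r 0 a (le_n r) Ha). apply continuous_R. intros d Hd.
      destruct (proj1 (cont2_eps _ _ _) Hc d Hd) as [d' Hd']. exists d'. intros y Hy.
      apply Hd'; [apply ball_center | exact Hy]. }
  replace h with (Gs O 0); [exact H|].
  apply functional_extensionality. intros a. apply G1.
Qed.

Lemma Ck_ex_diff_n {T : UniformSpace} (D : R -> R -> Prop) (k : nat) (f : T -> R -> R -> R) X s a :
  open2 D -> Ck D k f -> D s a -> ex_diff_n (f X) k s a.
Proof.
  intros HD. revert f s a; induction k as [|k IH]; intros f s a Hf Hsa;
    (split; [apply cont3_2d, (Ck_cont _ _ _ _ _ _ Hf Hsa)|]); [exact I|].
  destruct Hf as [_ [f1 [f2 [H1 [H2 [H3 H4]]]]]].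
  split; [exists (f1 X s a); auto|]. split; [exists (f2 X s a); apply H2, Hsa|]. split.
  - apply ex_diff_n_ext_loc with (f1 X); [|auto].
    generalize (HD s a Hsa). apply locally_2d_impl, locally_2d_forall. intros u v Huv.
    symmetry. apply is_derive_unique, H1, Huv.
  - apply ex_diff_n_ext_loc with (f2 X); [|auto].
    generalize (HD s a Hsa). apply locally_2d_impl, locally_2d_forall. intros u v Huv.
    symmetry. apply is_derive_unique. exact (H2 X u v Huv).
Qed.

(** [partial_derive i j] takes the j derivatives in the second variable first, hence the order of
    the two inductions. *)
Lemma Ck_partial_derive {T : UniformSpace} (D : R -> R -> Prop) (k i j : nat) (f : T -> R -> R -> R) :
  open2 D -> Ck D k f -> (i + j <= k)%nat ->
  exists g, Ck D (k - (i + j)) g /\ forall X s a, D s a -> partial_derive i j (f X) s a = g X s a.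
Proof.
  intros HD Hf Hij.
  assert (Hj : exists g, Ck D (k - j) g /\
             forall X s a, D s a -> Derive_n (fun z => f X s z) j a = g X s a).
  { assert (Hjk : (j <= k)%nat) by lia. clear Hij. induction j as [|j IH].
    - exists f. rewrite Nat.sub_0_r. split; [exact Hf | reflexivity].
    - destruct (IH ltac:(lia)) as [g [Hg1 Hg2]].
      replace (k - j)%nat with (S (k - S j)) in Hg1 by lia.
      destruct Hg1 as [_ [g1 [g2 [H1 [H2 [H3 H4]]]]]]. exists g2. split; [exact H4|].
      intros X s a Hsa. simpl. apply is_derive_unique.
      apply is_derive_ext_loc with (fun a => g X s a); [|exact (H2 X s a Hsa)].
      generalize (locally_2d_snd _ _ _ (HD s a Hsa)). apply filter_imp. intros b Hb.
      symmetry. apply Hg2, Hb. }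
  destruct Hj as [g [Hg1 Hg2]]. unfold partial_derive.
  assert (Hi : exists g', Ck D (k - j - i) g' /\ forall X s a, D s a ->
             Derive_n (fun t => Derive_n (fun z => f X t z) j a) i s = g' X s a).
  { assert (Hik : (i <= k - j)%nat) by lia. clear Hij. induction i as [|i IH].
    - exists g. rewrite Nat.sub_0_r. split; [exact Hg1 | exact Hg2].
    - destruct (IH ltac:(lia)) as [h [Hh1 Hh2]].
      replace (k - j - i)%nat with (S (k - j - S i)) in Hh1 by lia.
      destruct Hh1 as [_ [h1 [h2 [H1 [H2 [H3 H4]]]]]]. exists h1. split; [exact H3|].
      intros X s a Hsa. simpl. apply is_derive_unique.
      apply is_derive_ext_loc with (fun s => h X s a); [|exact (H1 X s a Hsa)].
      generalize (locally_2d_fst _ _ _ (HD s a Hsa)). apply filter_imp. intros b Hb.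
      symmetry. apply Hh2, Hb. }
  replace (k - (i + j))%nat with (k - j - i)%nat by lia. exact Hi.
Qed.

(* The converse of [Ck_ex_diff_n], for a family whose partial derivatives are
   jointly continuous; reordering the derivatives is Schwarz's theorem. *)
Lemma ex_diff_n_Ck {T : UniformSpace} (D : R -> R -> Prop) (r : nat) (f : T -> R -> R -> R) :
  open2 D -> (forall X s a, D s a -> ex_diff_n (f X) r s a) ->
  (forall i j, (i + j <= r)%nat -> forall X s a, D s a ->
     cont3 (fun X => partial_derive i j (f X)) X s a) ->
  Ck D r f.
Proof.
  intros HD Hf Hc.
  assert (Hloc : forall X s a, D s a -> locally_2d (ex_diff_n (f X) r) s a).
  { intros X s a Hsa. generalize (HD s a Hsa). apply locally_2d_impl, locally_2d_forall. auto. }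
  assert (Hmain : forall k i j, (i + j + k <= r)%nat ->
            Ck D k (fun X => partial_derive i j (f X))).
  { induction k as [|k IH]; intros i j Hijk; (split; [intros X s a Hsa; apply Hc; [lia|exact Hsa]|]);
      [exact I|].
    exists (fun X => partial_derive (S i) j (f X)), (fun X => partial_derive i (S j) (f X)).
    split; [|split; [|split; apply IH; lia]]; intros X s a Hsa.
    - apply Derive_correct.
      apply (ex_diff_n_ex_deriv_inf_1 r i j); [lia|auto].
    - rewrite <- Derive_partial_derive.
      + apply Derive_correct. apply (ex_diff_n_ex_deriv_inf_2 r i j); [lia|auto].
      + generalize (Hloc X s a Hsa). apply locally_2d_impl, locally_2d_forall. intros u v Huv.
        apply ex_diff_n_m with (2 := Huv). lia. }
  exact (Hmain r O O ltac:(lia)).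
Qed.

(** * Compact sets of the plane *)

Lemma compact_tube {T : UniformSpace} (K : R * R -> Prop) (P : T -> R * R -> Prop) (t : T) :
  compact_set K -> (forall p, K p -> locally (t, p) (fun q => P (fst q) (snd q))) ->
  locally t (fun u => forall p, K p -> P u p).
Proof.
  intros HK HP.
  (* The cover is indexed by the radius around t that works near p; a finite subcover has a smallest
     radius. *)
  destruct (HK posreal (fun d p => locally p (fun q => forall u, ball t d u -> P u q))) as [l Hl].
  - intros d p Hp. apply locally_locally in Hp. exact Hp.
  - intros p Hp. destruct (HP p Hp) as [d Hd]. exists d. exists d. intros q Hq u Hu.
    apply (Hd (u, q)). split; assumption.
  - assert (Hmin : exists d : posreal, forall d', In d' l -> d <= d').
    { clear. induction l as [|d l [e He]].
      - exists (mkposreal 1 Rlt_0_1). intros d' [].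
      - assert (Hm : 0 < Rmin d e) by (apply Rmin_glb_lt; apply cond_pos).
        exists (mkposreal _ Hm). intros d' [->|H]; simpl; [apply Rmin_l|].
        eapply Rle_trans; [apply Rmin_r | auto]. }
    destruct Hmin as [d Hd]. exists d. intros u Hu p Hp.
    destruct (Hl p Hp) as [d' [Hin Hp']]. apply (locally_singleton _ _ Hp').
    apply ball_le with d; [apply Hd, Hin | exact Hu].
Qed.

(** Two real inductions: first up a vertical segment, keeping a neighbourhood of its abscissa, then
    along [a, b]. Heights are measured from [gam], so every slice is the same interval. *)
Lemma compact_tube_graph (gam : R -> R) (a b d : R) :
  (forall s, continuous gam s) ->
  compact_set (fun p => a <= fst p <= b /\ Rabs (snd p - gam (fst p)) <= d).
Proof.
  intros Hg I O HO Hcov.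
  set (covers := fun (l : list I) p => exists i, In i l /\ O i p).
  assert (Hslice : forall s, a <= s <= b -> forall z, - d <= z <= d ->
    exists l, locally s (fun t => forall w, - d <= w <= z -> covers l (t, gam t + w))).
  { intros s Hs. apply (real_induction (fun z =>
      exists l, locally s (fun t => forall w, - d <= w <= z -> covers l (t, gam t + w)))).
    intros z Hz IH.
    destruct (Hcov (s, gam s + z)) as [i Hi].
    { simpl. split; [exact Hs|]. replace (gam s + z - gam s) with z by ring.
      apply Rabs_le. lra. }
    destruct (HO i _ Hi) as [e He]. assert (He0 := cond_pos e).
    assert (Hnear : locally s (fun t => forall w, Rabs (w - z) < e / 2 -> O i (t, gam t + w))).
    { assert (H1 := proj1 (continuous_R _ _) (Hg s) (e / 2) ltac:(lra)).
      assert (H2 : locally s (fun t => Rabs (t - s) < e)) by (exists e; intros y Hy; exact Hy).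
      generalize (filter_and _ _ H1 H2). apply filter_imp. intros t [Ht1 Ht2] w Hw.
      apply He. split; [exact Ht2|].
      change (Rabs ((gam t + w) - (gam s + z)) < e).
      replace (gam t + w - (gam s + z)) with ((gam t - gam s) + (w - z)) by ring.
      eapply Rle_lt_trans; [apply Rabs_triang|]. lra. }
    assert (He4 : 0 < e / 4) by lra. exists (mkposreal _ He4). intros v Hv Hvd.
    change (Rabs (v - z) < e / 4) in Hv. apply Rabs_def2 in Hv.
    destruct (Rle_lt_dec (- d) (z - e / 4)) as [Hl|Hl].
    - destruct (IH (z - e / 4) ltac:(lra)) as [l Hlc]. exists (i :: l).
      generalize (filter_and _ _ Hnear Hlc). apply filter_imp. intros t [Ht1 Ht2] w Hw.
      destruct (Rle_lt_dec w (z - e / 4)) as [Hw'|Hw'].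
      + destruct (Ht2 w ltac:(lra)) as [j [Hj1 Hj2]]. exists j. split; [right; exact Hj1|exact Hj2].
      + exists i. split; [left; reflexivity|]. apply Ht1. apply Rabs_def1; lra.
    - exists (i :: nil). revert Hnear. apply filter_imp. intros t Ht w Hw.
      exists i. split; [left; reflexivity|]. apply Ht. apply Rabs_def1; lra. }
  assert (Hstep : forall s, a <= s <= b -> exists l,
     locally s (fun t => forall w, - d <= w <= d -> covers l (t, gam t + w))).
  { intros s Hs. destruct (Rle_lt_dec (- d) d) as [Hd|Hd]; [apply Hslice; lra|].
    exists nil. apply filter_forall. intros t w Hw. lra. }
  destruct (Rle_lt_dec a b) as [Hab|Hab].
  2:{ exists nil. intros p [Hp _]. lra. }
  assert (Hall : forall u, a <= u <= b -> exists l, forall s w,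
            a <= s <= u -> - d <= w <= d -> covers l (s, gam s + w)).
  { apply (real_induction (fun u => exists l, forall s w,
            a <= s <= u -> - d <= w <= d -> covers l (s, gam s + w))).
    intros u Hu IH. destruct (Hstep u Hu) as [l [e He]]. assert (He0 := cond_pos e).
    exists e. intros v Hv Hvab. change (Rabs (v - u) < e) in Hv. apply Rabs_def2 in Hv.
    assert (Hl : forall s w, u - e < s < u + e -> - d <= w <= d -> covers l (s, gam s + w)).
    { intros s w Hs Hw. apply He; [|exact Hw]. change (Rabs (s - u) < e). apply Rabs_def1; lra. }
    destruct (Rle_lt_dec a (u - e / 2)) as [Hlt|Hlt].
    - destruct (IH (u - e / 2) ltac:(lra)) as [l' Hl']. exists (l ++ l'). intros s w Hs Hw.
      destruct (Rle_lt_dec s (u - e / 2)) as [Hs'|Hs'].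
      + destruct (Hl' s w ltac:(lra) Hw) as [j [Hj1 Hj2]]. exists j.
        split; [apply in_or_app; right|]; assumption.
      + destruct (Hl s w ltac:(lra) Hw) as [j [Hj1 Hj2]]. exists j.
        split; [apply in_or_app; left|]; assumption.
    - exists l. intros s w Hs Hw. apply Hl; lra. }
  destruct (Hall b ltac:(lra)) as [l Hl]. exists l. intros [x y] [Hx Hy]. simpl in *.
  replace y with (gam x + (y - gam x)) by ring. apply Hl; [exact Hx|].
  apply Rabs_le_between in Hy. lra.
Qed.

Lemma compact_bounded (K : R * R -> Prop) (f : R * R -> R) :
  compact_set K -> (forall p, K p -> continuous f p) -> exists B, forall p, K p -> Rabs (f p) <= B.
Proof.
  intros HK Hf.
  destruct (HK nat (fun n p => locally p (fun q => Rabs (f q) <= INR n))) as [l Hl].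
  - intros n p Hp. apply locally_locally in Hp. exact Hp.
  - intros p Hp. destruct (archimed_cor1 (/ (Rabs (f p) + 1))) as [n [Hn1 Hn2]].
    { apply Rinv_0_lt_compat. pose proof (Rabs_pos (f p)). lra. }
    assert (Hn : Rabs (f p) + 1 < INR n).
    { pose proof (Rabs_pos (f p)). apply Rinv_lt_cancel; [apply lt_0_INR; lia|exact Hn1]. }
    exists n. generalize (proj1 (continuous_R _ _) (Hf p Hp) 1 Rlt_0_1). apply filter_imp.
    intros q Hq. replace (f q) with (f p + (f q - f p)) by ring.
    eapply Rle_trans; [apply Rabs_triang|]. lra.
  - assert (Hmax : exists B, forall n, In n l -> INR n <= B).
    { clear. induction l as [|n l [B HB]]; [exists 0; intros n []|].
      exists (Rmax (INR n) B). intros k [->|Hk]; [apply Rmax_l|].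
      eapply Rle_trans; [apply HB, Hk | apply Rmax_r]. }
    destruct Hmax as [B HB]. exists B. intros p Hp. destruct (Hl p Hp) as [n [Hn Hp']].
    eapply Rle_trans; [apply (locally_singleton _ _ Hp') | apply HB, Hn].
Qed.

(** * Vector fields close to X0 on a tube *)

Lemma Cr_close_sym K r e X Y : Cr_close K r e X Y -> Cr_close K r e Y X.
Proof.
  intros H i j x y Hij HK. destruct (H i j x y Hij HK).
  split; rewrite Rabs_minus_sym; assumption.
Qed.

Lemma Cr_close_trans K r e1 e2 X Y Z :
  Cr_close K r e1 X Y -> Cr_close K r e2 Y Z -> Cr_close K r (e1 + e2) X Z.
Proof.
  intros H1 H2 i j x y Hij HK.
  destruct (H1 i j x y Hij HK) as [A1 A2]. destruct (H2 i j x y Hij HK) as [B1 B2].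
  apply Rabs_def2 in A1, A2, B1, B2. split; apply Rabs_def1; lra.
Qed.

Lemma Cr_close_refl K r e X : 0 < e -> Cr_close K r e X X.
Proof. intros He i j x y _ _. rewrite !Rminus_diag, Rabs_R0. auto. Qed.

Lemma Cr_close_le K r e e' X Y : e <= e' -> Cr_close K r e X Y -> Cr_close K r e' X Y.
Proof.
  intros He H i j x y Hij HK. destruct (H i j x y Hij HK). split; lra.
Qed.

Section NearSpace.
Variables (K : R * R -> Prop) (r : nat) (P : vfield -> Prop) (X0 : vfield) (HX0 : P X0).

(** One fixed compact set K suffices for the whole argument, so C^r closeness on K serves as the
    distance. X0 is the point that the structure demands. *)
Definition near_mixin : UniformSpace.mixin_of {X : vfield | P X} :=
  UniformSpace.Mixin {X : vfield | P X} (exist P X0 HX0)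
    (fun X e Y => Cr_close K r e (proj1_sig X) (proj1_sig Y))
    (fun X e => Cr_close_refl K r e (proj1_sig X) (cond_pos e))
    (fun X Y e => Cr_close_sym K r e (proj1_sig X) (proj1_sig Y))
    (fun X Y Z e1 e2 => Cr_close_trans K r e1 e2 (proj1_sig X) (proj1_sig Y) (proj1_sig Z)).

Definition near_space : UniformSpace := UniformSpace.Pack _ near_mixin {X : vfield | P X}.

End NearSpace.

(* Strict closeness with a margin, so that the ball is open. *)
Definition Cr_ball (M K : R * R -> Prop) (r : nat) (X0 : vfield) (e : R) (X : vfield) : Prop :=
  Cr_vfield M r X /\ exists e', e' < e /\ Cr_close K r e' X0 X.

Lemma Cr_ball_center M K r X0 e : 0 < e -> Cr_vfield M r X0 -> Cr_ball M K r X0 e X0.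
Proof. intros He H. split; [exact H|]. exists (e / 2). split; [lra|]. apply Cr_close_refl. lra. Qed.

Lemma vfield_partial_continuous (f : vfield -> R -> R -> R) M r X i j x y :
  (f = vx \/ f = vy) -> Cr_vfield M r X -> M (x, y) -> (i + j <= r)%nat ->
  continuity_2d_pt (partial_derive i j (f X)) x y.
Proof.
  intros Hf HX HM Hij.
  assert (H : ex_diff_n (f X) r x y) by (destruct (HX x y HM); destruct Hf; subst; assumption).
  apply (ex_diff_n_deriv r i j Hij) in H.
  destruct (r - (i + j))%nat; apply H.
Qed.

Definition clamp (a b x : R) : R := Rmax a (Rmin b x).

Lemma clamp_in a b x : a <= b -> a <= clamp a b x <= b.
Proof. intros H. unfold clamp, Rmax, Rmin. destruct (Rle_dec b x), (Rle_dec a _); lra. Qed.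

Lemma clamp_id a b x : a <= x <= b -> clamp a b x = x.
Proof. intros H. unfold clamp, Rmax, Rmin. destruct (Rle_dec b x), (Rle_dec a _); lra. Qed.

Lemma clamp_lipschitz a b x y : a <= b -> Rabs (clamp a b x - clamp a b y) <= Rabs (x - y).
Proof.
  intros H. unfold clamp, Rmax, Rmin.
  destruct (Rle_dec b x), (Rle_dec b y); repeat destruct Rle_dec;
    unfold Rabs; repeat destruct Rcase_abs; lra.
Qed.

Lemma clamp_continuous a b x : a <= b -> continuous (clamp a b) x.
Proof.
  intros H. apply (continuous_of_lipschitz _ 1). intros s t. rewrite Rmult_1_l.
  apply clamp_lipschitz, H.
Qed.

Section ClampedField.
Variables (M : R * R -> Prop) (r : nat) (X0 : vfield) (gam : R -> R) (al be d c dl : R).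
Hypothesis HX0 : Cr_vfield M r X0.
Hypothesis Hr : (1 <= r)%nat.
Hypothesis gam_cont : forall s, continuous gam s.
Hypothesis Hab : al < be.
Hypothesis Hd : 0 < d.
Hypothesis Hc : 0 < c.
Hypothesis Hdl : dl = 1 \/ dl = -1.

Definition tube (p : R * R) : Prop := al <= fst p <= be /\ Rabs (snd p - gam (fst p)) <= d.

Hypothesis tube_M : forall p, tube p -> M p.
Hypothesis tube_speed : forall x y, tube (x, y) -> c <= dl * vx X0 x y.

(** Within c/2 of X0 the horizontal speed stays at least c/2; within 1, the derivatives are bounded
    by those of X0 plus 1. *)
Definition radius : R := Rmin (c / 2) 1.

Lemma radius_pos : 0 < radius.
Proof. apply Rmin_glb_lt; lra. Qed.

Definition good : vfield -> Prop := Cr_ball M tube r X0 radius.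

Definition good_X0 : good X0 := Cr_ball_center M tube r X0 radius radius_pos HX0.

Definition goods : UniformSpace := near_space tube r good X0 good_X0.

(** With [clamp al be x] this is a retraction of the plane onto the tube that is 1-Lipschitz in y.
    Fields composed with it are defined, bounded and Lipschitz in y everywhere. *)
Definition ret_y (x y : R) : R :=
  gam (clamp al be x) + clamp (- d) d (y - gam (clamp al be x)).

Lemma ret_tube x y : tube (clamp al be x, ret_y x y).
Proof.
  split; simpl; [apply clamp_in; lra|]. unfold ret_y.
  replace (gam (clamp al be x) + clamp (- d) d (y - gam (clamp al be x)) - gam (clamp al be x))
    with (clamp (- d) d (y - gam (clamp al be x))) by ring.
  apply Rabs_le, clamp_in. lra.
Qed.

Lemma ret_id x y : tube (x, y) -> clamp al be x = x /\ ret_y x y = y.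
Proof.
  intros [H1 H2]. simpl in *. assert (Hx : clamp al be x = x) by (apply clamp_id, H1).
  split; [exact Hx|]. unfold ret_y. rewrite Hx, clamp_id; [ring|].
  apply Rabs_le_between, H2.
Qed.

Lemma ret_continuous (X : goods) x y :
  cont3 (fun (_ : goods) x _ => clamp al be x) X x y /\
  cont3 (fun (_ : goods) x y => ret_y x y) X x y.
Proof.
  assert (H1 : forall x y, cont3 (fun (_ : goods) x _ => clamp al be x) X x y).
  { intros u v. apply (continuous_comp (fun q : goods * (R * R) => fst (snd q)) (clamp al be)).
    - apply (continuous_comp (fun q : goods * (R * R) => snd q) fst);
        [apply continuous_snd | apply continuous_fst].
    - apply clamp_continuous. lra. }
  assert (H2 : continuous (fun q : goods * (R * R) => gam (clamp al be (fst (snd q)))) (X, (x, y))).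
  { apply (continuous_comp (fun q : goods * (R * R) => clamp al be (fst (snd q))) gam);
      [apply H1 | apply gam_cont]. }
  split; [apply H1|]. unfold cont3, ret_y.
  apply (continuous_plus (fun q : goods * (R * R) => gam (clamp al be (fst (snd q))))); [exact H2|].
  apply (continuous_comp (fun q : goods * (R * R) => snd (snd q) - gam (clamp al be (fst (snd q))))
           (clamp (- d) d)); [|apply clamp_continuous; lra].
  apply (continuous_minus (fun q : goods * (R * R) => snd (snd q))); [|exact H2].
  apply (continuous_comp (fun q : goods * (R * R) => snd q) snd); apply continuous_snd.
Qed.

Definition clamped (f : vfield -> R -> R -> R) : goods -> R -> R -> R :=
  fun X x y => f (proj1_sig X) (clamp al be x) (ret_y x y).

(** Half of the error comes from changing the field, uniformly on the tube by the choice of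
    distance, and half from moving the point while the field X is fixed. *)
Lemma clamped_partial_continuous f i j X x y : (f = vx \/ f = vy) -> (i + j <= r)%nat ->
  cont3 (clamped (fun Z => partial_derive i j (f Z))) X x y.
Proof.
  intros Hf Hij.
  destruct (ret_continuous X x y) as [C1 C2].
  apply cont3_eps. intros e He.
  destruct (vfield_partial_continuous f M r (proj1_sig X) i j (clamp al be x) (ret_y x y) Hf
              (proj1 (proj2_sig X)) (tube_M _ (ret_tube x y)) Hij
              (mkposreal (e / 2) ltac:(lra))) as [d1 H1].
  destruct (proj1 (cont3_eps _ _ _ _) C1 d1 (cond_pos d1)) as [d2 H2].
  destruct (proj1 (cont3_eps _ _ _ _) C2 d1 (cond_pos d1)) as [d3 H3].
  assert (Hm : 0 < Rmin (e / 2) (Rmin d2 d3)).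
  { repeat apply Rmin_glb_lt; try apply cond_pos. lra. }
  exists (mkposreal _ Hm). simpl. intros Y u v HY Hu Hv.
  pose proof (Rmin_l (e / 2) (Rmin d2 d3)). pose proof (Rmin_r (e / 2) (Rmin d2 d3)).
  pose proof (Rmin_l d2 d3). pose proof (Rmin_r d2 d3).
  assert (A := H2 X u v (ball_center X d2) ltac:(lra) ltac:(lra)). simpl in A.
  assert (B := H3 X u v (ball_center X d3) ltac:(lra) ltac:(lra)). simpl in B.
  assert (E := H1 _ _ A B). simpl in E. unfold clamped.
  assert (G := HY i j _ _ Hij (ret_tube u v)). destruct G as [G1 G2].
  set (p := partial_derive i j (f (proj1_sig Y)) (clamp al be u) (ret_y u v)) in *.
  set (q := partial_derive i j (f (proj1_sig X)) (clamp al be u) (ret_y u v)) in *.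
  assert (Hpq : Rabs (p - q) < e / 2).
  { unfold p, q. destruct Hf; subst f; lra. }
  match goal with |- Rabs (_ - ?w) < _ => replace (p - w) with ((p - q) + (q - w)) by ring end.
  eapply Rle_lt_trans; [apply Rabs_triang|]. lra.
Qed.

Lemma clamped_continuous f X x y : (f = vx \/ f = vy) -> cont3 (clamped f) X x y.
Proof. intros Hf. apply (clamped_partial_continuous f 0 0 X x y Hf). lia. Qed.

Lemma good_close f (X : goods) i j x y : (f = vx \/ f = vy) -> (i + j <= r)%nat -> tube (x, y) ->
  Rabs (partial_derive i j (f (proj1_sig X)) x y - partial_derive i j (f X0) x y) < radius.
Proof.
  intros Hf Hij Ht. destruct X as [X [HX [e [He H]]]]. simpl.
  destruct (H i j x y Hij Ht). destruct Hf; subst f; lra.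
Qed.

Lemma good_speed (X : goods) x y : tube (x, y) -> c / 2 <= dl * vx (proj1_sig X) x y.
Proof.
  intros Ht. assert (H := good_close vx X 0 0 x y (or_introl eq_refl) ltac:(lia) Ht).
  assert (H0 := tube_speed x y Ht). change (Rabs (vx (proj1_sig X) x y - vx X0 x y) < radius) in H.
  assert (radius <= c / 2) by apply Rmin_l. apply Rabs_def2 in H.
  destruct Hdl; subst dl; lra.
Qed.

(** Compactness is applied to X0 alone; the other fields stay within 1 of it, so one bound serves
    them all. *)
Lemma partial_bound : exists B, 0 < B /\ forall f (X : goods) i j x y,
  (f = vx \/ f = vy) -> (i + j <= 1)%nat -> tube (x, y) ->
  Rabs (partial_derive i j (f (proj1_sig X)) x y) <= B.
Proof.
  assert (HK : compact_set tube) by (apply (compact_tube_graph gam al be d), gam_cont).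
  assert (H0 : forall f i j, (f = vx \/ f = vy) -> (i + j <= r)%nat ->
     exists B, forall x y, tube (x, y) -> Rabs (partial_derive i j (f X0) x y) <= B).
  { intros f i j Hf Hij.
    destruct (compact_bounded tube (fun p => partial_derive i j (f X0) (fst p) (snd p)) HK) as [B HB].
    - intros [x y] Hp. apply continuity_2d_pt_filterlim.
      apply (vfield_partial_continuous f M r); auto.
    - exists B. intros x y Hxy. apply (HB (x, y) Hxy). }
  assert (H1 : forall f, (f = vx \/ f = vy) -> exists B, forall i j x y,
     (i + j <= 1)%nat -> tube (x, y) -> Rabs (partial_derive i j (f X0) x y) <= B).
  { intros f Hf.
    destruct (H0 f 0%nat 0%nat Hf ltac:(lia)) as [B1 H1]. destruct (H0 f 1%nat 0%nat Hf Hr) as [B2 H2].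
    destruct (H0 f 0%nat 1%nat Hf Hr) as [B3 H3].
    exists (Rmax B1 (Rmax B2 B3)). intros i j x y Hij Hxy.
    pose proof (Rmax_l B1 (Rmax B2 B3)). pose proof (Rmax_r B1 (Rmax B2 B3)).
    pose proof (Rmax_l B2 B3). pose proof (Rmax_r B2 B3).
    specialize (H1 x y Hxy). specialize (H2 x y Hxy). specialize (H3 x y Hxy).
    destruct i as [|[|i]]; destruct j as [|[|j]]; try lia; lra. }
  destruct (H1 vx (or_introl eq_refl)) as [B1 H2]. destruct (H1 vy (or_intror eq_refl)) as [B2 H3].
  exists (Rmax 1 (Rmax B1 B2) + 1).
  pose proof (Rmax_l 1 (Rmax B1 B2)). pose proof (Rmax_r 1 (Rmax B1 B2)).
  pose proof (Rmax_l B1 B2). pose proof (Rmax_r B1 B2).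
  split; [lra|]. intros f X i j x y Hf Hij Ht.
  assert (HX := good_close f X i j x y Hf ltac:(lia) Ht).
  assert (radius <= 1) by apply Rmin_r.
  assert (HfX : Rabs (partial_derive i j (f X0) x y) <= Rmax 1 (Rmax B1 B2)).
  { specialize (H2 i j x y Hij Ht). specialize (H3 i j x y Hij Ht). destruct Hf; subst f; lra. }
  set (u := partial_derive i j (f (proj1_sig X)) x y) in *.
  set (v := partial_derive i j (f X0) x y) in *.
  replace u with (v + (u - v)) by ring. eapply Rle_trans; [apply Rabs_triang|]. lra.
Qed.

Definition slope : goods -> R -> R -> R := fun X x y => clamped vy X x y / clamped vx X x y.

Lemma clamped_speed X x y : c / 2 <= dl * clamped vx X x y.
Proof. apply good_speed, ret_tube. Qed.

Lemma clamped_nonzero X x y : clamped vx X x y <> 0.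
Proof. intros H. assert (H1 := clamped_speed X x y). rewrite H in H1. lra. Qed.

Lemma slope_continuous X x y : cont3 slope X x y.
Proof.
  apply (continuous_mult (fun q : goods * (R * R) => clamped vy (fst q) (fst (snd q)) (snd (snd q)))
    (fun q : goods * (R * R) => / clamped vx (fst q) (fst (snd q)) (snd (snd q)))).
  - apply (clamped_continuous vy X x y). auto.
  - apply (continuous_comp (fun q : goods * (R * R) => clamped vx (fst q) (fst (snd q)) (snd (snd q)))
      Rinv).
    + apply (clamped_continuous vx X x y). auto.
    + apply continuous_Rinv, clamped_nonzero.
Qed.

Lemma speed_abs (v : R) : c / 2 <= dl * v -> c / 2 <= Rabs v.
Proof.
  intros H. pose proof (Rle_abs v). pose proof (Rle_abs (- v)) as H1. rewrite Rabs_Ropp in H1.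
  destruct Hdl; subst dl; lra.
Qed.

Lemma slope_bounds : exists B L, 1 <= L /\
  (forall X x y, Rabs (slope X x y) <= B) /\
  (forall X x y, Rabs (clamped vx X x y) <= B) /\
  (forall X x y z, Rabs (slope X x y - slope X x z) <= L * Rabs (y - z)).
Proof.
  destruct partial_bound as [B [HB H]].
  assert (Hinv : forall v, c / 2 <= Rabs v -> v <> 0 /\ Rabs (/ v) <= 2 / c).
  { intros v Hv. assert (v <> 0) by (intros H0; rewrite H0, Rabs_R0 in Hv; lra).
    split; [assumption|]. rewrite Rabs_inv. replace (2 / c) with (/ (c / 2)) by (field; lra).
    apply Rinv_le_contravar; lra. }
  assert (Hpos : 0 < 2 / c) by (apply Rdiv_lt_0_compat; lra).
  assert (HBc : 0 < B * (2 / c)) by (apply Rmult_lt_0_compat; lra).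
  (* With |p| >= c/2 and all quantities bounded by B, the derivative (q' p - q p') / p^2 of the
     slope is at most 2 B^2 (2/c)^2; the 1 secures 1 <= L. *)
  set (L := 2 * B * B * (2 / c) * (2 / c) + 1).
  assert (HL : 1 <= L).
  { unfold L. replace (2 * B * B * (2 / c) * (2 / c)) with
      (2 * (B * (2 / c)) * (B * (2 / c))) by ring. nra. }
  exists (B * (2 / c) + B), L. split; [exact HL|]. split; [|split].
  - intros X x y. unfold slope, Rdiv. rewrite Rabs_mult.
    assert (H1 := H vy X 0%nat 0%nat _ _ (or_intror eq_refl) ltac:(lia) (ret_tube x y)).
    assert (H2 := proj2 (Hinv _ (speed_abs _ (clamped_speed X x y)))).
    apply Rle_trans with (B * (2 / c)); [|lra].
    apply Rmult_le_compat; try apply Rabs_pos; assumption.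
  - intros X x y.
    assert (H1 := H vx X 0%nat 0%nat _ _ (or_introl eq_refl) ltac:(lia) (ret_tube x y)).
    change (Rabs (clamped vx X x y) <= B) in H1. lra.
  - intros X x y z.
    apply Rle_trans with (L * Rabs (ret_y x y - ret_y x z)).
    2:{ apply Rmult_le_compat_l; [lra|]. unfold ret_y.
        match goal with |- Rabs (?g + ?u - (?g + ?v)) <= _ =>
          replace (g + u - (g + v)) with (u - v) by ring end.
        eapply Rle_trans; [apply clamp_lipschitz; lra|]. right. f_equal. ring. }
    set (Z := proj1_sig X). set (t := clamp al be x).
    change (Rabs (vy Z t (ret_y x y) / vx Z t (ret_y x y) - vy Z t (ret_y x z) / vx Z t (ret_y x z))
            <= L * Rabs (ret_y x y - ret_y x z)).
    assert (T1 := ret_tube x y). assert (T2 := ret_tube x z). fold t in T1, T2.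
    set (u := ret_y x y) in *. set (v := ret_y x z) in *.
    assert (Hseg : forall w, Rmin v u <= w <= Rmax v u -> tube (t, w)).
    { intros w Hw. destruct T1 as [T1 T1']. destruct T2 as [_ T2]. simpl in *.
      split; [exact T1|]. simpl. apply Rabs_le_between in T1'. apply Rabs_le_between in T2.
      apply Rabs_le. revert Hw. unfold Rmin, Rmax. destruct Rle_dec; lra. }
    set (df := fun w => (Derive (fun w => vy Z t w) w * vx Z t w - vy Z t w * Derive (fun w => vx Z t w) w)
                         / (vx Z t w) ^ 2).
    assert (Hder : forall w, Rmin v u <= w <= Rmax v u ->
              is_derive (fun w => vy Z t w / vx Z t w) w (df w)).
    { intros w Hw. assert (HM := tube_M _ (Hseg w Hw)).
      destruct (proj1 (proj2_sig X) t w HM) as [E1 E2]. fold Z in E1, E2.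
      apply (ex_diff_n_ex_deriv_inf_2 r 0 0) in E1; [|lia].
      apply (ex_diff_n_ex_deriv_inf_2 r 0 0) in E2; [|lia].
      change (ex_derive (fun w => vx Z t w) w) in E1. change (ex_derive (fun w => vy Z t w) w) in E2.
      assert (Hnz := proj1 (Hinv _ (speed_abs _ (good_speed X t w (Hseg w Hw))))). fold Z in Hnz.
      apply (is_derive_div (fun w => vy Z t w) (fun w => vx Z t w)).
      - apply Derive_correct, E2.
      - apply Derive_correct, E1.
      - exact Hnz. }
    destruct (MVT_gen (fun w => vy Z t w / vx Z t w) v u df) as [w [Hw Heq]].
    + intros w Hw. apply Hder. lra.
    + intros w Hw. eapply is_derive_continuity_pt, Hder, Hw.
    + rewrite Heq, Rabs_mult. apply Rmult_le_compat_r; [apply Rabs_pos|].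
      assert (Tw := Hseg w Hw).
      assert (b1 := H vx X 0%nat 0%nat t w (or_introl eq_refl) ltac:(lia) Tw).
      assert (b2 := H vy X 0%nat 0%nat t w (or_intror eq_refl) ltac:(lia) Tw).
      assert (b3 := H vx X 0%nat 1%nat t w (or_introl eq_refl) ltac:(lia) Tw).
      assert (b4 := H vy X 0%nat 1%nat t w (or_intror eq_refl) ltac:(lia) Tw).
      destruct (Hinv _ (speed_abs _ (good_speed X t w Tw))) as [b5 b6]. fold Z in b1, b2, b3, b4, b5, b6.
      change (Rabs (vx Z t w) <= B) in b1. change (Rabs (vy Z t w) <= B) in b2.
      change (Rabs (Derive (fun w => vx Z t w) w) <= B) in b3.
      change (Rabs (Derive (fun w => vy Z t w) w) <= B) in b4.
      unfold df.
      set (p := vx Z t w) in *. set (q := vy Z t w) in *.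
      set (p' := Derive (fun w => vx Z t w) w) in *. set (q' := Derive (fun w => vy Z t w) w) in *.
      replace ((q' * p - q * p') / p ^ 2) with ((q' * p - q * p') * / p * / p) by (field; exact b5).
      rewrite !Rabs_mult.
      assert (b7 : Rabs (q' * p - q * p') <= 2 * B * B).
      { eapply Rle_trans; [apply Rabs_triang|]. rewrite Rabs_Ropp, !Rabs_mult.
        assert (Rabs q' * Rabs p <= B * B) by (apply Rmult_le_compat; try apply Rabs_pos; assumption).
        assert (Rabs q * Rabs p' <= B * B) by (apply Rmult_le_compat; try apply Rabs_pos; assumption).
        lra. }
      unfold L. apply Rle_trans with (2 * B * B * (2 / c) * (2 / c)); [|lra].
      apply Rmult_le_compat; try apply Rabs_pos; [|apply Rmult_le_compat; try apply Rabs_pos|];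
        try assumption.
      apply Rmult_le_pos; apply Rabs_pos.
Qed.

(** The open tube, on which the retraction is the identity and the clamped components coincide with
    those of the field. *)
Definition inner (x y : R) : Prop := al < x < be /\ Rabs (y - gam x) < d.

Lemma inner_tube x y : inner x y -> tube (x, y).
Proof. intros [H1 H2]. split; simpl; lra. Qed.

Lemma inner_open : open2 inner.
Proof.
  intros x y [H1 H2].
  assert (H3 : 0 < (d - Rabs (y - gam x)) / 2) by lra.
  destruct (proj1 (continuous_R _ _) (gam_cont x) _ H3) as [d1 Hd1].
  assert (Hm : 0 < Rmin d1 (Rmin (Rmin (x - al) (be - x)) ((d - Rabs (y - gam x)) / 2))).
  { repeat apply Rmin_glb_lt; try apply cond_pos; lra. }
  exists (mkposreal _ Hm). simpl. intros u v Hu Hv.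
  set (m := Rmin d1 (Rmin (Rmin (x - al) (be - x)) ((d - Rabs (y - gam x)) / 2))) in *.
  assert (m <= d1) by apply Rmin_l.
  assert (m <= Rmin (Rmin (x - al) (be - x)) ((d - Rabs (y - gam x)) / 2)) by apply Rmin_r.
  assert (m <= Rmin (x - al) (be - x)) by (eapply Rle_trans; [exact H0 | apply Rmin_l]).
  assert (m <= (d - Rabs (y - gam x)) / 2) by (eapply Rle_trans; [exact H0 | apply Rmin_r]).
  pose proof (Rmin_l (x - al) (be - x)). pose proof (Rmin_r (x - al) (be - x)).
  split.
  - apply Rabs_def2 in Hu. lra.
  - assert (A := Hd1 u ltac:(change (Rabs (u - x) < d1); lra)).
    replace (v - gam u) with ((v - y) + (y - gam x) + - (gam u - gam x)) by ring.
    eapply Rle_lt_trans; [apply Rabs_triang|]. rewrite Rabs_Ropp.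
    eapply Rle_lt_trans; [apply Rplus_le_compat_r, Rabs_triang|]. lra.
Qed.

Lemma inner_convex x y1 y2 t :
  inner x y1 -> inner x y2 -> 0 <= t <= 1 -> inner x ((1 - t) * y1 + t * y2).
Proof.
  intros [H1 H2] [_ H3] Ht. split; [exact H1|].
  replace ((1 - t) * y1 + t * y2 - gam x) with ((1 - t) * (y1 - gam x) + t * (y2 - gam x)) by ring.
  assert (Hm : Rmax (Rabs (y1 - gam x)) (Rabs (y2 - gam x)) < d) by (apply Rmax_lub_lt; assumption).
  pose proof (Rmax_l (Rabs (y1 - gam x)) (Rabs (y2 - gam x))).
  pose proof (Rmax_r (Rabs (y1 - gam x)) (Rabs (y2 - gam x))).
  set (w := Rmax (Rabs (y1 - gam x)) (Rabs (y2 - gam x))) in *.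
  eapply Rle_lt_trans; [apply Rabs_triang|]. rewrite !Rabs_mult.
  rewrite (Rabs_right (1 - t)), (Rabs_right t) by lra. nra.
Qed.

Lemma Ck_vfield f : (f = vx \/ f = vy) ->
  Ck inner r (fun X : goods => f (proj1_sig X)) /\ Ck inner r (clamped f).
Proof.
  intros Hf.
  assert (H : Ck inner r (fun X : goods => f (proj1_sig X))).
  { apply ex_diff_n_Ck; [exact inner_open| |].
    - intros X s a Hsa.
      destruct (proj1 (proj2_sig X) s a (tube_M _ (inner_tube _ _ Hsa))).
      destruct Hf; subst f; assumption.
    - intros i j Hij X s a Hsa.
      apply continuous_ext_loc with (fun q : goods * (R * R) =>
        clamped (fun Z => partial_derive i j (f Z)) (fst q) (fst (snd q)) (snd (snd q))).
      + destruct (inner_open s a Hsa) as [e He]. exists e. intros [Y [u v]] [_ [Hu Hv]]. simpl.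
        unfold clamped. destruct (ret_id u v (inner_tube _ _ (He u v Hu Hv))) as [E1 E2].
        rewrite E1, E2. reflexivity.
      + apply (clamped_partial_continuous f i j X s a Hf Hij). }
  split; [exact H|]. apply Ck_ext with (fun X : goods => f (proj1_sig X)); [exact inner_open| |exact H].
  intros X s a Hsa. unfold clamped. destruct (ret_id s a (inner_tube _ _ Hsa)) as [E1 E2].
  rewrite E1, E2. reflexivity.
Qed.

Lemma Ck_slope : Ck inner r slope.
Proof.
  apply (Ck_mult inner r (clamped vy) (fun X x y => / clamped vx X x y)).
  - apply Ck_vfield. auto.
  - apply Ck_inv; [intros; apply clamped_nonzero|]. apply Ck_vfield. auto.
Qed.

End ClampedField.

(** * The orbit of X0 as a graph *)

Lemma clamp_mono a b x y : a <= b -> x <= y -> 0 <= clamp a b y - clamp a b x <= y - x.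
Proof.
  intros H Hxy. unfold clamp, Rmax, Rmin.
  destruct (Rle_dec b x), (Rle_dec b y); repeat destruct Rle_dec; lra.
Qed.

(** On the compact arc the horizontal speed has a fixed sign and a positive minimum, so the abscissa
    is an expanding function of time and can be inverted. The tube lemma then yields a tube of
    uniform width on which half of that minimum persists. *)
Lemma orbit_graph (r : nat) (M V : R * R -> Prop) (X0 : vfield)
    (delta T0 sigma s x0 y0 : R) (hr : (1 <= r)%nat) (hX0 : Cr_vfield M r X0)
    (hM : open M)
    (hdelta : delta = sign (vx X0 0 0)) (hVO : V (0, 0)) (hVM : forall p, V p -> M p)
    (hVX0 : forall x y : R, V (x, y) -> vx X0 x y <> 0)
    (hA : condition_A M V X0 T0 sigma s (x0, y0)) :
  (delta = 1 \/ delta = -1) /\ 0 < sigma * delta * x0 /\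
  exists (gam : R -> R) (al be d c : R) (g : R -> R * R),
    (forall s, continuous gam s) /\ 0 < d /\ 0 < c /\ al < Rmin 0 x0 /\ Rmax 0 x0 < be /\
    (forall p, tube gam al be d p -> M p) /\
    (forall x y, tube gam al be d (x, y) -> c <= delta * vx X0 x y) /\
    g 0 = (0, 0) /\ g (sigma * T0) = (x0, y0) /\
    (forall x, Rmin 0 x0 <= x <= Rmax 0 x0 ->
       exists u, 0 <= u <= T0 /\ (x, gam x) = g (sigma * u)) /\
    (forall u, 0 <= u <= T0 ->
       is_derive (fun v => fst (g v)) (sigma * u) (vx X0 (fst (g (sigma * u))) (snd (g (sigma * u)))) /\
       is_derive (fun v => snd (g v)) (sigma * u) (vy X0 (fst (g (sigma * u))) (snd (g (sigma * u)))) /\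
       gam (fst (g (sigma * u))) = snd (g (sigma * u)) /\
       Rmin 0 x0 <= fst (g (sigma * u)) <= Rmax 0 x0).
Proof.
  destruct hA as [HT0 [Hsigma [Hs [[g [Hg0 [HgT Hg]]] HV]]]].
  assert (Hdelta : delta = 1 \/ delta = -1).
  { assert (H := hVX0 0 0 hVO). rewrite hdelta. destruct (Rtotal_order (vx X0 0 0) 0) as [H1|[H1|H1]].
    - right. apply sign_eq_m1, H1.
    - contradiction.
    - left. apply sign_eq_1, H1. }
  assert (Hrange : forall u, 0 <= u <= T0 ->
            Rmin 0 (sigma * T0) <= sigma * u <= Rmax 0 (sigma * T0)).
  { intros u Hu. unfold Rmin, Rmax. destruct Rle_dec; destruct Hsigma; subst sigma; nra. }
  (* Condition (A) speaks of all flow witnesses; the restriction of g to a shorter time is one of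
     them. *)
  assert (HVg : forall u, 0 <= u <= T0 -> V (g (sigma * u))).
  { intros u Hu. apply (HV u); [exact Hu|]. exists g. split; [exact Hg0|]. split; [reflexivity|].
    intros v Hv. apply Hg. revert Hv. unfold Rmin, Rmax.
    destruct (Rle_dec 0 (sigma * u)), (Rle_dec 0 (sigma * T0)); destruct Hsigma; subst sigma; nra. }
  assert (HVg' : forall u, 0 <= u <= T0 -> V (fst (g (sigma * u)), snd (g (sigma * u)))).
  { intros u Hu. specialize (HVg u Hu). destruct (g (sigma * u)). exact HVg. }
  set (p := fun u => delta * vx X0 (fst (g (sigma * u))) (snd (g (sigma * u)))).
  assert (Hgc : forall u, 0 <= u <= T0 ->
    continuous (fun t => fst (g (sigma * t))) u /\ continuous (fun t => snd (g (sigma * t))) u).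
  { intros u Hu. destruct (Hg _ (Hrange u Hu)) as [_ [H1 H2]].
    assert (Hl : continuous (fun t => sigma * t) u).
    { eapply is_derive_continuous, is_derive_linear. }
    split.
    - apply (continuous_comp (fun t => sigma * t) (fun v => fst (g v))); [exact Hl|].
      eapply is_derive_continuous, H1.
    - apply (continuous_comp (fun t => sigma * t) (fun v => snd (g v))); [exact Hl|].
      eapply is_derive_continuous, H2. }
  assert (Hpc : forall u, 0 <= u <= T0 -> continuous p u).
  { intros u Hu. destruct (Hgc u Hu) as [H1 H2].
    apply (continuous_mult (fun _ : R => delta)); [apply continuous_const|].
    apply (continuous_comp_2 (fun t => fst (g (sigma * t))) (fun t => snd (g (sigma * t))) (vx X0));
      [exact H1 | exact H2|].
    apply continuity_2d_pt_filterlim.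
    apply (vfield_partial_continuous vx M r X0 0 0); [auto|exact hX0| |lia].
    apply hVM, HVg', Hu. }
  set (cl := clamp 0 T0).
  assert (Hcl : forall t, 0 <= cl t <= T0) by (intros; apply clamp_in; lra).
  assert (Hclc : forall t, continuous cl t) by (intros; apply clamp_continuous; lra).
  assert (Hpcl : forall t, continuous (fun t => p (cl t)) t).
  { intros t. apply (continuous_comp cl p); [apply Hclc | apply Hpc, Hcl]. }
  assert (Hpos : forall u, 0 <= u <= T0 -> 0 < p u).
  { intros u Hu. destruct (Rlt_le_dec 0 (p u)) as [|Hle]; [assumption|]. exfalso.
    assert (Hp0 : 0 < p 0).
    { unfold p. rewrite Rmult_0_r, Hg0. simpl. assert (H := hVX0 0 0 hVO).
      destruct (Rtotal_order (vx X0 0 0) 0) as [H1|[H1|H1]].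
      - rewrite hdelta, sign_eq_m1; lra.
      - contradiction.
      - rewrite hdelta, sign_eq_1; lra. }
    destruct (IVT_gen (fun t => p (cl t)) 0 u 0) as [z [_ Hz]].
    - intros t. apply continuity_pt_filterlim, Hpcl.
    - unfold cl. rewrite !clamp_id by lra. unfold Rmin, Rmax. destruct Rle_dec; lra.
    - unfold p in Hz. apply (hVX0 (fst (g (sigma * cl z))) (snd (g (sigma * cl z)))).
      + apply HVg', Hcl.
      + destruct Hdelta as [E|E]; rewrite E in Hz; lra. }
  destruct (continuity_ab_min p 0 T0) as [mx [Hmin Hmx]]; [lra| |].
  { intros u Hu. apply continuity_pt_filterlim, Hpc, Hu. }
  set (c1 := p mx) in *. assert (Hc1 : 0 < c1) by (apply Hpos; lra).
  set (om := sigma * delta).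
  assert (Hom : om = 1 \/ om = -1).
  { unfold om. destruct Hsigma, Hdelta; subst sigma; [left|right|right|left]; lra. }
  assert (Homom : om * om = 1) by (destruct Hom as [E|E]; rewrite E; ring).
  (* The abscissa along the arc, oriented by [om] so as to increase, and continued with slope c1
     outside [0, T0]: it becomes an expanding bijection of the line. *)
  set (f := fun t => om * fst (g (sigma * cl t)) + c1 * (t - cl t)).
  assert (Hfexp : forall x y, x <= y -> c1 * (y - x) <= f y - f x).
  { intros x y Hxy. unfold f.
    assert (Hm := clamp_mono 0 T0 x y ltac:(lra) Hxy). fold cl in Hm.
    destruct (MVT_gen (fun t => om * fst (g (sigma * t))) (cl x) (cl y) p) as [z [Hz Heq]].
    - intros z Hz. rewrite Rmin_left, Rmax_right in Hz by lra.
      assert (Hz' : 0 <= z <= T0) by (pose proof (Hcl x); pose proof (Hcl y); lra).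
      destruct (Hg _ (Hrange z Hz')) as [_ [H1 _]].
      assert (Hd := is_derive_comp (fun v => fst (g v)) (fun t => sigma * t) z _ _ H1
               (is_derive_scal (fun t => t) z sigma 1 (is_derive_id z))).
      apply (is_derive_scal _ z om) in Hd.
      replace (p z) with (om * (sigma * 1 * vx X0 (fst (g (sigma * z))) (snd (g (sigma * z)))));
        [exact Hd|].
      unfold p, om. destruct Hsigma; subst sigma; ring.
    - intros z Hz. rewrite Rmin_left, Rmax_right in Hz by lra.
      assert (Hz' : 0 <= z <= T0) by (pose proof (Hcl x); pose proof (Hcl y); lra).
      apply continuity_pt_filterlim.
      apply (continuous_mult (fun _ : R => om)); [apply continuous_const | apply Hgc, Hz'].
    - rewrite Rmin_left, Rmax_right in Hz by lra.
      assert (Hz' : 0 <= z <= T0) by (pose proof (Hcl x); pose proof (Hcl y); lra).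
      assert (H := Hmin z Hz'). fold c1 in H.
      assert (c1 * (cl y - cl x) <= p z * (cl y - cl x)) by (apply Rmult_le_compat_r; lra).
      lra. }
  assert (Hfc : continuity f).
  { intros t. apply continuity_pt_filterlim.
    apply (continuous_plus (fun t => om * fst (g (sigma * cl t)))).
    - apply (continuous_mult (fun _ : R => om)); [apply continuous_const|].
      apply (continuous_comp cl (fun t => fst (g (sigma * t)))); [apply Hclc | apply Hgc, Hcl].
    - apply (continuous_mult (fun _ : R => c1)); [apply continuous_const|].
      apply (continuous_minus (fun t : R => t)); [apply continuous_id | apply Hclc]. }
  destruct (expanding_inverse f c1 Hc1 Hfc Hfexp) as [h [Hhf [Hfh Hhc]]].
  (* The clamp continues [gam] by constants beyond both ends of the arc. *)
  set (gam := fun x => snd (g (sigma * cl (h (om * x))))).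
  assert (Hgam : forall x, continuous gam x).
  { intros x. apply (continuous_comp (fun x => cl (h (om * x))) (fun t => snd (g (sigma * t))));
      [|apply Hgc, Hcl].
    apply (continuous_comp (fun x => h (om * x)) cl); [|apply Hclc].
    apply (continuous_comp (fun x => om * x) h); [|apply Hhc].
    eapply is_derive_continuous, is_derive_linear. }
  assert (Hcl_id : forall t, 0 <= t <= T0 -> cl t = t) by (intros; apply clamp_id; lra).
  assert (Hf_in : forall t, 0 <= t <= T0 -> f t = om * fst (g (sigma * t))).
  { intros t Ht. unfold f. rewrite Hcl_id by exact Ht. ring. }
  assert (Hf0 : f 0 = 0).
  { rewrite Hf_in by lra. rewrite Rmult_0_r, Hg0. simpl. ring. }
  assert (HfT : f T0 = om * x0).
  { rewrite Hf_in by lra. rewrite HgT. reflexivity. }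
  assert (Hx0 : 0 < om * x0).
  { assert (H := Hfexp 0 T0 ltac:(lra)). rewrite Hf0, HfT in H. nra. }
  assert (Hgraph : forall u, 0 <= u <= T0 -> gam (fst (g (sigma * u))) = snd (g (sigma * u))).
  { intros u Hu. unfold gam. rewrite <- Hf_in by exact Hu. rewrite Hhf, Hcl_id by exact Hu.
    reflexivity. }
  assert (Hbetween : forall u, 0 <= u <= T0 ->
            Rmin 0 x0 <= fst (g (sigma * u)) <= Rmax 0 x0).
  { intros u Hu. assert (H1 := Hfexp 0 u ltac:(lra)). assert (H2 := Hfexp u T0 ltac:(lra)).
    rewrite Hf0, Hf_in in H1 by exact Hu. rewrite HfT, Hf_in in H2 by exact Hu.
    assert (0 <= om * fst (g (sigma * u)) <= om * x0) by nra.
    unfold Rmin, Rmax. destruct Hom as [E|E]; rewrite E in *; destruct Rle_dec; lra. }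
  assert (Hon : forall x, Rmin 0 x0 <= x <= Rmax 0 x0 -> exists u, 0 <= u <= T0 /\ (x, gam x) = g (sigma * u)).
  { intros x Hx. set (u := h (om * x)).
    assert (Hfu : f u = om * x) by apply Hfh.
    assert (Hox : 0 <= om * x <= om * x0).
    { revert Hx. unfold Rmin, Rmax. destruct Hom as [E|E]; rewrite E in *; destruct Rle_dec; lra. }
    assert (Hu : 0 <= u <= T0).
    { split.
      - destruct (Rle_lt_dec 0 u); [assumption|]. assert (H := Hfexp u 0 ltac:(lra)). nra.
      - destruct (Rle_lt_dec u T0); [assumption|]. assert (H := Hfexp T0 u ltac:(lra)). nra. }
    exists u. split; [exact Hu|]. rewrite (surjective_pairing (g (sigma * u))). f_equal.
    - rewrite Hf_in in Hfu by exact Hu.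
      assert (om * om * fst (g (sigma * u)) = om * om * x) by (rewrite !Rmult_assoc, Hfu; reflexivity).
      rewrite Homom in H. lra.
    - unfold gam. fold u. rewrite Hcl_id by exact Hu. reflexivity. }
  split; [exact Hdelta|]. split; [exact Hx0|].
  set (Q := fun x y => M (x, y) /\ c1 / 2 <= delta * vx X0 x y).
  assert (HQ : forall x, Rmin 0 x0 <= x <= Rmax 0 x0 -> locally_2d Q x (gam x)).
  { intros x Hx. destruct (Hon x Hx) as [u [Hu Heq]].
    assert (HM : M (x, gam x)) by (rewrite Heq; apply hVM, HVg, Hu).
    assert (Hv : c1 <= delta * vx X0 x (gam x)).
    { assert (H := Hmin u Hu). unfold p in H. rewrite <- Heq in H. exact H. }
    apply locally_2d_and.
    - apply locally_2d_locally. generalize (hM _ HM). apply filter_imp.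
      intros [a b] H. exact H.
    - assert (Hcv := vfield_partial_continuous vx M r X0 0 0 x (gam x) (or_introl eq_refl) hX0 HM
               ltac:(lia) (mkposreal (c1 / 2) ltac:(lra))).
      revert Hcv. apply locally_2d_impl, locally_2d_forall. intros a b Hcv.
      change (Rabs (vx X0 a b - vx X0 x (gam x)) < c1 / 2) in Hcv. apply Rabs_def2 in Hcv.
      destruct Hdelta as [E|E]; rewrite E in *; lra. }
  (* The parameter of the tube lemma is the margin itself: |eta| bounds both the horizontal
     overshoot and the half-width. *)
  assert (Htube : locally 0 (fun eta => forall x, Rmin 0 x0 <= x <= Rmax 0 x0 ->
     forall x' y', Rabs (x' - x) <= Rabs eta -> Rabs (y' - gam x') <= Rabs eta -> Q x' y')).
  { apply (tube_lemma (fun eta x => forall x' y', Rabs (x' - x) <= Rabs eta ->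
       Rabs (y' - gam x') <= Rabs eta -> Q x' y')).
    intros x Hx. destruct (HQ x Hx) as [e He]. assert (He0 := cond_pos e).
    destruct (proj1 (continuous_R _ _) (Hgam x) (e / 2) ltac:(lra)) as [e2 He2].
    assert (He20 := cond_pos e2).
    assert (Hm : 0 < Rmin (e / 2) (e2 / 2)) by (apply Rmin_glb_lt; lra).
    exists (mkposreal _ Hm). intros [eta z] [Heta Hz] x' y' Hx' Hy'. simpl in *.
    change (Rabs (eta - 0) < Rmin (e / 2) (e2 / 2)) in Heta. rewrite Rminus_0_r in Heta.
    change (Rabs (z - x) < Rmin (e / 2) (e2 / 2)) in Hz.
    pose proof (Rmin_l (e / 2) (e2 / 2)). pose proof (Rmin_r (e / 2) (e2 / 2)).
    assert (Hxx : Rabs (x' - x) <= Rabs (x' - z) + Rabs (z - x)).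
    { replace (x' - x) with ((x' - z) + (z - x)) by ring. apply Rabs_triang. }
    apply He; [lra|].
    assert (A := He2 x' ltac:(change (Rabs (x' - x) < e2); lra)).
    replace (y' - gam x) with ((y' - gam x') + (gam x' - gam x)) by ring.
    eapply Rle_lt_trans; [apply Rabs_triang|]. lra. }
  destruct Htube as [e He]. assert (He0 := cond_pos e).
  assert (Hball : ball 0 e (e / 2)).
  { change (Rabs (e / 2 - 0) < e). rewrite Rminus_0_r, Rabs_right; lra. }
  assert (HQtube : forall x y, tube gam (Rmin 0 x0 - e / 2) (Rmax 0 x0 + e / 2) (e / 2) (x, y) -> Q x y).
  { intros x y [Hx Hy]. simpl in *.
    assert (Hmm : Rmin 0 x0 <= Rmax 0 x0) by (unfold Rmin, Rmax; destruct Rle_dec; lra).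
    apply (He (e / 2) Hball (clamp (Rmin 0 x0) (Rmax 0 x0) x)).
    - apply clamp_in, Hmm.
    - rewrite (Rabs_right (e / 2)) by lra. unfold clamp. apply Rabs_le.
      generalize (Rmin 0 x0) (Rmax 0 x0) Hx Hmm. intros a b Hx' Hab.
      unfold Rmax, Rmin. repeat destruct Rle_dec; lra.
    - rewrite (Rabs_right (e / 2)) by lra. exact Hy. }
  exists gam, (Rmin 0 x0 - e / 2), (Rmax 0 x0 + e / 2), (e / 2), (c1 / 2), g.
  split; [exact Hgam|]. split; [lra|]. split; [lra|]. split; [lra|]. split; [lra|].
  split; [intros [x y] H; apply HQtube, H|].
  split; [intros x y H; apply HQtube, H|].
  split; [exact Hg0|]. split; [exact HgT|]. split; [exact Hon|].
  intros u Hu. destruct (Hg _ (Hrange u Hu)) as [_ [H1 H2]]. auto.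
Qed.

(** * From graphs of solutions to the flow *)

Section GraphFlow.
Context {T : UniformSpace}.
Variables (val : T -> vfield) (P S Y : T -> R -> R -> R) (M : R * R -> Prop)
  (W : R -> R -> Prop) (c B L dl : R).
Hypothesis HW : open2 W.
Hypothesis WM : forall x y, W x y -> M (x, y).
Hypothesis P_val : forall X x y, W x y -> P X x y = vx (val X) x y.
Hypothesis S_val : forall X x y, W x y -> S X x y = vy (val X) x y / vx (val X) x y.
Hypothesis P_cont : forall X x y, cont3 P X x y.
Hypothesis Hc : 0 < c.
Hypothesis Hdl : dl = 1 \/ dl = -1.
Hypothesis P_speed : forall X x y, c <= dl * P X x y.
Hypothesis P_bound : forall X x y, Rabs (P X x y) <= B.
Hypothesis HL : 1 <= L.
Hypothesis S_lip : forall X x y z, Rabs (S X x y - S X x z) <= L * Rabs (y - z).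
Hypothesis Y_start : forall X a, Y X a a = 0.
Hypothesis Y_ode : forall X s a, is_derive (fun s => Y X s a) s (S X s (Y X s a)).
Hypothesis Y_cont : forall X s a, cont3 Y X s a.

Lemma P_nonzero X x y : P X x y <> 0.
Proof. intros H. assert (H1 := P_speed X x y). rewrite H in H1. lra. Qed.

Lemma B_nonneg (X : T) : 0 <= B.
Proof. eapply Rle_trans; [apply Rabs_pos | apply (P_bound X 0 0)]. Qed.

Definition inverse_speed : T -> R -> R -> R := fun X s a => / P X s (Y X s a).

(** Along the graph dt = dx / P, so this is the signed time needed to go from abscissa a to abscissa
    s. *)
Definition travel_time : T -> R -> R -> R := path_integral inverse_speed.

Lemma inverse_speed_C0 : Ck (fun _ _ => True) 0 inverse_speed.
Proof.
  apply (Ck_inv _ 0 (fun X s a => P X s (Y X s a))); [intros; apply P_nonzero|].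
  apply (Ck_comp _ (fun _ _ => True) 0 P (fun _ s _ => s) Y); auto using open2_True, Ck_fst.
  - split; auto.
  - split; auto.
Qed.

Lemma travel_time_continuous X s a : cont3 travel_time X s a.
Proof.
  exact (path_integral_cont (fun _ _ => True) open2_True (fun _ _ _ _ _ => I)
    inverse_speed 0 X s a inverse_speed_C0 I).
Qed.

Lemma travel_time_derive X s a :
  is_derive (fun s => travel_time X s a) s (/ P X s (Y X s a)).
Proof.
  exact (path_integral_derive_1 (fun _ _ => True) open2_True (fun _ _ _ _ _ => I)
    inverse_speed 0 X s a inverse_speed_C0 I).
Qed.

Lemma travel_time_start X a : travel_time X a a = 0.
Proof. apply (RInt_point a (fun z => inverse_speed X z a)). Qed.

Lemma inverse_speed_lower X x y : / (B + 1) <= dl * / P X x y.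
Proof.
  assert (H := P_speed X x y). assert (H1 := P_bound X x y). assert (H2 := B_nonneg X).
  apply Rabs_le_between in H1.
  assert (H3 := P_nonzero X x y).
  destruct Hdl as [E|E]; rewrite E in H |- *.
  - rewrite Rmult_1_l. apply Rinv_le_contravar; lra.
  - replace (-1 * / P X x y) with (/ (- P X x y)) by (field; exact H3).
    apply Rinv_le_contravar; lra.
Qed.

Lemma travel_time_expands X a s t : s <= t ->
  / (B + 1) * (t - s) <= dl * travel_time X t a - dl * travel_time X s a.
Proof.
  intros Hst.
  destruct (MVT_gen (fun s => dl * travel_time X s a) s t (fun z => dl * / P X z (Y X z a)))
    as [z [_ Hz]].
  - intros z _. apply (is_derive_scal (fun s => travel_time X s a)), travel_time_derive.
  - intros z _. eapply is_derive_continuity_pt.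
    apply (is_derive_scal (fun s => travel_time X s a)), travel_time_derive.
  - rewrite Hz. apply Rmult_le_compat_r; [lra | apply inverse_speed_lower].
Qed.

(* In W the system is P (1, S): the distance to the graph obeys a Gronwall inequality,
   and the derivative of the travel time along the path is P / P. *)
Lemma path_on_graph X a sg (xi et : R -> R) (u : R) :
  sg = 1 \/ sg = -1 -> 0 <= u -> xi 0 = a -> et 0 = 0 ->
  (forall v, 0 <= v <= u ->
     is_derive xi v (sg * vx (val X) (xi v) (et v)) /\
     is_derive et v (sg * vy (val X) (xi v) (et v))) ->
  (forall v, 0 <= v < u -> W (xi v) (et v)) ->
  Y X (xi u) a = et u /\ travel_time X (xi u) a = sg * u.
Proof.
  intros Hsg Hu Hxi0 Het0 Hder HWv.
  assert (HB := B_nonneg X).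
  assert (Hgraph : forall v, 0 <= v <= u -> Y X (xi v) a = et v).
  { intros v Hv. apply Rminus_diag_uniq.
    apply (gronwall_zero (fun v => Y X (xi v) a - et v)
      (fun v => sg * vx (val X) (xi v) (et v) * S X (xi v) (Y X (xi v) a)
                - sg * vy (val X) (xi v) (et v)) (B * L) 0 v).
    - apply Rmult_le_pos; lra.
    - intros w Hw. rewrite Rmin_left, Rmax_right in Hw by lra.
      destruct (Hder w ltac:(lra)) as [H1 H2].
      split.
      + apply (is_derive_minus (fun v => Y X (xi v) a) et); [|exact H2].
        apply (is_derive_comp (fun s => Y X s a) xi); [apply Y_ode | exact H1].
      + assert (HWp := HWv w ltac:(lra)).
        assert (Hp := P_val X _ _ HWp). assert (Hn := P_nonzero X (xi w) (et w)).
        rewrite Hp in Hn. assert (Hs := S_val X _ _ HWp).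
        assert (Hpb := P_bound X (xi w) (et w)). rewrite Hp in Hpb.
        replace (sg * vx (val X) (xi w) (et w) * S X (xi w) (Y X (xi w) a)
                - sg * vy (val X) (xi w) (et w)) with
          (sg * (vx (val X) (xi w) (et w) * (S X (xi w) (Y X (xi w) a) - S X (xi w) (et w))))
          by (rewrite Hs; field; exact Hn).
        rewrite !Rabs_mult. replace (Rabs sg) with 1.
        2:{ destruct Hsg as [E|E]; rewrite E; [rewrite Rabs_R1|rewrite Rabs_left]; lra. }
        rewrite Rmult_1_l, Rmult_assoc.
        apply Rmult_le_compat; try apply Rabs_pos; [exact Hpb | apply S_lip].
    - intros w Hw. rewrite Rmin_left, Rmax_right in Hw by lra.
      destruct (Hder w ltac:(lra)) as [H1 H2].
      eapply is_derive_continuity_pt. apply (is_derive_minus (fun v => Y X (xi v) a) et); [|exact H2].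
      apply (is_derive_comp (fun s => Y X s a) xi); [apply Y_ode | exact H1].
    - rewrite Hxi0, Het0, Y_start. ring. }
  split; [apply Hgraph; lra|].
  apply Rminus_diag_uniq.
  assert (Hd : forall v, 0 <= v <= u -> is_derive (fun v => travel_time X (xi v) a - sg * v) v
            (sg * vx (val X) (xi v) (et v) * / P X (xi v) (Y X (xi v) a) - sg)).
  { intros v Hv. destruct (Hder v Hv) as [H1 H2].
    apply (is_derive_minus (fun v => travel_time X (xi v) a) (fun v => sg * v)).
    - apply (is_derive_comp (fun s => travel_time X s a) xi); [apply travel_time_derive | exact H1].
    - apply is_derive_linear. }
  apply (gronwall_zero (fun v => travel_time X (xi v) a - sg * v)
    (fun v => sg * vx (val X) (xi v) (et v) * / P X (xi v) (Y X (xi v) a) - sg) 0 0 u).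
  + lra.
  + intros v Hv. rewrite Rmin_left, Rmax_right in Hv by lra. split; [apply Hd; lra|].
    assert (HWp := HWv v ltac:(lra)). rewrite Hgraph, P_val by (exact HWp || lra). assert (Hn := P_nonzero X (xi v) (et v)).
    rewrite P_val in Hn by exact HWp.
    replace (sg * vx (val X) (xi v) (et v) * / vx (val X) (xi v) (et v) - sg) with 0
      by (field; exact Hn).
    rewrite Rabs_R0. lra.
  + intros v Hv. rewrite Rmin_left, Rmax_right in Hv by lra.
    eapply is_derive_continuity_pt, Hd, Hv.
  + rewrite Hxi0, travel_time_start. ring.
Qed.

(** The graph is parametrised by the inverse of the travel time, whose derivative is P; the second
    component then moves at speed P S, the vertical speed. *)
Lemma flow_exists X a x0 :
  (forall s, Rmin a x0 <= s <= Rmax a x0 -> W s (Y X s a)) ->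
  flow M X.(val) (travel_time X x0 a) (a, 0) (x0, Y X x0 a).
Proof.
  intros HWs. assert (HB := B_nonneg X).
  assert (Hpos : 0 < / (B + 1)) by (apply Rinv_0_lt_compat; lra).
  assert (Hsq : forall t, dl * (dl * t) = t) by (intros; destruct Hdl as [E|E]; rewrite E; ring).
  destruct (expanding_inverse (fun s => dl * travel_time X s a) (/ (B + 1)) Hpos) as [h [Hh1 [Hh2 Hh3]]].
  { intros s. eapply is_derive_continuity_pt.
    apply (is_derive_scal (fun s => travel_time X s a)), travel_time_derive. }
  { intros s t Hst. apply travel_time_expands, Hst. }
  set (pos := fun t => h (dl * t)).
  assert (Hpos1 : forall s, pos (travel_time X s a) = s) by (intros; apply Hh1).
  assert (Hpos2 : forall t, travel_time X (pos t) a = t).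
  { intros t. assert (H := Hh2 (dl * t)). fold (pos t) in H.
    rewrite <- (Hsq (travel_time X (pos t) a)), H. apply Hsq. }
  assert (Hposc : forall t, continuous pos t).
  { intros t. apply (continuous_comp (fun t => dl * t) h); [|apply Hh3].
    eapply is_derive_continuous, is_derive_linear. }
  assert (Hposd : forall t, is_derive pos t (P X (pos t) (Y X (pos t) a))).
  { intros t. rewrite <- (Rinv_inv (P X (pos t) (Y X (pos t) a))).
    apply (is_derive_inverse (fun s => travel_time X s a)).
    - apply filter_forall. exact Hpos2.
    - apply Hposc.
    - apply travel_time_derive.
    - apply Rinv_neq_0_compat, P_nonzero. }
  exists (fun t => (pos t, Y X (pos t) a)).
  split; [rewrite <- (travel_time_start X a), Hpos1, Y_start, travel_time_start; reflexivity|].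
  split; [rewrite Hpos1; reflexivity|].
  intros t Ht.
  assert (Hin : Rmin a x0 <= pos t <= Rmax a x0).
  { assert (E1 := travel_time_start X a).
    assert (Hmono : forall s1 s2, s1 < s2 -> dl * travel_time X s1 a < dl * travel_time X s2 a).
    { intros s1 s2 H12. assert (H := travel_time_expands X a s1 s2 ltac:(lra)).
      assert (0 < / (B + 1) * (s2 - s1)) by (apply Rmult_lt_0_compat; lra). lra. }
    assert (Hlt : forall s1 s2, dl * travel_time X s1 a <= dl * travel_time X s2 a -> s1 <= s2).
    { intros s1 s2 H12. destruct (Rle_lt_dec s1 s2) as [|Hl]; [assumption|].
      assert (H := Hmono _ _ Hl). lra. }
    assert (Hside : (0 <= dl * t <= dl * travel_time X x0 a) \/ (dl * travel_time X x0 a <= dl * t <= 0)).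
    { revert Ht. unfold Rmin, Rmax. destruct Rle_dec; destruct Hdl as [E|E]; rewrite E; lra. }
    destruct Hside as [Hs|Hs].
    - assert (a <= pos t) by (apply Hlt; rewrite Hpos2, E1; lra).
      assert (pos t <= x0) by (apply Hlt; rewrite Hpos2; lra).
      rewrite Rmin_left, Rmax_right; lra.
    - assert (pos t <= a) by (apply Hlt; rewrite Hpos2, E1; lra).
      assert (x0 <= pos t) by (apply Hlt; rewrite Hpos2; lra).
      rewrite Rmin_right, Rmax_left; lra. }
  assert (HWt := HWs _ Hin). simpl. split; [apply WM, HWt|]. split.
  - rewrite <- P_val by exact HWt. apply Hposd.
  - replace (vy (val X) (pos t) (Y X (pos t) a)) with
      (P X (pos t) (Y X (pos t) a) * S X (pos t) (Y X (pos t) a)).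
    + apply (is_derive_comp (fun s => Y X s a) pos); [apply Y_ode | apply Hposd].
    + assert (Hn := P_nonzero X (pos t) (Y X (pos t) a)).
      rewrite S_val, P_val by exact HWt. rewrite P_val in Hn by exact HWt. field. exact Hn.
Qed.

(** Outside W nothing relates the orbit to the graph, so it must be shown that it never leaves W.
    While it has stayed in W it lies on the graph with travel time equal to elapsed time; the
    barrier xe takes longer than t to reach, so the abscissa stays between a and xe, the point is in
    W, and W is open. Real induction concludes. *)
Lemma flow_unique X a sg t xe q lo hi :
  sg = 1 \/ sg = -1 -> 0 < sg * t ->
  lo < a < hi -> lo < xe < hi ->
  (forall s, lo < s < hi -> W s (Y X s a)) ->
  sg * t < sg * travel_time X xe a ->
  flow M (val X) t (a, 0) q -> snd q = Y X (fst q) a.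
Proof.
  intros Hsg Ht Ha Hxe HWs Hxet [k [Hk0 [Hkt Hk]]].
  set (xi := fun v => fst (k (sg * v))). set (et := fun v => snd (k (sg * v))).
  set (u0 := sg * t) in *.
  assert (Hsq : forall v, sg * (sg * v) = v) by (intros; destruct Hsg as [E|E]; rewrite E; ring).
  assert (Hder : forall v, 0 <= v <= u0 ->
     is_derive xi v (sg * vx (val X) (xi v) (et v)) /\
     is_derive et v (sg * vy (val X) (xi v) (et v))).
  { intros v Hv.
    assert (Hr : Rmin 0 t <= sg * v <= Rmax 0 t).
    { revert Hv. unfold u0, Rmin, Rmax. destruct Rle_dec; destruct Hsg as [E|E]; rewrite E in *; lra. }
    destruct (Hk _ Hr) as [_ [H1 H2]].
    assert (Hl : is_derive (fun v => sg * v) v sg).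
    { apply is_derive_linear. }
    split.
    - apply (is_derive_comp (fun v => fst (k v)) (fun v => sg * v)); assumption.
    - apply (is_derive_comp (fun v => snd (k v)) (fun v => sg * v)); assumption. }
  assert (Hxi0 : xi 0 = a) by (unfold xi; rewrite Rmult_0_r, Hk0; reflexivity).
  assert (Het0 : et 0 = 0) by (unfold et; rewrite Rmult_0_r, Hk0; reflexivity).
  assert (HB := B_nonneg X).
  assert (Hpos : 0 < / (B + 1)) by (apply Rinv_0_lt_compat; lra).
  assert (Hlt : forall s1 s2, dl * travel_time X s1 a <= dl * travel_time X s2 a -> s1 <= s2).
  { intros s1 s2 H12. destruct (Rle_lt_dec s1 s2) as [|Hl]; [assumption|].
    assert (H := travel_time_expands X a s2 s1 ltac:(lra)).
    assert (0 < / (B + 1) * (s1 - s2)) by (apply Rmult_lt_0_compat; lra). lra. }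
  assert (HWv : forall v, 0 <= v <= u0 -> W (xi v) (et v)).
  { apply (real_induction (fun v => W (xi v) (et v))).
    intros u Hu IH.
    destruct (path_on_graph X a sg xi et u Hsg ltac:(lra) Hxi0 Het0) as [E1 E2].
    { intros v Hv. apply Hder. lra. }
    { exact IH. }
    assert (Hin : lo < xi u < hi).
    { assert (E0 := travel_time_start X a).
      assert (Hs : (0 <= dl * travel_time X (xi u) a <= dl * travel_time X xe a) \/
                   (dl * travel_time X xe a <= dl * travel_time X (xi u) a <= 0)).
      { rewrite E2. destruct Hsg as [E|E], Hdl as [E'|E']; rewrite E, E' in *; lra. }
      destruct Hs as [Hs|Hs].
      - assert (a <= xi u) by (apply Hlt; rewrite E0; lra).
        assert (xi u <= xe) by (apply Hlt; lra). lra.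
      - assert (xi u <= a) by (apply Hlt; rewrite E0; lra).
        assert (xe <= xi u) by (apply Hlt; lra). lra. }
    assert (HWu : W (xi u) (et u)) by (rewrite <- E1; apply HWs, Hin).
    destruct (HW _ _ HWu) as [e He]. destruct (Hder u Hu) as [H1 H2].
    assert (C1 : continuous xi u).
    { eapply is_derive_continuous, H1. }
    assert (C2 : continuous et u).
    { eapply is_derive_continuous, H2. }
    generalize (filter_and _ _ (proj1 (continuous_R _ _) C1 e (cond_pos e))
                               (proj1 (continuous_R _ _) C2 e (cond_pos e))).
    apply filter_imp. intros v [A1 A2] _. apply He; assumption. }
  destruct (path_on_graph X a sg xi et u0 Hsg ltac:(lra) Hxi0 Het0 Hder) as [E1 _].
  { intros v Hv. apply HWv. lra. }
  unfold xi, et, u0 in E1. rewrite Hsq, Hkt in E1. symmetry. exact E1.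
Qed.

End GraphFlow.

(** * The transition maps of all fields near X0 *)

Lemma Ck_pullback {T T' : UniformSpace} (phi : T' -> T) (D : R -> R -> Prop) (k : nat)
    (f : T -> R -> R -> R) :
  (forall X Y e, ball X e Y -> ball (phi X) e (phi Y)) ->
  Ck D k f -> Ck D k (fun X => f (phi X)).
Proof.
  intros Hphi. revert f; induction k as [|k IH]; intros f [H H'];
    (split; [intros X s a Hsa; apply cont3_eps; intros e He;
       destruct (proj1 (cont3_eps _ _ _ _) (H (phi X) s a Hsa) e He) as [d Hd];
       exists d; intros; apply Hd; auto|]); [exact I|].
  destruct H' as [f1 [f2 [H1 [H2 [H3 H4]]]]].
  exists (fun X => f1 (phi X)), (fun X => f2 (phi X)).
  split; [|split; [|split; auto]].
  - intros X s a Hsa. apply H1, Hsa.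
  - intros X s a Hsa. exact (H2 (phi X) s a Hsa).
Qed.

Lemma Cr_ball_le M K r X0 e e' X : e <= e' -> Cr_ball M K r X0 e X -> Cr_ball M K r X0 e' X.
Proof. intros He [H [e1 [H1 H2]]]. split; [exact H|]. exists e1. split; [lra|exact H2]. Qed.

Definition vfield_ball (M K : R * R -> Prop) (r : nat) (X0 : vfield) (e : R) (He : 0 < e)
    (hX0 : Cr_vfield M r X0) : UniformSpace :=
  near_space K r (Cr_ball M K r X0 e) X0 (Cr_ball_center M K r X0 e He hX0).

Definition vfield_center (M K : R * R -> Prop) (r : nat) (X0 : vfield) (e : R) (He : 0 < e)
    (hX0 : Cr_vfield M r X0) : vfield_ball M K r X0 e He hX0 :=
  exist _ X0 (Cr_ball_center M K r X0 e He hX0).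

(** The interface between orbits and the singularity theory that follows: G, its derivative Q u with
    the sign of u, and the fact that G is the transition. The space of fields is fixed before rho is
    chosen; a smaller rho only shrinks the neighbourhood of X0 and the range of a. *)
Lemma transition_family (r : nat) (M V : R * R -> Prop) (X0 : vfield)
    (delta T0 sigma s x0 y0 : R) (hr : (1 <= r)%nat) (hX0 : Cr_vfield M r X0)
    (hM : open M)
    (hdelta : delta = sign (vx X0 0 0)) (hVO : V (0, 0)) (hVM : forall p, V p -> M p)
    (hVX0 : forall x y : R, V (x, y) -> vx X0 x y <> 0)
    (hA : condition_A M V X0 T0 sigma s (x0, y0)) :
  (delta = 1 \/ delta = -1) /\
  exists (K : R * R -> Prop) (e2 : R) (He2 : 0 < e2),
    compact_set K /\ (forall p, K p -> M p) /\
    exists (G u : vfield_ball M K r X0 e2 He2 hX0 -> R -> R) (W : R -> R -> Prop) (e1 rho0 : R),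
      0 < e1 /\ 0 < rho0 /\ open2 W /\ (forall x y, W x y -> M (x, y)) /\
      (forall a, Rabs a < e1 -> W a 0) /\
      Ck W r (fun X : vfield_ball M K r X0 e2 He2 hX0 => vx (proj1_sig X)) /\
      Ck W r (fun X : vfield_ball M K r X0 e2 He2 hX0 => vy (proj1_sig X)) /\
      Ck (fun _ a => Rabs a < e1) r (fun X _ a => G X a) /\
      Ck (fun _ a => Rabs a < e1) (pred r) (fun X _ a => u X a) /\
      (forall X a, Rabs a < e1 ->
         is_derive (G X) a (vy (proj1_sig X) a 0 * u X a) /\ delta * u X a < 0 /\
         0 < delta * vx (proj1_sig X) a 0) /\
      G (vfield_center M K r X0 e2 He2 hX0) 0 = y0 /\
      forall rho, 0 < rho < rho0 -> exists e', 0 < e' <= e1 /\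
        locally (vfield_center M K r X0 e2 He2 hX0) (fun X => forall a, Rabs a < e' ->
          (exists t, Rabs (t - sigma * T0) < rho /\ flow M (proj1_sig X) t (a, 0) (x0, G X a)) /\
          (forall t q, Rabs (t - sigma * T0) < rho -> flow M (proj1_sig X) t (a, 0) q ->
             fst q = x0 -> q = (x0, G X a))).
Proof.
  destruct (orbit_graph r M V X0 delta T0 sigma s x0 y0 hr hX0 hM hdelta hVO hVM hVX0 hA)
    as [Hdl [Hsx [gam [al [be [d [c [g [Hgam [Hd [Hc [Hal [Hbe [HtM [Hsp [Hg0 [HgT [Hon Horb]]]]]]]]]]]]]]]]]].
  destruct hA as [HT0 [Hsigma _]].
  split; [exact Hdl|].
  assert (Hmm : Rmin 0 x0 <= 0 <= Rmax 0 x0 /\ Rmin 0 x0 <= x0 <= Rmax 0 x0).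
  { unfold Rmin, Rmax. destruct Rle_dec; lra. }
  assert (Hab : al < be) by lra.
  set (K := tube gam al be d) in *. set (W := inner gam al be d).
  assert (HWo : open2 W) by (apply inner_open, Hgam).
  assert (HWM : forall x y, W x y -> M (x, y)) by (intros x y H; apply HtM, inner_tube, H).
  set (TG := goods M r X0 gam al be d c hX0 Hc).
  set (P := clamped M r X0 gam al be d c hX0 Hc vx : TG -> R -> R -> R).
  set (S := slope M r X0 gam al be d c hX0 Hc : TG -> R -> R -> R).
  set (val := fun X : TG => proj1_sig X).
  assert (P_val : forall (X : TG) x y, W x y -> P X x y = vx (val X) x y).
  { intros X x y H. unfold P, clamped. destruct (ret_id _ _ _ _ _ _ (inner_tube _ _ _ _ _ _ H)) as [E1 E2].
    rewrite E1, E2. reflexivity. }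
  assert (S_val : forall (X : TG) x y, W x y -> S X x y = vy (val X) x y / vx (val X) x y).
  { intros X x y H. unfold S, slope, clamped.
    destruct (ret_id _ _ _ _ _ _ (inner_tube _ _ _ _ _ _ H)) as [E1 E2].
    rewrite E1, E2. reflexivity. }
  assert (P_cont : forall (X : TG) x y, cont3 P X x y).
  { intros. apply clamped_continuous; auto. }
  assert (S_cont : forall (X : TG) x y, cont3 S X x y).
  { intros. apply slope_continuous with delta; auto. }
  assert (P_speed : forall (X : TG) x y, c / 2 <= delta * P X x y).
  { intros. apply clamped_speed; auto. }
  assert (S_Ck : Ck W r S) by (apply Ck_slope with delta; auto).
  assert (vx_Ck : Ck W r (fun X : TG => vx (val X))) by (apply Ck_vfield; auto).
  assert (vy_Ck : Ck W r (fun X : TG => vy (val X))) by (apply Ck_vfield; auto).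
  destruct (slope_bounds M r X0 gam al be d c delta hX0 hr Hgam Hab Hd Hc Hdl HtM Hsp)
    as [B [L [HL [S_bound [P_bound S_lip]]]]].
  fold S TG in S_bound, S_lip. fold P in P_bound.
  destruct (flow_graph_exists S B L S_cont S_bound S_lip HL) as [Y [Y_start [Y_ode Y_cont]]].
  assert (Hc2 : 0 < c / 2) by lra.
  set (Xz := exist _ X0 (good_X0 M r X0 gam al be d c hX0 Hc) : TG).
  (* Asserted for every point over X0, because [Xz] and [phi Xc] carry different membership
     proofs. *)
  assert (Horbit : forall Z : TG, proj1_sig Z = X0 -> forall w, 0 <= w <= T0 ->
     Y Z (fst (g (sigma * w))) 0 = snd (g (sigma * w)) /\
     travel_time P Y Z (fst (g (sigma * w))) 0 = sigma * w).
  { intros Z HZ w Hw.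
    apply (path_on_graph val P S Y W (c / 2) B L delta P_val S_val P_cont Hc2 P_speed P_bound
      HL S_lip Y_start Y_ode Y_cont Z 0 sigma (fun v => fst (g (sigma * v)))
      (fun v => snd (g (sigma * v))) w Hsigma (proj1 Hw)).
    - rewrite Rmult_0_r, Hg0. reflexivity.
    - rewrite Rmult_0_r, Hg0. reflexivity.
    - intros v Hv. destruct (Horb v ltac:(lra)) as [H1 [H2 _]].
      unfold val. rewrite HZ. split.
      + apply (is_derive_comp (fun v => fst (g v)) (fun v => sigma * v) v _ _ H1).
        apply is_derive_linear.
      + apply (is_derive_comp (fun v => snd (g v)) (fun v => sigma * v) v _ _ H2).
        apply is_derive_linear.
    - intros v Hv. destruct (Horb v ltac:(lra)) as [_ [_ [H3 H4]]].
      split; [lra|]. rewrite H3, Rminus_diag, Rabs_R0. exact Hd. }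
  (* The second component of p bounds both the initial abscissas and the overshoot beyond the ends
     of the arc; the arc of X0 itself lies on the axis of the tube. *)
  assert (Htube : locally ((Xz, 0) : TG * R) (fun p => forall x, Rmin 0 x0 <= x <= Rmax 0 x0 ->
     forall a x', Rabs a <= Rabs (snd p) -> Rabs (x' - x) <= Rabs (snd p) -> W x' (Y (fst p) x' a))).
  { apply (tube_lemma (fun (p : TG * R) x => forall a x', Rabs a <= Rabs (snd p) ->
       Rabs (x' - x) <= Rabs (snd p) -> W x' (Y (fst p) x' a))).
    intros x Hx. destruct (Hon x Hx) as [w [Hw Hxw]].
    destruct (Horbit Xz eq_refl w Hw) as [HYx _]. rewrite <- Hxw in HYx. simpl in HYx.
    assert (HWx : W x (Y Xz x 0)).
    { rewrite HYx. split; [lra|]. rewrite Rminus_diag, Rabs_R0. exact Hd. }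
    destruct (HWo _ _ HWx) as [e He]. assert (He0 := cond_pos e).
    destruct (proj1 (cont3_eps _ _ _ _) (Y_cont Xz x 0) e He0) as [e' He']. assert (He'0 := cond_pos e').
    assert (Hm : 0 < Rmin e e' / 2) by (apply Rdiv_lt_0_compat; [apply Rmin_glb_lt|]; lra).
    pose proof (Rmin_l e e'). pose proof (Rmin_r e e').
    exists (mkposreal _ Hm). intros [[X eta] z] [[HX Heta] Hz] a x' Ha Hx'. simpl in *.
    change (Rabs (eta - 0) < Rmin e e' / 2) in Heta. rewrite Rminus_0_r in Heta.
    change (Rabs (z - x) < Rmin e e' / 2) in Hz.
    assert (Hxx : Rabs (x' - x) < Rmin e e').
    { replace (x' - x) with ((x' - z) + (z - x)) by ring.
      eapply Rle_lt_trans; [apply Rabs_triang|]. lra. }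
    apply He; [lra|]. apply He'; [| lra |rewrite Rminus_0_r; lra].
    apply ball_le with (2 := HX). simpl. lra. }
  destruct Htube as [e0 He0]. assert (He00 := cond_pos e0).
  set (rad := radius c). assert (Hrad : 0 < rad) by (apply radius_pos, Hc).
  set (e1 := e0 / 2). assert (He1 : 0 < e1) by (unfold e1; lra).
  (* The bound by [rad] provides the inclusion [phi] into the fields of the clamped construction;
     the bound by e0 keeps their graphs in W. *)
  set (e2 := Rmin e0 rad). assert (He2 : 0 < e2) by (apply Rmin_glb_lt; lra).
  assert (He2r : e2 <= rad) by apply Rmin_r. assert (He2e : e2 <= e0) by apply Rmin_l.
  set (T := vfield_ball M K r X0 e2 He2 hX0).
  set (phi := fun X : T => exist (good M r X0 gam al be d c) (proj1_sig X)
                (Cr_ball_le _ _ _ _ _ _ _ He2r (proj2_sig X)) : TG).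
  assert (Hphi : forall (X X' : T) e, ball X e X' -> ball (phi X) e (phi X')).
  { intros X X' e H. exact H. }
  set (lo := Rmin 0 x0 - e1). set (hi := Rmax 0 x0 + e1).
  assert (HWY : forall (X : T) x a, lo < x < hi -> Rabs a < e1 -> W x (Y (phi X) x a)).
  { intros X x a Hx Ha.
    assert (Hball : ball ((Xz, 0) : TG * R) e0 (phi X, e1)).
    { split.
      - destruct (proj2 (proj2_sig X)) as [e' [H1 H2]].
        apply (Cr_close_le K r e'); [lra | exact H2].
      - change (Rabs (e1 - 0) < e0). rewrite Rminus_0_r, Rabs_right; unfold e1; lra. }
    apply (He0 (phi X, e1) Hball (clamp (Rmin 0 x0) (Rmax 0 x0) x)); simpl.
    - apply clamp_in. lra.
    - rewrite (Rabs_right e1) by lra. lra.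
    - rewrite (Rabs_right e1) by lra. unfold clamp. apply Rabs_le.
      unfold lo, hi in Hx. revert Hx. destruct Hmm as [Hm1 Hm2]. revert Hm1 Hm2.
      generalize (Rmin 0 x0) (Rmax 0 x0). intros m1 m2 Hm1 Hm2 Hx.
      unfold Rmax, Rmin. repeat destruct Rle_dec; lra. }
  set (P' := fun X : T => P (phi X)). set (S' := fun X : T => S (phi X)).
  set (Y' := fun X : T => Y (phi X)). set (val' := fun X : T => proj1_sig X).
  assert (P'_cont : forall X x y, cont3 P' X x y).
  { intros X x y. apply cont3_eps. intros e He.
    destruct (proj1 (cont3_eps _ _ _ _) (P_cont (phi X) x y) e He) as [d' Hd'].
    exists d'. intros Z; intros. apply (Hd' (phi Z)); auto. }
  assert (Y'_cont : forall X x y, cont3 Y' X x y).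
  { intros X x y. apply cont3_eps. intros e He.
    destruct (proj1 (cont3_eps _ _ _ _) (Y_cont (phi X) x y) e He) as [d' Hd'].
    exists d'. intros Z; intros. apply (Hd' (phi Z)); auto. }
  assert (S'_Ck : Ck W r S') by (apply (Ck_pullback phi W r S Hphi S_Ck)).
  assert (vx'_Ck : Ck W r (fun X : T => vx (val' X)))
    by (apply (Ck_pullback phi W r (fun X : TG => vx (val X)) Hphi vx_Ck)).
  assert (vy'_Ck : Ck W r (fun X : T => vy (val' X)))
    by (apply (Ck_pullback phi W r (fun X : TG => vy (val X)) Hphi vy_Ck)).
  set (D := fun x a => lo < x < hi /\ Rabs a < e1).
  assert (HDo : open2 D).
  { intros x a [Hx Ha].
    assert (Hm : 0 < Rmin (Rmin (x - lo) (hi - x)) (e1 - Rabs a))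
      by (repeat apply Rmin_glb_lt; lra).
    exists (mkposreal _ Hm). simpl. intros x' a' Hx' Ha'.
    pose proof (Rmin_l (Rmin (x - lo) (hi - x)) (e1 - Rabs a)).
    pose proof (Rmin_r (Rmin (x - lo) (hi - x)) (e1 - Rabs a)).
    pose proof (Rmin_l (x - lo) (hi - x)). pose proof (Rmin_r (x - lo) (hi - x)).
    apply Rabs_def2 in Hx'. split; [lra|].
    replace a' with (a + (a' - a)) by ring. eapply Rle_lt_trans; [apply Rabs_triang|]. lra. }
  assert (Hlohi : forall a, Rabs a < e1 -> lo < a < hi).
  { intros a Ha. apply Rabs_def2 in Ha. unfold lo, hi. lra. }
  assert (HDc : forall x a z, D x a -> Rmin a x <= z <= Rmax a x -> D z a).
  { intros x a z [Hx Ha] Hz. split; [|exact Ha]. assert (H := Hlohi a Ha).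
    revert Hz. unfold Rmin, Rmax. destruct Rle_dec; lra. }
  assert (HDx0 : forall a, Rabs a < e1 -> D x0 a).
  { intros a Ha. split; [unfold lo, hi; lra|exact Ha]. }
  assert (HDW : forall (X : T) x a, D x a -> W x (Y' X x a)).
  { intros X x a [Hx Ha]. apply HWY; assumption. }
  destruct r as [|m]; [lia|].
  assert (S'_Ck0 := S'_Ck).
  destruct S'_Ck0 as [_ [S1 [S2 [_ [HS2 [_ S2_Ck]]]]]].
  set (E := variation S2 Y').
  assert (HWconv : forall x y1 y2 t, W x y1 -> W x y2 -> 0 <= t <= 1 -> W x ((1 - t) * y1 + t * y2)).
  { intros x y1 y2 t. apply (inner_convex gam al be d). }
  assert (Y'_start : forall X a, Y' X a a = 0) by (intros; apply Y_start).
  assert (Y'_ode : forall X x a, is_derive (fun x => Y' X x a) x (S' X x (Y' X x a)))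
    by (intros; apply Y_ode).
  destruct (flow_graph_smooth S' S2 Y' W D m Y'_start Y'_ode Y'_cont HWo HWconv HDo HDc HDW S'_Ck
              HS2 S2_Ck) as [Y'_Ck E_Ck].
  fold E in E_Ck.
  assert (HWa : forall a, Rabs a < e1 -> W a 0).
  { intros a Ha. rewrite <- (Y'_start (vfield_center M K (Datatypes.S m) X0 e2 He2 hX0) a).
    apply HDW. split; [apply Hlohi, Ha | exact Ha]. }
  exists K, e2, He2.
  split; [apply compact_tube_graph, Hgam|]. split; [exact HtM|].
  set (Xc := vfield_center M K (Datatypes.S m) X0 e2 He2 hX0).
  assert (P'_val : forall (X : T) x y, W x y -> P' X x y = vx (val' X) x y)
    by (intros; apply P_val; assumption).
  assert (S'_val : forall (X : T) x y, W x y -> S' X x y = vy (val' X) x y / vx (val' X) x y)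
    by (intros; apply S_val; assumption).
  assert (P'_speed : forall (X : T) x y, c / 2 <= delta * P' X x y) by (intros; apply P_speed).
  assert (P'_bound : forall (X : T) x y, Rabs (P' X x y) <= B) by (intros; apply P_bound).
  assert (S'_lip : forall (X : T) x y z, Rabs (S' X x y - S' X x z) <= L * Rabs (y - z))
    by (intros; apply S_lip).
  assert (Hvx : forall X a, Rabs a < e1 -> 0 < delta * vx (val' X) a 0).
  { intros X a Ha. rewrite <- P'_val by (apply HWa, Ha). assert (H := P'_speed X a 0). lra. }
  assert (Hvx0 : forall X a, Rabs a < e1 -> vx (val' X) a 0 <> 0).
  { intros X a Ha H0. assert (H := Hvx X a Ha). rewrite H0 in H. lra. }
  set (om := sigma * delta).
  assert (Hom : om = 1 \/ om = -1).
  { unfold om. destruct Hsigma as [E1|E1], Hdl as [E2|E2]; rewrite E1, E2; [left|right|right|left]; lra. }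
  set (tt := travel_time P' Y').
  (* A barrier beyond x0 in the direction of motion, which is the sign [om] of sigma times the
     horizontal speed, still inside the margin e1. *)
  set (xe := x0 + om * (e1 / 2)).
  assert (Hxe : lo < xe < hi) by (unfold lo, hi, xe; destruct Hom as [E1|E1]; rewrite E1; lra).
  destruct (Horbit (phi Xc) eq_refl T0 ltac:(lra)) as [HYx0 Htw]. rewrite HgT in HYx0, Htw.
  simpl in HYx0, Htw. change (tt Xc x0 0 = sigma * T0) in Htw.
  assert (Hte : sigma * tt Xc xe 0 > T0).
  { assert (HB := B_nonneg P' B P'_bound Xc).
    assert (Hib : 0 < / (B + 1)) by (apply Rinv_0_lt_compat; lra).
    assert (Hexp := travel_time_expands P' Y' (c / 2) B delta P'_cont Hc2 Hdl P'_speed P'_bound Y'_cont Xc 0).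
    fold tt in Hexp.
    assert (Hsq : sigma * (sigma * T0) = T0) by (destruct Hsigma as [E1|E1]; rewrite E1; ring).
    assert (Hpos : 0 < / (B + 1) * (e1 / 2)) by (apply Rmult_lt_0_compat; lra).
    assert (Hsd : sigma = om * delta).
    { unfold om. destruct Hdl as [E1|E1]; rewrite E1; ring. }
    assert (H : sigma * tt Xc x0 0 < sigma * tt Xc xe 0).
    { rewrite Hsd. unfold xe. destruct Hom as [E1|E1]; rewrite E1.
      - assert (H := Hexp x0 (x0 + 1 * (e1 / 2)) ltac:(lra)). 
        replace (x0 + 1 * (e1 / 2) - x0) with (e1 / 2) in H by ring. lra.
      - assert (H := Hexp (x0 + -1 * (e1 / 2)) x0 ltac:(lra)).
        replace (x0 - (x0 + -1 * (e1 / 2))) with (e1 / 2) in H by ring. lra. }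
    rewrite Htw, Hsq in H. lra. }
  (* Half of the time left before the barrier absorbs the dependence of the travel time on (X, a),
     the other half absorbs rho. *)
  set (gap := (sigma * tt Xc xe 0 - T0) / 2). assert (Hgap : 0 < gap) by (unfold gap; lra).
  (* The derivative of Y in a is -F(a, 0) E with F = Q / P, so the cofactor of Q is u = -E / P,
     whose sign is opposite to that of P because E is an exponential. *)
  set (E0 := fun (X : T) (_ a : R) => - E X x0 a * / vx (val' X) a 0).
  (* The bound T0 on rho makes every admissible time have the sign of sigma. *)
  exists (fun X a => Y' X x0 a), (fun X a => E0 X 0 a), W, e1, (Rmin T0 gap).
  split; [exact He1|]. split; [apply Rmin_glb_lt; lra|]. split; [exact HWo|].
  split; [exact HWM|]. split; [exact HWa|]. split; [exact vx'_Ck|]. split; [exact vy'_Ck|].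
  split.
  { apply (Ck_comp (fun _ a => Rabs a < e1) D (Datatypes.S m) Y' (fun _ _ _ => x0) (fun _ _ a => a));
      auto using Ck_const, Ck_snd. }
  split.
  { unfold E0. simpl pred. apply Ck_mult.
    - apply Ck_opp.
      apply (Ck_comp (fun _ a => Rabs a < e1) D m E (fun _ _ _ => x0) (fun _ _ a => a));
        auto using Ck_const, Ck_snd.
    - apply Ck_inv; [intros X _ a Ha; apply Hvx0, Ha|].
      apply (Ck_comp (fun _ a => Rabs a < e1) W m (fun X => vx (val' X)) (fun _ _ a => a) (fun _ _ _ => 0));
        auto using Ck_const, Ck_snd.
      apply Ck_S, vx'_Ck. }
  split.
  { intros X a Ha. split; [|split; [|apply Hvx, Ha]].
    - assert (H := flow_graph_derive_2 S' S2 Y' W D m Y'_start Y'_ode Y'_cont HWconv HDo HDc HDW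
                     HS2 S2_Ck X x0 a (HDx0 a Ha)).
      fold E in H. rewrite S'_val in H by (apply HWa, Ha).
      replace (vy (proj1_sig X) a 0 * E0 X 0 a) with
        (- (vy (val' X) a 0 / vx (val' X) a 0) * E X x0 a); [exact H|].
      unfold E0, val'. field. apply Hvx0, Ha.
    - unfold E0. assert (HE : 0 < E X x0 a) by apply exp_pos.
      assert (H := Hvx X a Ha). assert (H' := Hvx0 X a Ha).
      assert (Hi : 0 < delta * / vx (val' X) a 0).
      { replace (delta * / vx (val' X) a 0) with (/ (delta * vx (val' X) a 0)).
        - apply Rinv_0_lt_compat, H.
        - destruct Hdl as [E1|E1]; rewrite E1; field; exact H'. }
      replace (delta * (- E X x0 a * / vx (val' X) a 0)) with
        (- (E X x0 a * (delta * / vx (val' X) a 0))) by ring.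
      assert (0 < E X x0 a * (delta * / vx (val' X) a 0)) by (apply Rmult_lt_0_compat; assumption).
      lra. }
  split; [exact HYx0|].
  intros rho Hrho.
  assert (Hrho1 : rho < T0) by (pose proof (Rmin_l T0 gap); lra).
  assert (Hrho2 : rho < gap) by (pose proof (Rmin_r T0 gap); lra).
  assert (Htc : forall x a, cont3 tt Xc x a).
  { intros x a. apply (travel_time_continuous P' Y' (c / 2) delta); assumption. }
  destruct (proj1 (cont3_eps _ _ _ _) (Htc x0 0) rho (proj1 Hrho)) as [d1 Hd1].
  destruct (proj1 (cont3_eps _ _ _ _) (Htc xe 0) gap Hgap) as [d2 Hd2].
  assert (Hd1p := cond_pos d1). assert (Hd2p := cond_pos d2).
  set (d3 := Rmin d1 d2). assert (Hd3 : 0 < d3) by (apply Rmin_glb_lt; lra).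
  assert (Hd31 : d3 <= d1) by apply Rmin_l. assert (Hd32 : d3 <= d2) by apply Rmin_r.
  exists (Rmin e1 d3). split; [split; [apply Rmin_glb_lt; lra | apply Rmin_l]|].
  exists (mkposreal d3 Hd3). intros X HX a Ha.
  assert (Ha1 : Rabs a < e1) by (pose proof (Rmin_l e1 d3); lra).
  assert (Ha2 : Rabs a < d3) by (pose proof (Rmin_r e1 d3); lra).
  assert (Hz : forall z, Rabs (z - z) = 0) by (intros; rewrite Rminus_diag; apply Rabs_R0).
  assert (A1 : Rabs (tt X x0 a - tt Xc x0 0) < rho).
  { apply Hd1; [apply ball_le with (2 := HX); exact Hd31 | rewrite Hz; lra |
      rewrite Rminus_0_r; lra]. }
  assert (A2 : Rabs (tt X xe a - tt Xc xe 0) < gap).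
  { apply Hd2; [apply ball_le with (2 := HX); exact Hd32 | rewrite Hz; lra |
      rewrite Rminus_0_r; lra]. }
  split.
  - exists (tt X x0 a). split; [rewrite Htw in A1; exact A1|].
    apply (flow_exists val' P' S' Y' M W (c / 2) B delta HWM P'_val S'_val P'_cont Hc2 Hdl P'_speed
             P'_bound Y'_start Y'_ode Y'_cont X a x0).
    intros z Hz'. apply HDW. apply (HDc x0); [apply HDx0, Ha1 | exact Hz'].
  - intros t q Ht Hflow Hq.
    assert (Hst : T0 - rho < sigma * t < T0 + rho).
    { apply Rabs_def2 in Ht. destruct Hsigma as [E1|E1]; rewrite E1 in *; lra. }
    assert (Hs2 : sigma * t < sigma * tt X xe a).
    { apply Rabs_def2 in A2. unfold gap in *. destruct Hsigma as [E1|E1]; rewrite E1 in *; lra. }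
    assert (H := flow_unique val' P' S' Y' M W (c / 2) B L delta HWo P'_val S'_val P'_cont Hc2 Hdl
      P'_speed P'_bound HL S'_lip Y'_start Y'_ode Y'_cont X a sigma t xe q lo hi Hsigma ltac:(lra)
      (Hlohi a Ha1) Hxe (fun z Hz => HDW X z a (conj Hz Ha1)) Hs2 Hflow).
    rewrite Hq in H. destruct q as [q1 q2]. simpl in *. congruence.
Qed.

(** * Contact order and perturbations *)

Lemma open2_strip e : open2 (fun _ a => Rabs a < e).
Proof.
  intros s a Ha. assert (Hd : 0 < e - Rabs a) by lra. exists (mkposreal _ Hd). simpl.
  intros u v _ Hv. replace v with (a + (v - a)) by ring.
  eapply Rle_lt_trans; [apply Rabs_triang|]. lra.
Qed.

Lemma Ck_pow {T : UniformSpace} D k N (f : T -> R -> R -> R) :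
  Ck D k f -> Ck D k (fun X s a => f X s a ^ N).
Proof.
  intros Hf. induction N as [|N IH]; [exact (Ck_const D k 1)|].
  apply (Ck_mult D k f (fun X s a => f X s a ^ N)); assumption.
Qed.

(* The diffeomorphism is the translation by a up to order 2N at 0, and it fixes
   both end points. *)
Lemma translation_diffeo (r N : nat) (eps a : R) :
  0 < eps -> (1 <= N)%nat -> Rabs a * INR (2 * N) < eps ->
  Cr_diffeo r eps (fun x => (x + a * (1 - (x / eps) ^ (2 * N)), 0)).
Proof.
  intros He HN Ha.
  set (g := fun x => x + a * (1 - (x / eps) ^ (2 * N))).
  set (dg := fun x => 1 - a * (INR (2 * N) * / eps * (x / eps) ^ pred (2 * N))).
  assert (Hg : forall x, is_derive g x (dg x)).
  { intros x. unfold g, dg.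
    assert (H1 : is_derive (fun x => x / eps) x (/ eps)).
    { apply is_derive_ext with (fun x => / eps * x); [intros t; apply Rmult_comm|].
      apply is_derive_linear. }
    assert (H2 := is_derive_pow (fun x => x / eps) (2 * N) x (/ eps) H1).
    set (l := INR (2 * N) * / eps * (x / eps) ^ pred (2 * N)) in *.
    replace (1 - a * l) with (1 + a * (0 - l)) by ring.
    apply (is_derive_plus (fun x => x) (fun x => a * (1 - (x / eps) ^ (2 * N)))).
    - apply @is_derive_id.
    - apply (is_derive_scal (fun x => 1 - (x / eps) ^ (2 * N))).
      apply (is_derive_minus (fun _ => 1) (fun x => (x / eps) ^ (2 * N)));
        [apply @is_derive_const | exact H2]. }
  (* Since |x / eps| <= 1 on the closed interval, c is a lower bound for the derivative of g
     there. *)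
  set (c := 1 - Rabs a * INR (2 * N) / eps).
  assert (Hc : 0 < c).
  { unfold c. assert (Rabs a * INR (2 * N) / eps < 1); [|lra].
    apply Rmult_lt_reg_r with eps; [exact He|]. unfold Rdiv.
    rewrite Rmult_assoc, Rinv_l by lra. lra. }
  assert (Hc1 : c <= 1).
  { unfold c. assert (0 <= Rabs a * INR (2 * N) / eps); [|lra].
    apply Rdiv_le_0_compat; [|exact He]. apply Rmult_le_pos; [apply Rabs_pos | apply pos_INR]. }
  assert (Hdg : forall x, - eps <= x <= eps -> c <= dg x).
  { intros x Hx. unfold c, dg.
    assert (Hp : Rabs ((x / eps) ^ pred (2 * N)) <= 1).
    { rewrite <- RPow_abs. rewrite <- (pow1 (pred (2 * N))). apply pow_incr.
      split; [apply Rabs_pos|]. unfold Rdiv. rewrite Rabs_mult, Rabs_inv, (Rabs_right eps) by lra.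
      apply Rmult_le_reg_r with eps; [exact He|]. rewrite Rmult_assoc, Rinv_l, Rmult_1_r by lra.
      rewrite Rmult_1_l. apply Rabs_le. lra. }
    assert (Hie : 0 < / eps) by (apply Rinv_0_lt_compat, He).
    assert (a * (INR (2 * N) * / eps * (x / eps) ^ pred (2 * N)) <= Rabs a * INR (2 * N) / eps); [|lra].
    eapply Rle_trans; [apply Rle_abs|]. rewrite !Rabs_mult.
    rewrite (Rabs_right (INR (2 * N))) by (apply Rle_ge, pos_INR).
    rewrite (Rabs_right (/ eps)) by lra.
    replace (Rabs a * INR (2 * N) / eps) with (Rabs a * (INR (2 * N) * / eps * 1)) by (unfold Rdiv; ring).
    apply Rmult_le_compat_l; [apply Rabs_pos|]. apply Rmult_le_compat_l; [|exact Hp].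
    apply Rmult_le_pos; [apply pos_INR|lra]. }
  set (cl := clamp (- eps) eps).
  assert (Hcl : forall x, - eps <= cl x <= eps) by (intros; apply clamp_in; lra).
  (* Continuing g with slope 1 >= c makes it an expanding map of the line with a global inverse. The
     end points are fixed because the exponent 2N is even, so g preserves the interval. *)
  set (f := fun x => g (cl x) + (x - cl x)).
  assert (Hfc : continuity f).
  { intros x. apply continuity_pt_filterlim. apply (continuous_plus (fun x => g (cl x))).
    - apply (continuous_comp cl g); [apply clamp_continuous; lra|].
      eapply is_derive_continuous, Hg.
    - apply (continuous_minus (fun x : R => x)); [apply continuous_id | apply clamp_continuous; lra]. }
  assert (Hfe : forall x y, x <= y -> c * (y - x) <= f y - f x).
  { intros x y Hxy. unfold f. assert (Hm := clamp_mono (- eps) eps x y ltac:(lra) Hxy). fold cl in Hm.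
    destruct (MVT_gen g (cl x) (cl y) dg) as [z [Hz Heq]].
    - intros; apply Hg.
    - intros; eapply is_derive_continuity_pt, Hg.
    - rewrite Rmin_left, Rmax_right in Hz by lra.
      assert (H := Hdg z ltac:(pose proof (Hcl x); pose proof (Hcl y); lra)). nra. }
  destruct (expanding_inverse f c Hc Hfc Hfe) as [k [Hkf [Hfk Hkc]]].
  assert (Hfin : forall x, - eps <= x <= eps -> f x = g x).
  { intros x Hx. unfold f, cl. rewrite clamp_id by lra. ring. }
  assert (Hpe : forall x, x = eps \/ x = - eps -> f x = x).
  { intros x Hx. rewrite Hfin by (destruct Hx; subst x; lra). unfold g.
    replace ((x / eps) ^ (2 * N)) with 1; [ring|].
    rewrite pow_mult. replace ((x / eps) ^ 2) with 1; [symmetry; apply pow1|].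
    destruct Hx; subst x; field; lra. }
  assert (Hmono : forall x y, x < y -> f x < f y).
  { intros x y Hxy. assert (H := Hfe x y ltac:(lra)). nra. }
  assert (Hlt : forall x y, f x < f y -> x < y).
  { intros x y Hxy. destruct (Rlt_le_dec x y) as [|[Hl|Hl]]; [assumption| |].
    - apply Hmono in Hl. lra.
    - subst y. lra. }
  assert (Hk_in : forall u, - eps < u < eps -> - eps < k u < eps).
  { intros u Hu. split; apply Hlt; rewrite Hfk, Hpe; auto; lra. }
  assert (Hg_in : forall u, - eps < u < eps -> - eps < g u < eps).
  { intros u Hu. rewrite <- Hfin by lra.
    assert (E1 := Hpe eps (or_introl eq_refl)). assert (E2 := Hpe (- eps) (or_intror eq_refl)).
    assert (A1 := Hmono (- eps) u (proj1 Hu)). assert (A2 := Hmono u eps (proj2 Hu)). lra. }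
  set (D := fun (_ x : R) => Rabs x < eps).
  assert (HDo : open2 D) by apply open2_strip.
  assert (HDin : forall x, Rabs x < eps -> - eps < x < eps) by (intros x Hx; apply Rabs_def2 in Hx; lra).
  assert (Ck_quot : forall j, Ck D j (fun (_ : R) (_ : R) x => x / eps)).
  { intros j. apply (Ck_mult D j (fun _ _ x => x) (fun _ _ _ => / eps)); [apply Ck_snd | apply Ck_const]. }
  assert (Ck_g : Ck D r (fun (_ : R) (_ : R) x => g x)).
  { apply (Ck_plus D r (fun _ _ x => x)); [apply Ck_snd|].
    apply (Ck_mult D r (fun _ _ _ => a)); [apply Ck_const|].
    apply (Ck_plus D r (fun _ _ _ => 1)); [apply Ck_const|]. apply Ck_opp, Ck_pow, Ck_quot. }
  assert (Ck_dg : forall j, Ck D j (fun (_ : R) (_ : R) x => dg x)).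
  { intros j. apply (Ck_plus D j (fun _ _ _ => 1)); [apply Ck_const|]. apply Ck_opp.
    apply (Ck_mult D j (fun _ _ _ => a)); [apply Ck_const|].
    apply (Ck_mult D j (fun _ _ _ => INR (2 * N) * / eps)); [apply Ck_const|].
    apply Ck_pow, Ck_quot. }
  assert (Hk_der : forall u, Rabs u < eps -> is_derive k u (/ dg (k u))).
  { intros u Hu. assert (Hku := Hk_in u (HDin u Hu)). apply (is_derive_inverse g k).
    - generalize (locally_ball_0 eps u Hu). apply filter_imp. intros v Hv.
      assert (H := Hk_in v (HDin v Hv)). rewrite <- Hfin by lra. apply Hfk.
    - apply Hkc.
    - apply Hg.
    - assert (H := Hdg (k u) ltac:(lra)). lra. }
  (* The formula k' = 1 / g'(k) raises the order of k by one at each step. *)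
  assert (Ck_k : forall j, Ck D j (fun (_ : R) (_ : R) x => k x)).
  { assert (Hcont : forall X s x : R, D s x -> cont3 (fun _ _ x => k x) X s x).
    { intros X s x _. apply (continuous_comp (fun q : R * (R * R) => snd (snd q)) k); [|apply Hkc].
      apply (continuous_comp (fun q : R * (R * R) => snd q) snd); apply continuous_snd. }
    induction j as [|j IH]; split; auto.
    exists (fun _ _ _ => 0), (fun _ _ x => / dg (k x)). split; [|split; [|split]].
    - intros; apply @is_derive_const.
    - intros X s x Hx. apply Hk_der, Hx.
    - apply Ck_const.
    - apply Ck_inv.
      + intros X s x Hx. assert (H := Hk_in x (HDin x Hx)). assert (H' := Hdg (k x) ltac:(lra)). lra.
      + apply (Ck_comp D D j (fun _ _ x => dg x) (fun _ s _ => s) (fun _ _ x => k x));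
          auto using Ck_fst.
        intros X s x Hx. apply Rabs_def1; apply Hk_in, HDin, Hx. }
  exists g, k. split; [apply Ck_Cr_on_interval, Ck_g|]. split; [apply Ck_Cr_on_interval, Ck_k|].
  split.
  - intros x Hx. split; [reflexivity|]. split; [apply Hg_in, Hx|].
    rewrite <- Hfin by lra. apply Hkf.
  - intros u Hu. split; [apply Hk_in, Hu|].
    assert (H := Hk_in u Hu). rewrite <- Hfin by lra. apply Hfk.
Qed.

Lemma Ck_smooth {T : UniformSpace} (D : R -> R -> Prop) (k : nat) (f : T -> R -> R -> R) X s e :
  (forall a, Rabs a < e -> D s a) -> Ck D k f -> smooth e k (fun a => f X s a).
Proof.
  intros HD. revert f; induction k as [|k IH]; intros f; [intros; exact I|].
  intros [_ [f1 [f2 [_ [H2 [_ H4]]]]]]. exists (fun a => f2 X s a). split; [|auto].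
  intros a Ha. apply (H2 X s a), HD, Ha.
Qed.

Lemma Ck_axis {T : UniformSpace} (W : R -> R -> Prop) (k : nat) (f : T -> R -> R -> R) e :
  open2 W -> (forall a, Rabs a < e -> W a 0) -> Ck W k f ->
  Ck (fun _ a => Rabs a < e) k (fun X _ a => f X a 0).
Proof.
  intros HW HWa Hf.
  apply (Ck_comp (fun _ a => Rabs a < e) W k f (fun _ _ a => a) (fun _ _ _ => 0));
    auto using Ck_snd, Ck_const.
Qed.

Lemma smooth_axis {T : UniformSpace} (W : R -> R -> Prop) (k : nat) (f : T -> R -> R -> R) X e :
  open2 W -> (forall a, Rabs a < e -> W a 0) -> Ck W k f -> smooth e k (fun a => f X a 0).
Proof.
  intros HW HWa Hf.
  apply (Ck_smooth (fun _ a => Rabs a < e) k (fun X _ a => f X a 0) X 0 e); [auto|].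
  apply Ck_axis with W; assumption.
Qed.

Section Lie.
Context {T : UniformSpace}.
Variables (val : T -> vfield) (W : R -> R -> Prop) (r : nat) (e : R).
Hypothesis HW : open2 W.
Hypothesis He : 0 < e.
Hypothesis HWa : forall a, Rabs a < e -> W a 0.
Hypothesis vx_Ck : Ck W r (fun X => vx (val X)).
Hypothesis vy_Ck : Ck W r (fun X => vy (val X)).

(** The bound is r + 1 because the height function is smooth and Xh is just the vertical component:
    the i-th iterate loses only i - 1 derivatives. *)
Lemma lie_iter_Ck i k : (i + k <= r + 1)%nat -> Ck W k (fun X => lie_iter (val X) i height).
Proof.
  revert k; induction i as [|i IH]; intros k Hik.
  - exact (Ck_snd W k).
  - destruct (IH (S k) ltac:(lia)) as [_ [f1 [f2 [H1 [H2 [H3 H4]]]]]].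
    apply Ck_ext with (fun X x y => vx (val X) x y * f1 X x y + vy (val X) x y * f2 X x y).
    + exact HW.
    + intros X x y Hxy. simpl. unfold lie. f_equal; f_equal; symmetry; apply is_derive_unique.
      * apply H1, Hxy.
      * exact (H2 X x y Hxy).
    + apply Ck_plus; apply Ck_mult; auto; apply Ck_le with r; auto; lia.
Qed.

(* On the axis, X f = P (f|axis)' + Q f_y, and the last term has the order of
   vanishing of Q = Xh. *)
Lemma lie_iter_jet X k c : (k < r)%nat -> jet e k c (fun a => vy (val X) a 0) ->
  forall i j, (i + j = k)%nat ->
    jet e j (c * vx (val X) 0 0 ^ i) (fun a => lie_iter (val X) (S i) height a 0).
Proof.
  intros Hk Hq i. induction i as [|i IH]; intros j Hij.
  - simpl in Hij. subst j. rewrite pow_O, Rmult_1_r.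
    apply (jet_ext e He _ _ (fun a => vy (val X) a 0)); [|exact Hq].
    intros a _. simpl. unfold lie, height. rewrite Derive_const, Derive_id. ring.
  - assert (HA := IH (S j) ltac:(lia)).
    destruct (lie_iter_Ck (S i) (S j) ltac:(lia)) as [_ [f1 [f2 [H1 [H2 [H3 H4]]]]]].
    apply (jet_ext e He _ _ (fun a => f1 X a 0 * vx (val X) a 0 + vy (val X) a 0 * f2 X a 0)).
    { intros a Ha. change (lie_iter (val X) (S (S i)) height a 0) with
        (lie (val X) (lie_iter (val X) (S i) height) a 0). unfold lie.
      rewrite (Rmult_comm (f1 X a 0)). f_equal; f_equal; symmetry; apply is_derive_unique.
      - apply H1, HWa, Ha.
      - exact (H2 X a 0 (HWa a Ha)). }
    replace (c * vx (val X) 0 0 ^ S i) with (c * vx (val X) 0 0 ^ i * vx (val X) 0 0 + 0 * f2 X 0 0)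
      by (simpl; ring).
    apply jet_plus.
    + apply (jet_mult e j _ (fun a => f1 X a 0) (fun a => vx (val X) a 0)).
      * apply jet_derive with (fun a => lie_iter (val X) (S i) height a 0); [exact He| |exact HA].
        intros a Ha. apply H1, HWa, Ha.
      * apply (smooth_axis W j (fun X => vx (val X))); auto. apply Ck_le with r; [lia|exact vx_Ck].
    + apply (jet_mult e j 0 (fun a => vy (val X) a 0) (fun a => f2 X a 0)).
      * apply jet_lt with k c; [lia|exact Hq].
      * apply (smooth_axis W j f2); auto.
Qed.

(** If Q(., 0) is flat to order k with k-th derivative c, then X^(k+1) h = c P^k at the origin; as P
    is not 0 there, each vanishing Lie derivative gives one more order of flatness. *)
Lemma contact_jet X (M : R * R -> Prop) n : (1 <= n)%nat -> (n <= r)%nat ->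
  vx (val X) 0 0 <> 0 -> multiplicity_contact M (val X) n (0, 0) ->
  exists c, jet e (n - 1) c (fun a => vy (val X) a 0) /\
    lie_iter (val X) n height 0 0 = c * vx (val X) 0 0 ^ (n - 1).
Proof.
  intros Hn Hnr Hv [_ [_ [H1 _]]]. simpl in H1.
  assert (Hk : forall k, (k <= n - 1)%nat -> exists c, jet e k c (fun a => vy (val X) a 0)).
  { induction k as [|k IH]; intros Hkn; [exists (vy (val X) 0 0); reflexivity|].
    destruct (IH ltac:(lia)) as [c Hc].
    assert (HA := lie_iter_jet X k c ltac:(lia) Hc k 0 ltac:(lia)). simpl jet in HA.
    change (lie_iter (val X) (S k) height 0 0 = c * vx (val X) 0 0 ^ k) in HA.
    rewrite H1 in HA by lia.
    apply (jet_raise e He).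
    - symmetry in HA. apply Rmult_integral in HA. destruct HA as [E|E].
      + rewrite E in Hc. exact Hc.
      + exfalso. exact (pow_nonzero _ _ Hv E).
    - apply (smooth_axis W (S k) (fun X => vy (val X))); auto. apply Ck_le with r; [lia|exact vy_Ck]. }
  destruct (Hk (n - 1)%nat ltac:(lia)) as [c Hc]. exists c. split; [exact Hc|].
  assert (HA := lie_iter_jet X (n - 1) c ltac:(lia) Hc (n - 1) 0 ltac:(lia)).
  replace (S (n - 1)) with n in HA by lia. exact HA.
Qed.
End Lie.

(** * Polynomial perturbations of the vertical component *)

Lemma filter_forall_lt {T : Type} (F : (T -> Prop) -> Prop) {FF : Filter F} (P : nat -> T -> Prop) m :
  (forall i, (i < m)%nat -> F (P i)) -> F (fun x => forall i, (i < m)%nat -> P i x).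
Proof.
  induction m as [|m IH]; intros H.
  - apply filter_forall. intros x i Hi. lia.
  - assert (H1 := IH (fun i Hi => H i ltac:(lia))). assert (H2 := H m ltac:(lia)).
    generalize (filter_and _ _ H1 H2). clear H1 H2.
    apply filter_imp. intros x [H1 H2] i Hi.
    destruct (Nat.eq_dec i m) as [->|]; [exact H2 | apply H1; lia].
Qed.

(** The restriction of Q to the axis changes by exactly mu w, and the horizontal speed does not
    change. *)
Definition shear (X0 : vfield) (w : R -> R) (mu : R) : vfield :=
  VField (vx X0) (fun x y => vy X0 x y + mu * w x).

Lemma shear_zero X0 w : shear X0 w 0 = X0.
Proof.
  destruct X0 as [p q]. unfold shear. simpl. f_equal.
  do 2 (apply functional_extensionality; intro). ring.
Qed.

Lemma horner_Ck {T : UniformSpace} (D : R -> R -> Prop) k l :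
  Ck D k (fun (_ : T) x (_ : R) => horner l x).
Proof.
  induction l as [|c l IH]; [exact (Ck_const D k 0)|].
  apply (Ck_plus D k (fun _ _ _ => c)); [apply Ck_const|].
  apply (Ck_mult D k (fun _ x _ => x)); [apply Ck_fst | exact IH].
Qed.

Lemma shear_Ck (M : R * R -> Prop) r X0 l :
  open M -> Cr_vfield M r X0 ->
  Ck (fun x y => M (x, y)) r (fun mu => vx (shear X0 (horner l) mu)) /\
  Ck (fun x y => M (x, y)) r (fun mu => vy (shear X0 (horner l) mu)).
Proof.
  intros HM HX0.
  assert (HMo : open2 (fun x y => M (x, y))).
  { intros x y Hxy. apply locally_2d_locally. generalize (HM _ Hxy). apply filter_imp.
    intros [u v] H. exact H. }
  assert (Hbase : forall f, (f = vx \/ f = vy) ->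
            Ck (fun x y => M (x, y)) r (fun _ : R => f X0)).
  { intros f Hf. apply ex_diff_n_Ck; [exact HMo| |].
    - intros _ x y Hxy. destruct (HX0 x y Hxy). destruct Hf; subst f; assumption.
    - intros i j Hij mu x y Hxy.
      assert (H := vfield_partial_continuous f M r X0 i j x y Hf HX0 Hxy Hij).
      apply cont3_eps. intros e He. destruct (H (mkposreal e He)) as [d Hd].
      exists d. intros Z u v _ Hu Hv. apply Hd; assumption. }
  split; [apply Hbase; auto|].
  apply (Ck_plus _ r (fun _ => vy X0) (fun mu x _ => mu * horner l x)); [apply Hbase; auto|].
  apply (Ck_mult _ r (fun mu _ _ => mu) (fun _ x _ => horner l x)); [|apply horner_Ck].
  assert (Hc : forall mu x y : R, M (x, y) -> cont3 (fun mu _ _ => mu) mu x y).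
  { intros mu x y _. apply cont3_eps. intros e He. exists (mkposreal e He). intros Z u v HZ _ _.
    exact HZ. }
  destruct r; split; auto.
  exists (fun _ _ _ => 0), (fun _ _ _ => 0).
  split; [|split; [|split; apply Ck_const]]; intros; apply @is_derive_const.
Qed.

(** Here the family is indexed by mu. Compactness of K turns the joint continuity of each partial
    derivative into uniform closeness, and there are finitely many of them. *)
Lemma shear_continuous (M K : R * R -> Prop) r X0 l :
  open M -> Cr_vfield M r X0 -> compact_set K -> (forall p, K p -> M p) ->
  (forall mu, Cr_vfield M r (shear X0 (horner l) mu)) /\
  forall mu e, 0 < e ->
    locally mu (fun mu' => Cr_close K r e (shear X0 (horner l) mu) (shear X0 (horner l) mu')).
Proof.
  intros HM HX0 HK HKM.
  destruct (shear_Ck M r X0 l HM HX0) as [Cx Cy].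
  assert (HMo : open2 (fun x y => M (x, y))).
  { intros x y Hxy. apply locally_2d_locally. generalize (HM _ Hxy). apply filter_imp.
    intros [u v] H. exact H. }
  split.
  { intros mu x y Hxy. split.
    - apply (Ck_ex_diff_n (fun x y => M (x, y)) r (fun mu => vx (shear X0 (horner l) mu))); assumption.
    - apply (Ck_ex_diff_n (fun x y => M (x, y)) r (fun mu => vy (shear X0 (horner l) mu))); assumption. }
  intros mu e He.
  assert (Hone : forall (F : R -> R -> R -> R) i j, (i + j <= r)%nat ->
     Ck (fun x y => M (x, y)) r F ->
     locally mu (fun mu' => forall p, K p ->
       Rabs (partial_derive i j (F mu') (fst p) (snd p) - partial_derive i j (F mu) (fst p) (snd p)) < e)).
  { intros F i j Hij HF.
    destruct (Ck_partial_derive _ r i j F HMo HF Hij) as [g [Hg1 Hg2]].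
    apply (compact_tube K (fun mu' p => Rabs (partial_derive i j (F mu') (fst p) (snd p)
              - partial_derive i j (F mu) (fst p) (snd p)) < e) mu HK).
    intros [x y] Hp. apply HKM in Hp.
    destruct (proj1 (cont3_eps _ _ _ _) (Ck_cont _ _ _ mu _ _ Hg1 Hp) (e / 2) ltac:(lra)) as [d Hd].
    destruct (HMo x y Hp) as [d' Hd'].
    assert (Hm : 0 < Rmin d d') by (apply Rmin_glb_lt; apply cond_pos).
    pose proof (Rmin_l d d'). pose proof (Rmin_r d d').
    exists (mkposreal _ Hm). intros [mu' [u v]] [Hmu [Hu Hv]]. simpl in *.
    change (Rabs (u - x) < Rmin d d') in Hu. change (Rabs (v - y) < Rmin d d') in Hv.
    assert (HMuv : M (u, v)) by (apply Hd'; lra).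
    rewrite !Hg2 by exact HMuv.
    assert (A := Hd mu' u v (ball_le _ _ _ H _ Hmu) ltac:(lra) ltac:(lra)).
    assert (B := Hd mu u v (ball_center _ _) ltac:(lra) ltac:(lra)).
    apply Rabs_def2 in A. apply Rabs_def2 in B. apply Rabs_def1; lra. }
  assert (Hall : locally mu (fun mu' => forall i, (i < S r)%nat -> forall j, (j < S r)%nat ->
     (i + j <= r)%nat -> forall p, K p ->
       Rabs (partial_derive i j (vx (shear X0 (horner l) mu')) (fst p) (snd p)
             - partial_derive i j (vx (shear X0 (horner l) mu)) (fst p) (snd p)) < e /\
       Rabs (partial_derive i j (vy (shear X0 (horner l) mu')) (fst p) (snd p)
             - partial_derive i j (vy (shear X0 (horner l) mu)) (fst p) (snd p)) < e)).
  { apply filter_forall_lt; [apply locally_filter|]. intros i Hi.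
    apply filter_forall_lt; [apply locally_filter|]. intros j Hj.
    destruct (Nat.le_gt_cases (i + j) r) as [Hij|Hij].
    - generalize (filter_and _ _ (Hone (fun mu => vx (shear X0 (horner l) mu)) i j Hij Cx)
                                 (Hone (fun mu => vy (shear X0 (horner l) mu)) i j Hij Cy)).
      apply filter_imp. intros mu' [H1 H2] _ p Hp. split; [apply H1, Hp | apply H2, Hp].
    - apply filter_forall. intros mu' Hij'. lia. }
  revert Hall. apply filter_imp. intros mu' H i j x y Hij Hp.
  exact (H i ltac:(lia) j ltac:(lia) Hij (x, y) Hp).
Qed.

(** * Unfolding directions *)

Lemma chain_jet (g : nat -> R -> R) (e c : R) (m k : nat) :
  0 < e -> (k <= m)%nat ->
  (forall j a, (j < m)%nat -> Rabs a < e -> is_derive (g j) a (g (S j) a)) ->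
  jet e k c (g O) -> (forall j, (j < k)%nat -> g j 0 = 0) /\ g k 0 = c.
Proof.
  intros He. revert g m; induction k as [|k IH]; intros g m Hkm Hg Hj.
  - split; [lia | exact Hj].
  - destruct m as [|m]; [lia|].
    destruct (IH (fun j => g (S j)) m ltac:(lia)) as [H1 H2].
    + intros j a Hjm Ha. apply Hg; [lia|exact Ha].
    + apply jet_derive with (g O); [exact He| |exact Hj]. intros a Ha. apply Hg; [lia|exact Ha].
    + split; [|exact H2]. intros [|j] Hjk; [apply Hj | apply H1; lia].
Qed.

Lemma monomial_chain (k : nat) (c : R) : exists qs : nat -> R -> R,
  (forall a, qs O a = c * a ^ k) /\
  (forall j a, is_derive (qs j) a (qs (S j) a)) /\
  (forall j, qs j 0 = if Nat.eqb j k then c * INR (fact k) else 0).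
Proof.
  revert c; induction k as [|k IH]; intros c.
  - exists (fun j _ => if Nat.eqb j 0 then c else 0). split; [intros; simpl; ring|]. split.
    + intros [|j] a; apply @is_derive_const.
    + intros [|j]; simpl; [ring|reflexivity].
  - destruct (IH (c * INR (S k))) as [qs [H1 [H2 H3]]].
    exists (fun j => match j with O => fun a => c * a ^ S k | S i => qs i end).
    split; [reflexivity|]. split.
    + intros [|j] a; [|apply H2]. rewrite H1.
      assert (H := is_derive_scal (fun x => x ^ S k) a c _
                     (is_derive_pow (fun x => x) (S k) a 1 (is_derive_id a))).
      change (Nat.pred (S k)) with k in H.
      replace (c * INR (S k) * a ^ k) with (c * (INR (S k) * 1 * a ^ k)) by ring. exact H.
    + intros [|j]; [simpl; ring|]. rewrite H3. change (Nat.eqb (S j) (S k)) with (Nat.eqb j k).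
      destruct (Nat.eqb j k); [|reflexivity]. rewrite fact_simpl, mult_INR. ring.
Qed.

Lemma horner_shift c k l : exists l', forall x, horner l' x = c * x ^ k * horner l x.
Proof.
  induction k as [|k [l' Hl']].
  - exists (map (Rmult c) l). intros x. induction l as [|d l IH]; simpl; [ring|].
    rewrite IH. simpl. ring.
  - exists (0 :: l'). intros x. simpl. rewrite Hl'. ring.
Qed.

Section SlopeBelow.
Variables (F F' : R -> R) (e kap : R).
Hypothesis F_der : forall a, Rabs a < e -> is_derive F a (F' a).
Hypothesis F'_near : forall a, Rabs a < e -> Rabs (F' a - kap) < Rabs kap / 2.

Lemma between_ball a b z : Rabs a < e -> Rabs b < e -> Rmin a b <= z <= Rmax a b -> Rabs z < e.
Proof.
  intros Ha Hb Hz. apply Rabs_def2 in Ha. apply Rabs_def2 in Hb.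
  apply Rabs_def1; revert Hz; unfold Rmin, Rmax; destruct Rle_dec; lra.
Qed.

(** Here |F'| >= |kap| / 2. For F the (n-1)-st derivative of G this yields the uniqueness of its
    zero, the continuity of the zero in X and a bound on its displacement. *)
Lemma slope_below a b : Rabs a < e -> Rabs b < e ->
  Rabs kap / 2 * Rabs (b - a) <= Rabs (F b - F a).
Proof.
  intros Ha Hb. destruct (MVT_gen F a b F') as [z [Hz Heq]].
  - intros z Hz. apply F_der, (between_ball a b z); auto; lra.
  - intros z Hz. eapply is_derive_continuity_pt, F_der, (between_ball a b z); auto.
  - rewrite Heq, Rabs_mult. apply Rmult_le_compat_r; [apply Rabs_pos|].
    assert (H := F'_near z (between_ball a b z Ha Hb Hz)).
    assert (H1 := Rabs_triang (F' z) (kap - F' z)).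
    replace (F' z + (kap - F' z)) with kap in H1 by ring.
    rewrite (Rabs_minus_sym kap) in H1. lra.
Qed.

Lemma root_near nu : 0 < nu < e -> Rabs (F 0) < Rabs kap / 2 * nu ->
  exists a, Rabs a < nu /\ F a = 0.
Proof.
  intros Hnu HF0.
  assert (Hc : forall t, continuous (fun t => F (clamp (- nu) nu t)) t).
  { intros t. apply (continuous_comp (clamp (- nu) nu) F); [apply clamp_continuous; lra|].
    eapply is_derive_continuous, F_der.
    assert (H := clamp_in (- nu) nu t ltac:(lra)). apply Rabs_def1; lra. }
  assert (He0 : Rabs 0 < e) by (rewrite Rabs_R0; lra).
  assert (Hen : Rabs nu < e) by (rewrite Rabs_right; lra).
  assert (Hen' : Rabs (- nu) < e) by (rewrite Rabs_Ropp; exact Hen).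
  (* Over a distance nu, F moves by at least |kap| nu / 2, more than |F 0|, in opposite directions
     on the two sides. *)
  assert (Hsides : (F (- nu) < 0 < F nu) \/ (F nu < 0 < F (- nu))).
  { assert (Hmv : forall b, Rabs b < e -> exists z, Rabs z < e /\ F b - F 0 = F' z * b).
    { intros b Hb. destruct (MVT_gen F 0 b F') as [z [Hz Heq]].
      - intros z Hz. apply F_der, (between_ball 0 b z); auto; lra.
      - intros z Hz. eapply is_derive_continuity_pt, F_der, (between_ball 0 b z); auto.
      - exists z. split; [apply (between_ball 0 b z); auto|]. rewrite Heq. ring. }
    destruct (Hmv nu Hen) as [z1 [Hz1 E1]]. destruct (Hmv (- nu) Hen') as [z2 [Hz2 E2]].
    apply F'_near in Hz1. apply F'_near in Hz2.
    apply Rabs_def2 in Hz1. apply Rabs_def2 in Hz2. apply Rabs_def2 in HF0.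
    destruct (Rle_lt_dec 0 kap) as [Hk|Hk].
    - rewrite (Rabs_right kap) in * by lra. left. split; nra.
    - rewrite (Rabs_left kap) in * by lra. right. split; nra. }
  destruct (IVT_gen (fun t => F (clamp (- nu) nu t)) (- nu) nu 0) as [z [Hz Heq]].
  - intros t. apply continuity_pt_filterlim, Hc.
  - rewrite !clamp_id by lra. unfold Rmin, Rmax. destruct Rle_dec; lra.
  - rewrite Rmin_left, Rmax_right in Hz by lra. rewrite clamp_id in Heq by lra.
    exists z. split; [|exact Heq].
    apply Rabs_def1; destruct (Req_dec z nu), (Req_dec z (- nu)); subst; lra.
Qed.

End SlopeBelow.

Section Unfolding.
Variables (n r : nat) (M K : R * R -> Prop) (X0 : vfield) (e2 : R) (He2 : 0 < e2)
  (hX0 : Cr_vfield M r X0).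
Let T : UniformSpace := vfield_ball M K r X0 e2 He2 hX0.
Let Xc : T := vfield_center M K r X0 e2 He2 hX0.
Variables (u : T -> R -> R) (Gs : nat -> T -> R -> R) (e1 e3 c0 kap : R).
Hypothesis hn : (2 <= n)%nat.
Hypothesis hr : (n + 1 <= r)%nat.
Hypothesis hM : open M.
Hypothesis HK : compact_set K.
Hypothesis HKM : forall p, K p -> M p.
Hypothesis He1 : 0 < e1.
Hypothesis He3 : 0 < e3 <= e1.
Hypothesis u_Ck : Ck (fun _ a => Rabs a < e1) (pred r) (fun X _ a => u X a).
Hypothesis u_nz : forall X a, Rabs a < e1 -> u X a <> 0.
Hypothesis Gs_der : forall j X a, (j < r)%nat -> Rabs a < e1 -> is_derive (Gs j X) a (Gs (S j) X a).
Hypothesis Gs_1 : forall (X : T) a, Rabs a < e1 -> Gs 1 X a = vy (proj1_sig X) a 0 * u X a.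
Hypothesis X0_jet : jet e1 (n - 1) c0 (fun a => vy X0 a 0).
Hypothesis kap_nz : kap <> 0.
Hypothesis near : locally Xc (fun X => forall a, Rabs a < e3 ->
  Rabs (Gs n X a - kap) < Rabs kap / 2 /\
  forall j, (j < n)%nat -> (1 <= j)%nat -> Rabs (Gs j X a) < 1 / 4).

(** Ideally the shear adds mu i x^(i-1) to G', that is mu x^i to G. The errors are the shift of the
    base point from 0 to a, costing |a| / 4 with |a| <= |mu| / 4, and the change of u with the
    field, costing |mu| / 8; together at most |mu| / 4. The zero [a] is arbitrary, so no choice of
    it is involved. *)
Lemma unfolding_direction i : (1 <= i <= n - 2)%nat ->
  exists l, locally 0 (fun mu : R => forall Z : T, proj1_sig Z = shear X0 (horner l) mu ->
    forall a, Rabs a < e3 -> Gs (n - 1) Z a = 0 ->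
    forall j, (1 <= j <= n - 2)%nat ->
      Rabs (Gs j Z a / INR (fact j) - (if Nat.eqb i j then mu else 0)) <= Rabs mu / 4).
Proof.
  intros Hi.
  assert (Hz0 : Rabs 0 < e1) by (rewrite Rabs_R0; exact He1).
  destruct (horner_inverse e1 (n - 2) (u Xc)) as [p Hp]; [exact He1| |apply u_nz, Hz0|].
  { apply (Ck_smooth (fun _ a => Rabs a < e1) (n - 2) (fun X _ a => u X a) Xc 0); [auto|].
    apply Ck_le with (pred r); [lia|exact u_Ck]. }
  destruct (horner_shift (INR i) (i - 1) p) as [l Hl].
  exists l.
  assert (H_Ck : Ck (fun _ a => Rabs a < e1) (pred r) (fun (X : T) (_ : R) a => horner l a * u X a)).
  { apply Ck_mult; [|exact u_Ck].
    apply (Ck_comp _ (fun _ _ => True) (pred r) (fun _ x _ => horner l x) (fun _ _ a => a)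
      (fun _ _ a => a)); auto using open2_True, Ck_snd, horner_Ck. }
  destruct (Ck_seq _ (pred r) _ 0 e1 (fun a Ha => Ha) H_Ck) as [Hs [Hs0 [Hs_der Hs_cont]]].
  (* At X0 the function horner l * u differs from i x^(i-1) by (p u - 1) i x^(i-1), which is flat to
     order n - 2 by the choice of p. *)
  assert (Hs_center : forall j, (j <= n - 2)%nat ->
            Hs j Xc 0 = if Nat.eqb j (i - 1) then INR (fact i) else 0).
  { destruct (monomial_chain (i - 1) (INR i)) as [qs [Q1 [Q2 Q3]]].
    assert (Hd : jet e1 (n - 2) 0 (fun a => Hs O Xc a - qs O a)).
    { apply (jet_ext e1 He1 _ _ (fun a => (horner p a * u Xc a - 1) * (INR i * a ^ (i - 1)))).
      - intros a _. rewrite Hs0, Q1, Hl. ring.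
      - replace 0 with (0 * (INR i * 0 ^ (i - 1))) by ring.
        apply (jet_mult e1 (n - 2) 0 (fun a => horner p a * u Xc a - 1)
                 (fun a => INR i * a ^ (i - 1)) Hp).
        destruct (horner_monomial (INR i) (i - 1)) as [l1 Hl1].
        apply (smooth_ext e1 (n - 2) (horner l1)); [intros; apply Hl1|].
        apply (Ck_smooth (fun _ _ => True) (n - 2) (fun (_ : T) (_ : R) a => horner l1 a) Xc 0);
          [auto|].
        apply (Ck_comp _ (fun _ _ => True) (n - 2) (fun _ x _ => horner l1 x) (fun _ _ a => a)
          (fun _ _ a => a)); auto using open2_True, Ck_snd, horner_Ck. }
    destruct (chain_jet (fun j a => Hs j Xc a - qs j a) e1 0 (pred r) (n - 2) He1 ltac:(lia))
      as [J1 J2]; [|exact Hd|].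
    { intros j a Hj Ha. apply (is_derive_minus (Hs j Xc) (qs j)); [apply Hs_der; assumption | apply Q2]. }
    intros j Hj.
    assert (E : Hs j Xc 0 - qs j 0 = 0).
    { destruct (Nat.eq_dec j (n - 2)) as [->|]; [exact J2 | apply J1; lia]. }
    rewrite Q3 in E. destruct (Nat.eqb j (i - 1)); [|lra].
    replace (INR (fact i)) with (INR i * INR (fact (i - 1))); [lra|].
    destruct i as [|i']; [lia|]. replace (S i' - 1)%nat with i' by lia.
    rewrite fact_simpl, mult_INR. reflexivity. }
  (* The bound 1/8 is for the coefficients; |kap| / 8 gives |a| <= |mu| / 4 after division by the
     slope |kap| / 2. *)
  set (d1 := Rmin (1 / 8) (Rabs kap / 8)).
  assert (Hkap : 0 < Rabs kap) by (apply Rabs_pos_lt, kap_nz).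
  assert (Hd1 : 0 < d1) by (apply Rmin_glb_lt; lra).
  assert (Hd11 : d1 <= 1 / 8) by apply Rmin_l. assert (Hd12 : d1 <= Rabs kap / 8) by apply Rmin_r.
  assert (Hs_near : locally Xc (fun X => forall j, (j < n - 1)%nat -> Rabs (Hs j X 0 - Hs j Xc 0) < d1)).
  { apply filter_forall_lt; [apply locally_filter|]. intros j Hj.
    destruct (proj1 (cont2_eps _ _ _) (Hs_cont j Xc 0 ltac:(lia) Hz0) d1 Hd1) as [d Hd].
    exists d. intros Y HY. apply Hd; [exact HY|]. rewrite Rminus_diag, Rabs_R0. apply cond_pos. }
  destruct (filter_and _ _ near Hs_near) as [d Hd].
  destruct (shear_continuous M K r X0 l hM hX0 HK HKM) as [_ Hshear].
  generalize (Hshear 0 d (cond_pos d)). apply filter_imp. intros mu Hmu Z HZ a Ha Hroot j Hj.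
  rewrite shear_zero in Hmu.
  destruct (Hd Z) as [HnearZ HsZ].
  { change (Cr_close K r d X0 (proj1_sig Z)). rewrite HZ. exact Hmu. }
  assert (Hz3 : Rabs 0 < e3) by (rewrite Rabs_R0; lra).
  (* The part of the derivative of G due to X0 itself is flat of order n - 1. *)
  assert (HG0 : forall k, (k <= n - 2)%nat -> Gs (S k) Z 0 = mu * Hs k Z 0).
  { destruct (chain_jet (fun k b => Gs (S k) Z b - mu * Hs k Z b) e1 (c0 * u Z 0) (pred r) (n - 1)
      He1 ltac:(lia)) as [J1 _].
    - intros k b Hk Hb. apply (is_derive_minus (Gs (S k) Z) (fun b => mu * Hs k Z b)).
      + apply Gs_der; [lia|exact Hb].
      + apply (is_derive_scal (Hs k Z)). apply Hs_der; assumption.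
    - apply (jet_ext e1 He1 _ _ (fun b => vy X0 b 0 * u Z b)).
      + intros b Hb. rewrite Gs_1, Hs0, HZ by exact Hb. simpl. ring.
      + apply (jet_mult e1 (n - 1) c0 (fun b => vy X0 b 0) (u Z) X0_jet).
        apply (Ck_smooth (fun _ a => Rabs a < e1) (n - 1) (fun X _ a => u X a) Z 0); [auto|].
        apply Ck_le with (pred r); [lia|exact u_Ck].
    - intros k Hk. specialize (J1 k ltac:(lia)). simpl in J1. lra. }
  assert (Ha_small : Rabs a <= Rabs mu / 4).
  { assert (Hder : forall b, Rabs b < e3 -> is_derive (Gs (n - 1) Z) b (Gs n Z b)).
    { intros b Hb. assert (H := Gs_der (n - 1) Z b ltac:(lia) ltac:(lra)).
      replace (S (n - 1)) with n in H by lia. exact H. }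
    assert (H := slope_below (Gs (n - 1) Z) (Gs n Z) e3 kap Hder
              (fun b Hb => proj1 (HnearZ b Hb)) 0 a Hz3 Ha).
    rewrite Hroot, Rminus_0_r, Rminus_0_l, Rabs_Ropp in H.
    replace (n - 1)%nat with (S (n - 2)) in H by lia.
    rewrite HG0, Rabs_mult in H by lia.
    assert (Hb := HsZ (n - 2)%nat ltac:(lia)). rewrite Hs_center in Hb by lia.
    (* As i <= n - 2, the direction has no component on the (n-1)-st derivative of G at X0, so the
       zero barely moves. *)
    replace (Nat.eqb (n - 2) (i - 1)) with false in Hb by (symmetry; apply Nat.eqb_neq; lia).
    rewrite Rminus_0_r in Hb.
    assert (Rabs mu * Rabs (Hs (n - 2)%nat Z 0) <= Rabs mu * (Rabs kap / 8)).
    { apply Rmult_le_compat_l; [apply Rabs_pos|lra]. }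
    apply Rmult_le_reg_l with (Rabs kap / 2); lra. }
  assert (Hmain : Rabs (Gs j Z a - mu * Hs (j - 1)%nat Xc 0) <= Rabs mu / 4).
  { assert (Hstep : Rabs (Gs j Z a - Gs j Z 0) <= 1 / 4 * Rabs a).
    { destruct (MVT_gen (Gs j Z) 0 a (Gs (S j) Z)) as [z [Hz Heq]].
      - intros z Hz. apply Gs_der; [lia|].
        assert (H := between_ball e3 0 a z Hz3 Ha ltac:(lra)). lra.
      - intros z Hz. eapply is_derive_continuity_pt, Gs_der; [lia|].
        assert (H := between_ball e3 0 a z Hz3 Ha Hz). lra.
      - rewrite Heq, Rminus_0_r, Rabs_mult. apply Rmult_le_compat_r; [apply Rabs_pos|].
        left. apply HnearZ; [apply (between_ball e3 0 a z); auto|lia|lia]. }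
    assert (E := HG0 (j - 1)%nat ltac:(lia)). replace (S (j - 1)) with j in E by lia.
    replace (Gs j Z a - mu * Hs (j - 1)%nat Xc 0) with
      ((Gs j Z a - Gs j Z 0) + mu * (Hs (j - 1)%nat Z 0 - Hs (j - 1)%nat Xc 0)) by (rewrite E; ring).
    eapply Rle_trans; [apply Rabs_triang|]. rewrite Rabs_mult.
    assert (Hb := HsZ (j - 1)%nat ltac:(lia)).
    assert (Rabs mu * Rabs (Hs (j - 1)%nat Z 0 - Hs (j - 1)%nat Xc 0) <= Rabs mu * (1 / 8)).
    { apply Rmult_le_compat_l; [apply Rabs_pos|lra]. }
    pose proof (Rabs_pos mu). lra. }
  assert (Hfact : 1 <= INR (fact j)).
  { replace 1 with (INR 1) by reflexivity. apply le_INR, lt_O_fact. }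
  rewrite Hs_center in Hmain by lia.
  replace (Gs j Z a / INR (fact j) - (if Nat.eqb i j then mu else 0)) with
    ((Gs j Z a - mu * (if Nat.eqb (j - 1) (i - 1) then INR (fact i) else 0)) * / INR (fact j)).
  - rewrite Rabs_mult, (Rabs_right (/ INR (fact j))).
    2:{ apply Rle_ge. left. apply Rinv_0_lt_compat. lra. }
    apply Rle_trans with (Rabs mu / 4 * 1).
    + apply Rmult_le_compat; [apply Rabs_pos | left; apply Rinv_0_lt_compat; lra | exact Hmain |].
      rewrite <- Rinv_1. apply Rinv_le_contravar; lra.
    + right; ring.
  - destruct (Nat.eqb_spec i j) as [->|Hij].
    + rewrite Nat.eqb_refl. field. lra.
    + replace (Nat.eqb (j - 1) (i - 1)) with false by (symmetry; apply Nat.eqb_neq; lia).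
      field. lra.
Qed.

End Unfolding.

(** * The normal form *)

Lemma Cr_ball_open M K r X0 e X : Cr_ball M K r X0 e X ->
  exists d, 0 < d /\ forall Y, Cr_vfield M r Y -> Cr_close K r d X Y -> Cr_ball M K r X0 e Y.
Proof.
  intros [HX [e' [He' Hcl]]]. exists ((e - e') / 2). split; [lra|].
  intros Y HY HXY. split; [exact HY|]. exists (e' + (e - e') / 2). split; [lra|].
  apply Cr_close_trans with X; assumption.
Qed.

(** Passes from the uniform space on the ball back to the topology of the statement; the ball being
    open, every field close enough to Z carries a membership proof. *)
Lemma locally_Cr_nbhs (M K : R * R -> Prop) (r : nat) (X0 : vfield) (e : R) (He : 0 < e)
    (hX0 : Cr_vfield M r X0) (Z : vfield_ball M K r X0 e He hX0)
    (P : vfield_ball M K r X0 e He hX0 -> Prop) :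
  compact_set K -> (forall p, K p -> M p) -> locally Z P ->
  Cr_nbhs M r (proj1_sig Z) (fun Y => exists H : Cr_ball M K r X0 e Y, P (exist _ Y H)).
Proof.
  intros HK HKM [d Hd]. destruct (Cr_ball_open M K r X0 e (proj1_sig Z) (proj2_sig Z)) as [d' [Hd' H']].
  exists K, (Rmin d d'). split; [exact HK|]. split; [exact HKM|].
  split; [apply Rmin_glb_lt; [apply cond_pos|exact Hd']|].
  intros Y HY HZY.
  assert (H : Cr_ball M K r X0 e Y).
  { apply H'; [exact HY|]. apply Cr_close_le with (Rmin d d'); [apply Rmin_r | exact HZY]. }
  exists H. apply Hd. change (Cr_close K r d (proj1_sig Z) Y).
  apply Cr_close_le with (Rmin d d'); [apply Rmin_l | exact HZY].
Qed.

(** Taylor's formula at a has no term of degree n - 1 since that derivative vanishes there.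
    Replacing a + x by h(x) changes the argument by |a| |x / eps|^(2N), which is O(x^(n+1)) because
    2N >= n + 1. *)
Lemma normal_form_expansion (G : nat -> R -> R) (n N : nat) (e3 eps a : R) :
  (2 <= n)%nat -> (n + 1 <= 2 * N)%nat -> 0 < eps -> Rabs a < e3 ->
  (forall j b, (j < S n)%nat -> Rabs b < e3 -> is_derive (G j) b (G (S j) b)) ->
  continuous (G (S n)) a -> G (n - 1)%nat a = 0 ->
  (forall b, Rabs b < e3 -> Rabs (G 1%nat b) < 1 / 4) ->
  exists C, locally 0 (fun x =>
    Rabs (G O (x + a * (1 - (x / eps) ^ (2 * N))) -
          (G O a / INR (fact 0) + G n a / INR (fact n) * x ^ n +
           sum_n_m (fun i => G i a / INR (fact i) * x ^ i) 1 (n - 2))) <= C * Rabs x ^ (n + 1)).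
Proof.
  intros Hn HN He Ha HG Hc Hroot HG1.
  destruct (proj1 (continuous_R _ _) Hc 1 Rlt_0_1) as [d Hd]. assert (Hd0 := cond_pos d).
  set (B := Rabs (G (S n) a) + 1).
  set (e' := Rmin d (e3 - Rabs a)).
  assert (He' : 0 < e') by (apply Rmin_glb_lt; lra).
  assert (He'1 : e' <= d) by apply Rmin_l. assert (He'2 : e' <= e3 - Rabs a) by apply Rmin_r.
  assert (Hin : forall b, Rabs b < e' -> Rabs (a + b) < e3).
  { intros b Hb. eapply Rle_lt_trans; [apply Rabs_triang|]. lra. }
  assert (Htaylor := taylor_bound e' B n (fun j b => G j (a + b))).
  set (C2 := Rabs a * (/ eps) ^ (2 * N)).
  exists (B + C2).
  set (h := fun x => x + a * (1 - (x / eps) ^ (2 * N))).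
  assert (Hh0 : h 0 = a).
  { unfold h, Rdiv. rewrite Rmult_0_l, pow_i by lia. ring. }
  assert (Hhc : continuous h 0).
  { apply continuity_pt_filterlim. unfold h. apply derivable_continuous_pt.
    exists (1 + a * (0 - INR (2 * N) * / eps * (0 / eps) ^ pred (2 * N))). apply is_derive_Reals.
    assert (H1 : is_derive (fun x => x / eps) 0 (/ eps)).
    { apply is_derive_ext with (fun x => / eps * x); [intros t; apply Rmult_comm|].
      apply is_derive_linear. }
    assert (H2 := is_derive_pow (fun x => x / eps) (2 * N) 0 (/ eps) H1).
    apply (is_derive_plus (fun x => x) (fun x => a * (1 - (x / eps) ^ (2 * N))));
      [apply @is_derive_id|].
    apply (is_derive_scal (fun x => 1 - (x / eps) ^ (2 * N))).
    apply (is_derive_minus (fun _ => 1) (fun x => (x / eps) ^ (2 * N)));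
      [apply @is_derive_const | exact H2]. }
  assert (Hh_near : locally 0 (fun x => Rabs (h x) < e3)).
  { generalize (proj1 (continuous_R _ _) Hhc (e3 - Rabs a) ltac:(lra)). apply filter_imp.
    intros x Hx. rewrite Hh0 in Hx. replace (h x) with (a + (h x - a)) by ring.
    eapply Rle_lt_trans; [apply Rabs_triang|]. lra. }
  assert (Hx_near : locally 0 (fun x => Rabs x < Rmin e' 1)).
  { assert (Hm : 0 < Rmin e' 1) by (apply Rmin_glb_lt; lra).
    exists (mkposreal _ Hm). intros x Hx. change (Rabs (x - 0) < Rmin e' 1) in Hx.
    rewrite Rminus_0_r in Hx. exact Hx. }
  generalize (filter_and _ _ Hh_near Hx_near). apply filter_imp. intros x [Hhx Hx].
  assert (Hx1 : Rabs x < e') by (pose proof (Rmin_l e' 1); lra).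
  assert (Hx2 : Rabs x < 1) by (pose proof (Rmin_r e' 1); lra).
  assert (Hax := Hin x Hx1).
  assert (A1 : Rabs (G O (h x) - G O (a + x)) <= C2 * Rabs x ^ (n + 1)).
  { assert (Hbb : forall z, Rmin (a + x) (h x) <= z <= Rmax (a + x) (h x) -> Rabs z < e3)
      by (intros z; apply between_ball; assumption).
    destruct (MVT_gen (G O) (a + x) (h x) (G 1%nat)) as [z [Hz Heq]].
    - intros z Hz. apply HG; [lia|]. apply Hbb. lra.
    - intros z Hz. eapply is_derive_continuity_pt, HG; [lia|]. apply Hbb, Hz.
    - rewrite Heq, Rabs_mult.
      replace (h x - (a + x)) with (- (a * (x / eps) ^ (2 * N))) by (unfold h; ring).
      rewrite Rabs_Ropp, Rabs_mult. unfold Rdiv. rewrite Rpow_mult_distr, Rabs_mult.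
      assert (Hie : 0 < / eps) by (apply Rinv_0_lt_compat, He).
      rewrite (Rabs_right ((/ eps) ^ (2 * N))) by (apply Rle_ge, pow_le; lra).
      rewrite <- RPow_abs.
      assert (Hp : Rabs x ^ (2 * N) <= Rabs x ^ (n + 1)).
      { replace (2 * N)%nat with ((n + 1) + (2 * N - (n + 1)))%nat by lia. rewrite pow_add.
        rewrite <- (Rmult_1_r (Rabs x ^ (n + 1))) at 2.
        apply Rmult_le_compat_l; [apply pow_le, Rabs_pos|].
        rewrite <- (pow1 (2 * N - (n + 1))). apply pow_incr. split; [apply Rabs_pos|lra]. }
      assert (Hz1 := HG1 z (Hbb z Hz)).
      assert (0 <= Rabs a * (/ eps) ^ (2 * N)).
      { apply Rmult_le_pos; [apply Rabs_pos | apply pow_le; lra]. }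
      assert (0 <= Rabs x ^ (2 * N)) by apply pow_le, Rabs_pos.
      unfold C2. replace (Rabs (G 1%nat z) * (Rabs a * (Rabs x ^ (2 * N) * (/ eps) ^ (2 * N)))) with
        (Rabs (G 1%nat z) * ((Rabs a * (/ eps) ^ (2 * N)) * Rabs x ^ (2 * N))) by ring.
      apply Rle_trans with (1 * ((Rabs a * (/ eps) ^ (2 * N)) * Rabs x ^ (2 * N))).
      + apply Rmult_le_compat_r; [apply Rmult_le_pos; assumption|lra].
      + rewrite Rmult_1_l. apply Rmult_le_compat_l; assumption. }
  assert (A2 : Rabs (G O (a + x) - sum_n (fun i => G i (a + 0) / INR (fact i) * x ^ i) n)
                <= B * Rabs x ^ S n).
  { apply Htaylor; [| |exact Hx1].
    - intros j b Hj Hb.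
      assert (H := is_derive_comp (G j) (fun b => a + b) b _ 1 (HG j (a + b) Hj (Hin b Hb))).
      replace (G (S j) (a + b)) with (1 * G (S j) (a + b)) by ring. apply H.
      replace 1 with (0 + 1) by ring.
      apply (is_derive_plus (fun _ => a) (fun b => b)); [apply @is_derive_const | apply @is_derive_id].
    - intros b Hb. assert (H := Hd (a + b)).
      assert (Hball : ball a d (a + b)).
      { change (Rabs ((a + b) - a) < d). replace (a + b - a) with b by ring. lra. }
      specialize (H Hball). unfold B.
      replace (G (S n) (a + b)) with (G (S n) a + (G (S n) (a + b) - G (S n) a)) by ring.
      eapply Rle_trans; [apply Rabs_triang|]. lra. }
  assert (Hsum : sum_n (fun i => G i (a + 0) / INR (fact i) * x ^ i) n =
    G O a / INR (fact 0) + G n a / INR (fact n) * x ^ n +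
           sum_n_m (fun i => G i a / INR (fact i) * x ^ i) 1 (n - 2)).
  { rewrite Rplus_0_r.
    destruct n as [|[|m]]; [lia|lia|]. replace (S (S m) - 2)%nat with m by lia.
    replace (S (S m) - 1)%nat with (S m) in Hroot by lia.
    rewrite !sum_Sn. rewrite Hroot.
    assert (E : sum_n (fun i => G i a / INR (fact i) * x ^ i) m =
      G O a / INR (fact 0) * x ^ 0 + sum_n_m (fun i => G i a / INR (fact i) * x ^ i) 1 m).
    { unfold sum_n. rewrite sum_Sn_m by lia. reflexivity. }
    rewrite E. unfold plus; simpl. unfold Rdiv. ring. }
  fold (h x). rewrite <- Hsum. rewrite Nat.add_1_r in A1 |- *.
  replace (G O (h x) - sum_n (fun i => G i (a + 0) / INR (fact i) * x ^ i) n) with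
    ((G O (h x) - G O (a + x)) +
     (G O (a + x) - sum_n (fun i => G i (a + 0) / INR (fact i) * x ^ i) n)) by ring.
  eapply Rle_trans; [apply Rabs_triang|]. lra.
Qed.

Lemma sign_opp_mul (dl kap b : R) (n : nat) :
  dl = 1 \/ dl = -1 -> kap * (dl ^ n * b) < 0 -> sign kap = - dl ^ n * sign b.
Proof.
  intros Hdl H.
  assert (Hp : dl ^ n = 1 \/ dl ^ n = -1).
  { clear H. induction n as [|n IH]; [left; reflexivity|]. simpl.
    destruct IH as [E'|E']; rewrite E'; destruct Hdl as [E|E]; rewrite E; lra. }
  destruct (Rtotal_order kap 0) as [Hk|[Hk|Hk]]; [| subst kap; lra |];
  destruct (Rtotal_order b 0) as [Hb|[Hb|Hb]]; try (subst b; lra);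
  destruct Hp as [E|E]; rewrite E in H |- *;
  rewrite ?(sign_eq_m1 kap), ?(sign_eq_1 kap), ?(sign_eq_m1 b), ?(sign_eq_1 b) by assumption;
  try lra; exfalso; nra.
Qed.

Theorem theorem2 (n r : nat) (M V : R * R -> Prop) (X0 : vfield)
    (delta T0 sigma s x0 y0 : R)
    (hn : (2 <= n)%nat) (hr : (n + 1 <= r)%nat)
    (hM : open M) (hX0 : Cr_vfield M r X0)
    (hcontact : multiplicity_contact M X0 n (0, 0))
    (hdelta : delta = sign (vx X0 0 0))
    (hV : open V) (hVO : V (0, 0)) (hVM : forall p, V p -> M p)
    (hVX0 : forall x y : R, V (x, y) -> vx X0 x y <> 0)
    (hA : condition_A M V X0 T0 sigma s (x0, y0)) :
  exists rho0 : R, 0 < rho0 /\ forall rho : R, 0 < rho < rho0 ->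
  exists eps0 : R, 0 < eps0 /\ forall eps : R, 0 < eps < eps0 ->
  (forall q, section x0 y0 eps q -> V q /\ side M s q) ->
  exists (U0 : vfield -> Prop) (eta : R) (lambda : nat -> vfield -> R),
    Cr_open M r U0 /\ U0 X0 /\ 0 < eta /\
    (forall i : nat, (1 <= i <= n - 2)%nat ->
       (forall X, U0 X -> - eta < lambda i X < eta) /\
       (forall v : R, - eta < v < eta -> exists X, U0 X /\ lambda i X = v)) /\
    (forall i : nat, (i <= n - 2)%nat -> forall X, U0 X ->
       filterlim (lambda i) (within U0 (Cr_nbhs M r X)) (locally (lambda i X))) /\
    forall X, U0 X ->
      exists (T : R * R -> R * R) (h : R -> R * R) (kappa : R),
        full_transition_map M X (sigma * T0) rho eps (section x0 y0 eps) T /\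
        Cr_diffeo r eps h /\
        (forall x : R, - eps < x < eps -> fst (T (h x)) = x0) /\
        (exists C : R, locally 0 (fun x : R =>
           Rabs (snd (T (h x)) -
                 (lambda 0%nat X + kappa * x ^ n +
                  sum_n_m (fun i => lambda i X * x ^ i) 1 (n - 2)))
           <= C * Rabs x ^ (n + 1))) /\
        lambda 0%nat X = snd (T (h 0)) /\
        (multiplicity_contact M X n (0, 0) -> lambda 0%nat X = snd (T (0, 0))) /\
        sign kappa = - delta ^ n * sign (lie_iter X n height 0 0).
Proof.
  destruct (transition_family r M V X0 delta T0 sigma s x0 y0 ltac:(lia) hX0 hM hdelta hVO hVM hVX0 hA)
    as [Hdl [K [e2 [He2 [HK [HKM [G [u [W [e1 [rho0 [He1 [Hrho0 [HW [HWM [HWa [vx_Ck [vy_Ck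
       [G_Ck [u_Ck [HGu [HGc Htrans]]]]]]]]]]]]]]]]]]]]]].
  set (T := vfield_ball M K r X0 e2 He2 hX0) in *.
  set (Xc := vfield_center M K r X0 e2 He2 hX0) in *.
  assert (Hz1 : Rabs 0 < e1) by (rewrite Rabs_R0; exact He1).
  assert (u_nz : forall X a, Rabs a < e1 -> u X a <> 0).
  { intros X a Ha H0. destruct (HGu X a Ha) as [_ [H _]]. rewrite H0 in H. lra. }
  assert (vx_nz : forall X : T, vx (proj1_sig X) 0 0 <> 0).
  { intros X H0. destruct (HGu X 0 Hz1) as [_ [_ H]]. rewrite H0 in H. lra. }
  destruct (Ck_seq _ r _ 0 e1 (fun a Ha => Ha) G_Ck) as [Gs [Gs_0 [Gs_der Gs_cont]]].
  assert (Gs_1 : forall (X : T) a, Rabs a < e1 -> Gs 1%nat X a = vy (proj1_sig X) a 0 * u X a).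
  { intros X a Ha. destruct (HGu X a Ha) as [H _].
    rewrite <- (is_derive_unique _ _ _ (Gs_der O X a ltac:(lia) Ha)).
    apply is_derive_unique. apply is_derive_ext with (G X); [|exact H].
    intros b. symmetry. apply Gs_0. }
  assert (u_smooth : forall X k, (k <= pred r)%nat -> smooth e1 k (u X)).
  { intros X k Hk. apply (Ck_smooth (fun _ a => Rabs a < e1) k (fun X _ a => u X a) X 0); [auto|].
    apply Ck_le with (pred r); assumption. }
  (* Applied to X0 for the flatness of G, and at the end to any X with the same contact, to show
     that its zero is the origin. *)
  assert (Hcontact : forall X : T, multiplicity_contact M (proj1_sig X) n (0, 0) ->
     exists c, jet e1 (n - 1) c (fun a => vy (proj1_sig X) a 0) /\
       lie_iter (proj1_sig X) n height 0 0 = c * vx (proj1_sig X) 0 0 ^ (n - 1) /\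
       (forall j, (1 <= j <= n - 1)%nat -> Gs j X 0 = 0) /\ Gs n X 0 = c * u X 0).
  { intros X HX.
    destruct (contact_jet (fun X : T => proj1_sig X) W r e1 HW He1 HWa vx_Ck vy_Ck X M n
                ltac:(lia) ltac:(lia) (vx_nz X) HX) as [c [Hc1 Hc2]].
    exists c. split; [exact Hc1|]. split; [exact Hc2|].
    destruct (chain_jet (fun j => Gs (S j) X) e1 (c * u X 0) (pred r) (n - 1) He1 ltac:(lia)) as [J1 J2].
    - intros j a Hj Ha. apply Gs_der; [lia|exact Ha].
    - apply (jet_ext e1 He1 _ _ (fun a => vy (proj1_sig X) a 0 * u X a)).
      + intros a Ha. symmetry. apply Gs_1, Ha.
      + apply (jet_mult e1 (n - 1) c (fun a => vy (proj1_sig X) a 0) (u X) Hc1).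
        apply u_smooth. lia.
    - split.
      + intros [|j] Hj; [lia|]. apply J1. lia.
      + replace (S (n - 1)) with n in J2 by lia. exact J2. }
  destruct (Hcontact Xc hcontact) as [c0 [X0_jet [Hlie0 [Gs_flat Gs_n]]]].
  set (kap := Gs n Xc 0) in *.
  assert (Hlie_nz : lie_iter X0 n height 0 0 <> 0) by apply hcontact.
  change (proj1_sig Xc) with X0 in *.
  assert (Hc0 : c0 <> 0).
  { intros H0. apply Hlie_nz. change (lie_iter X0 n height 0 0 = c0 * vx X0 0 0 ^ (n - 1)) in Hlie0.
    rewrite Hlie0, H0. ring. }
  assert (kap_nz : kap <> 0).
  { rewrite Gs_n. apply Rmult_integral_contrapositive_currified; [exact Hc0|apply u_nz, Hz1]. }
  assert (Hkap : 0 < Rabs kap) by (apply Rabs_pos_lt, kap_nz).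
  (* With kap = c u and X^n h = c P^(n-1), the product is c^2 (delta u) (delta P)^(n-1), where delta
     u < 0 < delta P. *)
  assert (Hsign0 : kap * (delta ^ n * lie_iter X0 n height 0 0) < 0).
  { change (lie_iter X0 n height 0 0 = c0 * vx X0 0 0 ^ (n - 1)) in Hlie0.
    destruct (HGu Xc 0 Hz1) as [_ [H1 H2]]. change (0 < delta * vx X0 0 0) in H2.
    rewrite Gs_n, Hlie0.
    assert (Hp : 0 < (delta * vx X0 0 0) ^ (n - 1)) by (apply pow_lt, H2).
    rewrite Rpow_mult_distr in Hp.
    replace (delta ^ n) with (delta * delta ^ (n - 1)).
    2:{ replace n with (S (n - 1)) at 2 by lia. reflexivity. }
    replace (c0 * u Xc 0 * (delta * delta ^ (n - 1) * (c0 * vx X0 0 0 ^ (n - 1)))) with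
      ((c0 * c0) * ((delta * u Xc 0) * (delta ^ (n - 1) * vx X0 0 0 ^ (n - 1)))) by ring.
    assert (0 < c0 * c0) by nra.
    assert ((delta * u Xc 0) * (delta ^ (n - 1) * vx X0 0 0 ^ (n - 1)) < 0) by nra. nra. }
  set (Near := fun (e3 : R) (X : T) => forall a, Rabs a < e3 ->
    Rabs (Gs n X a - kap) < Rabs kap / 2 /\
    forall j, (j < n)%nat -> (1 <= j)%nat -> Rabs (Gs j X a) < 1 / 4).
  assert (Hbox : exists e3, 0 < e3 <= e1 /\ locally Xc (Near e3)).
  { assert (H : locally ((Xc, 0) : T * R) (fun q =>
      Rabs (Gs n (fst q) (snd q) - kap) < Rabs kap / 2 /\
      forall j, (j < n)%nat -> (1 <= j)%nat -> Rabs (Gs j (fst q) (snd q)) < 1 / 4)).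
    { apply filter_and.
      - assert (C := Gs_cont n Xc 0 ltac:(lia) Hz1). unfold cont2 in C. rewrite continuous_R in C.
        apply (C (Rabs kap / 2)). lra.
      - apply filter_forall_lt; [apply locally_filter|]. intros j Hj.
        destruct (Nat.eq_dec j 0) as [->|Hj0].
        { apply filter_forall. intros q Hq. lia. }
        assert (C := Gs_cont j Xc 0 ltac:(lia) Hz1). unfold cont2 in C. rewrite continuous_R in C.
        generalize (C (1 / 4) ltac:(lra)). apply filter_imp. intros q Hq _.
        cbv beta in Hq. simpl fst in Hq. simpl snd in Hq.
        change (Rabs (Gs j (fst q) (snd q) - Gs j Xc 0) < 1 / 4) in Hq.
        rewrite Gs_flat, Rminus_0_r in Hq by lia. exact Hq. }
    destruct H as [d Hd]. assert (Hd0 := cond_pos d).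
    exists (Rmin d e1). split; [split; [apply Rmin_glb_lt; lra|apply Rmin_r]|].
    exists d. intros X HX a Ha. apply (Hd (X, a)). split; [exact HX|].
    change (Rabs (a - 0) < d). rewrite Rminus_0_r. pose proof (Rmin_l d e1). lra. }
  destruct Hbox as [e3 [He3 Hnear]].
  assert (Hz3 : Rabs 0 < e3) by (rewrite Rabs_R0; lra).
  exists rho0. split; [exact Hrho0|]. intros rho Hrho.
  destruct (Htrans rho Hrho) as [e' [He' Htrans']].
  exists (Rmin e3 e'). split; [apply Rmin_glb_lt; lra|]. intros eps Heps _.
  assert (Heps3 : eps < e3) by (pose proof (Rmin_l e3 e'); lra).
  assert (Heps' : eps < e') by (pose proof (Rmin_r e3 e'); lra).
  (* Any N with 2N >= n + 1 would do; the exponent 2N is even, as the fixed end points require. *)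
  set (N := (n + 1)%nat).
  assert (HNpos := pos_INR (2 * N)).
  (* A zero smaller than nu satisfies |a| 2N < eps, the condition for [translation_diffeo]. *)
  set (nu := Rmin (e3 / 2) (eps / (INR (2 * N) + 1))).
  assert (Hnu : 0 < nu) by (apply Rmin_glb_lt; [lra | apply Rdiv_lt_0_compat; lra]).
  assert (Hnu3 : nu < e3).
  { assert (nu <= e3 / 2) by apply Rmin_l. lra. }
  assert (HnuN : forall a, Rabs a < nu -> Rabs a * INR (2 * N) < eps).
  { intros a Ha. assert (H : nu <= eps / (INR (2 * N) + 1)) by apply Rmin_r.
    apply Rle_lt_trans with (eps / (INR (2 * N) + 1) * INR (2 * N)).
    - apply Rmult_le_compat_r; lra.
    - apply Rlt_le_trans with (eps / (INR (2 * N) + 1) * (INR (2 * N) + 1)); [|right; field; lra].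
      apply Rmult_lt_compat_l; [apply Rdiv_lt_0_compat; lra|lra]. }
  (* In order: a steep (n-1)-st derivative and small lower ones, existence of a zero within nu,
     images in the section (eps/2 at 0 plus a slope below 1/4), the sign of X^n h, and the
     identification of G with the transition. *)
  set (C := fun X : T => Near e3 X /\ Rabs (Gs (n - 1)%nat X 0) < Rabs kap / 2 * nu /\
    Rabs (G X 0 - y0) < eps / 2 /\
    Rabs (lie_iter (proj1_sig X) n height 0 0 - lie_iter X0 n height 0 0)
      < Rabs (lie_iter X0 n height 0 0) /\
    (forall a, Rabs a < e' ->
          (exists t, Rabs (t - sigma * T0) < rho /\ flow M (proj1_sig X) t (a, 0) (x0, G X a)) /\
          (forall t q, Rabs (t - sigma * T0) < rho -> flow M (proj1_sig X) t (a, 0) q ->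
             fst q = x0 -> q = (x0, G X a)))).
  assert (Hslice : forall (f : T -> R -> R) d, cont2 f Xc 0 -> 0 < d ->
            locally Xc (fun X => Rabs (f X 0 - f Xc 0) < d)).
  { intros f d Hf Hd. destruct (proj1 (cont2_eps _ _ _) Hf d Hd) as [d' Hd'].
    exists d'. intros Y HY. apply Hd'; [exact HY|]. rewrite Rminus_diag, Rabs_R0. apply cond_pos. }
  assert (HC : locally Xc C).
  { repeat apply filter_and; [exact Hnear | | | | exact Htrans'].
    - generalize (Hslice (Gs (n - 1)%nat) (Rabs kap / 2 * nu) (Gs_cont (n - 1)%nat Xc 0 ltac:(lia) Hz1)
        ltac:(apply Rmult_lt_0_compat; lra)).
      apply filter_imp. intros X HX. rewrite (Gs_flat (n - 1)%nat), Rminus_0_r in HX by lia. exact HX.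
    - generalize (Hslice (Gs O) (eps / 2) (Gs_cont O Xc 0 ltac:(lia) Hz1) ltac:(lra)).
      apply filter_imp. intros X HX. rewrite !Gs_0, HGc in HX. exact HX.
    - assert (Hl : cont3 (fun X : T => lie_iter (proj1_sig X) n height) Xc 0 0).
      { apply (Ck_cont W 0 (fun X : T => lie_iter (proj1_sig X) n height)); [|apply HWa, Hz1].
        apply (lie_iter_Ck (fun X : T => proj1_sig X) W r); auto. lia. }
      apply (Hslice (fun (X : T) a => lie_iter (proj1_sig X) n height 0 a)); [|apply Rabs_pos_lt, Hlie_nz].
      apply (cont3_cont2 _ _ _ _ Hl). }
  destruct HC as [d4 Hd4]. assert (Hd40 := cond_pos d4).
  set (e4 := Rmin d4 e2). assert (He4 : 0 < e4) by (apply Rmin_glb_lt; lra).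
  assert (He42 : e4 <= e2) by apply Rmin_r. assert (He4d : e4 <= d4) by apply Rmin_l.
  set (C4 := fun X : T => Cr_ball M K r X0 e4 (proj1_sig X)).
  assert (HC4 : forall X, C4 X -> C X).
  { intros X [_ [e5 [He5 H]]]. apply Hd4. apply (Cr_close_le K r e5); [lra|exact H]. }
  assert (HC4_open : forall X, C4 X -> locally X C4).
  { intros X HX. destruct (Cr_ball_open M K r X0 e4 _ HX) as [d [Hd H]].
    exists (mkposreal d Hd). intros Y HY. apply H; [apply (proj2_sig Y) | exact HY]. }
  assert (Gs_der3 : forall (X : T) b, Rabs b < e3 -> is_derive (Gs (n - 1)%nat X) b (Gs n X b)).
  { intros X b Hb. assert (H := Gs_der (n - 1)%nat X b ltac:(lia) ltac:(lra)).
    replace (S (n - 1)) with n in H by lia. exact H. }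
  (* Off C the value is arbitrary; the zero is only evaluated at fields in C4, which lie in C. *)
  assert (Hroot_ex : forall X : T, { a : R | C X -> Rabs a < nu /\ Gs (n - 1)%nat X a = 0 }).
  { intros X. apply constructive_indefinite_description.
    destruct (classic (C X)) as [HX|HX]; [|exists 0; tauto].
    destruct HX as [H1 [H2 _]].
    destruct (root_near (Gs (n - 1)%nat X) (Gs n X) e3 kap (Gs_der3 X) (fun b Hb => proj1 (H1 b Hb))
                nu ltac:(lra) H2) as [a Ha].
    exists a. auto. }
  set (root := fun X => proj1_sig (Hroot_ex X)).
  assert (Hroot : forall X, C X -> Rabs (root X) < nu /\ Gs (n - 1)%nat X (root X) = 0).
  { intros X. unfold root. destruct (Hroot_ex X) as [a Ha]. exact Ha. }
  assert (Hroot_unique : forall X a, C X -> Rabs a < e3 ->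
            Rabs kap / 2 * Rabs (a - root X) <= Rabs (Gs (n - 1)%nat X a)).
  { intros X a HX Ha. destruct (Hroot X HX) as [R1 R2]. destruct HX as [H1 _].
    assert (H := slope_below (Gs (n - 1)%nat X) (Gs n X) e3 kap (Gs_der3 X)
                   (fun b Hb => proj1 (H1 b Hb)) (root X) a ltac:(lra) Ha).
    rewrite R2, Rminus_0_r in H. exact H. }
  set (lam := fun (i : nat) (X : T) => Gs i X (root X) / INR (fact i)).
  assert (Hlam_cont : forall i X, (i <= r)%nat -> C4 X -> continuous (lam i) X).
  { intros i X Hi HX. destruct (Hroot X (HC4 X HX)) as [R1 R2].
    (* The zero of X is inserted in the (n-1)-st derivative for Y near X: the value is small, and
       the lower slope bound turns this into closeness of the two zeros. *)
    assert (Hrc : continuous root X).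
    { apply continuous_R. intros e He.
      destruct (proj1 (cont2_eps _ _ _) (Gs_cont (n - 1)%nat X (root X) ltac:(lia) ltac:(lra))
        (Rabs kap / 2 * e) ltac:(apply Rmult_lt_0_compat; lra)) as [d Hd].
      assert (Hd' : locally X (fun Y => ball X d Y)) by (exists d; auto).
      generalize (filter_and _ _ (HC4_open X HX) Hd'). apply filter_imp. intros Y [HY1 HY2].
      assert (A := Hd Y (root X) HY2 ltac:(rewrite Rminus_diag, Rabs_R0; apply cond_pos)).
      rewrite R2, Rminus_0_r in A.
      assert (B := Hroot_unique Y (root X) (HC4 Y HY1) ltac:(lra)).
      rewrite Rabs_minus_sym in B. apply Rmult_lt_reg_l with (Rabs kap / 2); lra. }
    unfold lam. apply (continuous_mult (fun X => Gs i X (root X)) (fun _ => / INR (fact i)));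
      [|apply continuous_const].
    apply (continuous_comp_2 (fun X : T => X) root (Gs i)); [apply continuous_id | exact Hrc|].
    apply Gs_cont; [exact Hi|lra]. }
  (* The coefficients as functions on all fields, 0 off the ball of radius e2, which contains U0. *)
  set (lamv := fun (i : nat) (X : vfield) =>
    match excluded_middle_informative (Cr_ball M K r X0 e2 X) with
    | left H => lam i (exist _ X H)
    | right _ => 0
    end).
  assert (Hlamv : forall i (Z : T), lamv i (proj1_sig Z) = lam i Z).
  { intros i [X HX]. unfold lamv. simpl. destruct excluded_middle_informative as [H|H]; [|contradiction].
    rewrite (proof_irrelevance _ H HX). reflexivity. }
  assert (Hlift : forall X, Cr_ball M K r X0 e4 X -> exists Z : T, proj1_sig Z = X /\ C4 Z).
  { intros X HX. exists (exist _ X (Cr_ball_le _ _ _ _ _ _ _ He42 HX)). split; [reflexivity|exact HX]. }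
  assert (Hdirs : forall i, { l : list R | (1 <= i <= n - 2)%nat ->
    locally 0 (fun mu : R => forall Z : T, proj1_sig Z = shear X0 (horner l) mu ->
    forall a, Rabs a < e3 -> Gs (n - 1)%nat Z a = 0 ->
    forall j, (1 <= j <= n - 2)%nat ->
      Rabs (Gs j Z a / INR (fact j) - (if Nat.eqb i j then mu else 0)) <= Rabs mu / 4) }).
  { intros i. apply constructive_indefinite_description.
    destruct (classic (1 <= i <= n - 2)%nat) as [Hi|Hi]; [|exists nil; tauto].
    destruct (unfolding_direction n r M K X0 e2 He2 hX0 u Gs e1 e3 c0 kap hn hr hM HK HKM He1 He3
                u_Ck u_nz Gs_der Gs_1 X0_jet kap_nz Hnear i Hi) as [l Hl].
    exists l. intros _. exact Hl. }
  set (dir := fun i => proj1_sig (Hdirs i)).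
  assert (Hdir : forall i, (1 <= i <= n - 2)%nat -> locally 0 (fun mu : R =>
     Cr_ball M K r X0 e4 (shear X0 (horner (dir i)) mu) /\
     forall j, (1 <= j <= n - 2)%nat ->
       Rabs (lamv j (shear X0 (horner (dir i)) mu) - (if Nat.eqb i j then mu else 0)) <= Rabs mu / 4)).
  { intros i Hi. unfold dir. destruct (Hdirs i) as [l Hl]. simpl. specialize (Hl Hi).
    destruct (shear_continuous M K r X0 l hM hX0 HK HKM) as [S1 S2].
    generalize (filter_and _ _ Hl (S2 0 (e4 / 2) ltac:(lra))). apply filter_imp.
    intros mu [H1 H2]. rewrite shear_zero in H2.
    assert (Hb : Cr_ball M K r X0 e4 (shear X0 (horner l) mu)).
    { split; [apply S1|]. exists (e4 / 2). split; [lra|exact H2]. }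
    split; [exact Hb|]. intros j Hj. destruct (Hlift _ Hb) as [Z [HZ HZ4]].
    destruct (Hroot Z (HC4 Z HZ4)) as [R1 R2].
    rewrite <- HZ, Hlamv. apply (H1 Z HZ (root Z)); [lra|exact R2|exact Hj]. }
  assert (Hdirs_all : locally 0 (fun mu : R => forall i, (i < n - 1)%nat -> (1 <= i)%nat ->
     Cr_ball M K r X0 e4 (shear X0 (horner (dir i)) mu) /\
     forall j, (1 <= j <= n - 2)%nat ->
       Rabs (lamv j (shear X0 (horner (dir i)) mu) - (if Nat.eqb i j then mu else 0)) <= Rabs mu / 4)).
  { apply filter_forall_lt; [apply locally_filter|]. intros i Hi.
    destruct (Nat.eq_dec i 0) as [->|Hi0].
    - apply filter_forall. intros mu Hmu. lia.
    - generalize (Hdir i ltac:(lia)). apply filter_imp. auto. }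
  destruct Hdirs_all as [dm Hdm]. assert (Hdm0 := cond_pos dm).
  (* A target with |v| < eta is sought among |mu| <= 2 |v| < dm. *)
  set (eta := dm / 4). assert (Heta : 0 < eta) by (unfold eta; lra).
  assert (Hdm' : forall i mu, (1 <= i <= n - 2)%nat -> Rabs mu < dm ->
     Cr_ball M K r X0 e4 (shear X0 (horner (dir i)) mu) /\
     forall j, (1 <= j <= n - 2)%nat ->
       Rabs (lamv j (shear X0 (horner (dir i)) mu) - (if Nat.eqb i j then mu else 0)) <= Rabs mu / 4).
  { intros i mu Hi Hmu. apply Hdm; [|lia|lia]. change (Rabs (mu - 0) < dm). rewrite Rminus_0_r. exact Hmu. }
  (* Cutting the ball by |lambda_j| < eta confines all coefficients to the same interval;
     surjectivity then has to produce fields for which all of them are small. *)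
  set (U0 := fun X => Cr_ball M K r X0 e4 X /\
    forall j, (j < n - 1)%nat -> (1 <= j)%nat -> Rabs (lamv j X) < eta).
  exists U0, eta, lamv.
  split; [|split; [|split; [exact Heta|split; [|split]]]].
  - split; [intros X HX; apply HX|].
    intros X [HX1 HX2]. destruct (Hlift X HX1) as [Z [<- HZ]].
    assert (H : locally Z (fun Y => C4 Y /\ forall j, (j < n - 1)%nat -> (1 <= j)%nat -> Rabs (lam j Y) < eta)).
    { apply filter_and; [apply HC4_open, HZ|].
      apply filter_forall_lt; [apply locally_filter|]. intros j Hj.
      destruct (Nat.eq_dec j 0) as [->|Hj0].
      - apply filter_forall. intros Y HY. lia.
      - assert (A := HX2 j Hj ltac:(lia)). rewrite Hlamv in A.
        generalize (proj1 (continuous_R _ _) (Hlam_cont j Z ltac:(lia) HZ) (eta - Rabs (lam j Z)) ltac:(lra)).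
        apply filter_imp. intros Y HY _.
        replace (lam j Y) with (lam j Z + (lam j Y - lam j Z)) by ring.
        eapply Rle_lt_trans; [apply Rabs_triang|]. lra. }
    destruct (locally_Cr_nbhs M K r X0 e2 He2 hX0 Z _ HK HKM H) as [K' [e5 [A1 [A2 [A3 A4]]]]].
    exists K', e5. split; [exact A1|]. split; [exact A2|]. split; [exact A3|].
    intros Y HY HYc. destruct (A4 Y HY HYc) as [HB [B1 B2]].
    split; [exact B1|]. intros j Hj1 Hj2.
    change Y with (proj1_sig (exist _ Y HB : T)). rewrite Hlamv. apply B2; assumption.
  - assert (Hb : Cr_ball M K r X0 e4 X0) by (apply Cr_ball_center; assumption).
    split; [exact Hb|]. intros j Hj1 Hj2.
    destruct (Hdm' j 0 ltac:(lia) ltac:(rewrite Rabs_R0; exact Hdm0)) as [_ H].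
    specialize (H j ltac:(lia)). rewrite shear_zero, Nat.eqb_refl, Rabs_R0, Rminus_0_r in H. lra.
  - intros i Hi. split.
    + intros X [_ HX]. specialize (HX i ltac:(lia) ltac:(lia)). apply Rabs_def2 in HX. lra.
    (* At mu = w and mu = -w, lambda_i is beyond 3 |v| / 2 in absolute value with the sign of mu, or
       0 if v = 0, so the intermediate value theorem attains v in between. *)
    + intros v Hv. set (w := 2 * Rabs v).
      assert (Hvabs : Rabs v < eta) by (apply Rabs_def1; lra).
      assert (Hw : 0 <= w < dm) by (unfold w; pose proof (Rabs_pos v); unfold eta in Hvabs; lra).
      set (path := fun mu => shear X0 (horner (dir i)) mu).
      assert (Hin : forall t, Rabs (clamp (- w) w t) <= w).
      { intros t. apply Rabs_le, clamp_in. lra. }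
      assert (Hcont : continuity (fun t => lamv i (path (clamp (- w) w t)))).
      { intros t. apply continuity_pt_filterlim.
        apply (continuous_comp (clamp (- w) w) (fun mu => lamv i (path mu)));
          [apply clamp_continuous; lra|].
        set (mu := clamp (- w) w t).
        assert (Hmu : Rabs mu < dm) by (assert (H := Hin t); fold mu in H; lra).
        destruct (Hlift _ (proj1 (Hdm' i mu Hi Hmu))) as [Z [HZ HZ4]]. fold (path mu) in HZ.
        apply continuous_R. intros e He.
        destruct (proj1 (continuous_R _ _) (Hlam_cont i Z ltac:(lia) HZ4) e He) as [d Hd].
        destruct (shear_continuous M K r X0 (dir i) hM hX0 HK HKM) as [_ S2].
        assert (Hnb : locally mu (fun m => Rabs m < dm)) by (apply locally_ball_0; exact Hmu).
        generalize (filter_and _ _ Hnb (S2 mu d (cond_pos d))). apply filter_imp.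
        intros mu' [H1 H2]. destruct (Hlift _ (proj1 (Hdm' i mu' Hi H1))) as [Z' [HZ' _]].
        fold (path mu') in HZ'. rewrite <- HZ, <- HZ', !Hlamv. apply Hd.
        change (Cr_close K r d (proj1_sig Z) (proj1_sig Z')). rewrite HZ, HZ'. exact H2. }
      assert (Hest : forall mu, Rabs mu <= w -> Rabs (lamv i (path mu) - mu) <= Rabs mu / 4).
      { intros mu Hmu. destruct (Hdm' i mu Hi ltac:(lra)) as [_ H]. specialize (H i Hi).
        rewrite Nat.eqb_refl in H. exact H. }
      assert (Hwabs : Rabs w = w) by (apply Rabs_right; lra).
      assert (E1 := Hest w ltac:(lra)). assert (E2 := Hest (- w) ltac:(rewrite Rabs_Ropp; lra)).
      rewrite Rabs_Ropp in E2. rewrite Hwabs in E1, E2.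
      apply Rabs_le_between in E1. apply Rabs_le_between in E2.
      assert (Hvw : - Rabs v <= v <= Rabs v) by (apply Rabs_le_between; lra).
      destruct (IVT_gen _ (- w) w v Hcont) as [t [_ Ht]].
      { rewrite !clamp_id by lra. unfold w in *. unfold Rmin, Rmax. destruct Rle_dec; lra. }
      set (mu := clamp (- w) w t) in *.
      assert (Hmu := Hin t). fold mu in Hmu.
      exists (path mu). split; [|exact Ht].
      destruct (Hdm' i mu Hi ltac:(lra)) as [B1 B2]. split; [exact B1|].
      intros j Hj1 Hj2. assert (E3 := Hest mu Hmu). rewrite Ht in E3.
      assert (E4 := B2 j ltac:(lia)). fold (path mu) in E4.
      destruct (Nat.eqb_spec i j) as [<-|Hij]; [rewrite Ht; exact Hvabs|].
      rewrite Rminus_0_r in E4.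
      (* Since |v - mu| <= |mu| / 4, also |mu| <= 4 |v| / 3, and every other coefficient is at most
         |mu| / 4 <= |v| / 3 < eta. *)
      assert (Rabs mu <= Rabs v + Rabs (v - mu)).
      { replace mu with (v - (v - mu)) at 1 by ring. eapply Rle_trans; [apply Rabs_triang|].
        rewrite Rabs_Ropp. lra. }
      lra.
  - intros i Hi X [HX1 _]. destruct (Hlift X HX1) as [Z [<- HZ]].
    intros P HP. rewrite Hlamv in HP.
    assert (H := Hlam_cont i Z ltac:(lia) HZ P HP). unfold filtermap in H.
    destruct (locally_Cr_nbhs M K r X0 e2 He2 hX0 Z _ HK HKM H) as [K' [e5 [A1 [A2 [A3 A4]]]]].
    exists K', e5. split; [exact A1|]. split; [exact A2|]. split; [exact A3|].
    intros Y HY HYc _. destruct (A4 Y HY HYc) as [HB B].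
    change Y with (proj1_sig (exist _ Y HB : T)). rewrite Hlamv. exact B.
  - intros X [HX1 _]. destruct (Hlift X HX1) as [Z [<- HZ4]].
    assert (HCZ := HC4 Z HZ4). destruct (Hroot Z HCZ) as [R1 R2].
    destruct HCZ as [HnearZ [HsmallZ [HyZ [HlieZ HtransZ]]]].
    set (a := root Z) in *.
    exists (fun p => (x0, G Z (fst p))),
      (fun x => (x + a * (1 - (x / eps) ^ (2 * N)), 0)), (Gs n Z a / INR (fact n)).
    (* The diffeomorphism sends 0 to the zero a, so the constant coefficient G(a) is the height
       reached from h(0). *)
    assert (Hh0 : 0 + a * (1 - (0 / eps) ^ (2 * N)) = a).
    { unfold Rdiv. rewrite Rmult_0_l, pow_i by (unfold N; lia). ring. }
    assert (Hl0 : lamv O (proj1_sig Z) = G Z a).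
    { rewrite Hlamv. unfold lam. fold a. rewrite Gs_0. simpl. field. }
    split; [|split; [|split; [|split; [|split; [|split]]]]].
    + intros x Hx. assert (Hxe : Rabs x < eps) by (apply Rabs_def1; lra).
      destruct (HtransZ x ltac:(lra)) as [H1 H2]. simpl. split; [|split; [exact H1|]].
      * split; [reflexivity|]. simpl.
        assert (Hd : Rabs (G Z x - G Z 0) <= 1 / 4 * Rabs x).
        { rewrite <- !Gs_0. destruct (MVT_gen (Gs O Z) 0 x (Gs 1%nat Z)) as [z [Hz Heq]].
          - intros z Hz. apply Gs_der; [lia|].
            assert (H := between_ball e3 0 x z Hz3 ltac:(lra) ltac:(lra)). lra.
          - intros z Hz. eapply is_derive_continuity_pt, Gs_der; [lia|].
            assert (H := between_ball e3 0 x z Hz3 ltac:(lra) Hz). lra.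
          - rewrite Heq, Rminus_0_r, Rabs_mult. apply Rmult_le_compat_r; [apply Rabs_pos|].
            left. apply HnearZ; [apply (between_ball e3 0 x z); auto; lra|lia|lia]. }
        assert (H : Rabs (G Z x - y0) < eps).
        { replace (G Z x - y0) with ((G Z x - G Z 0) + (G Z 0 - y0)) by ring.
          eapply Rle_lt_trans; [apply Rabs_triang|]. lra. }
        apply Rabs_def2 in H. lra.
      * intros t q Ht Hq [Hq1 _]. apply (H2 t q); assumption.
    + apply translation_diffeo; [lra | unfold N; lia | apply HnuN, R1].
    + reflexivity.
    + destruct (normal_form_expansion (fun j => Gs j Z) n N e3 eps a hn) as [B HB].
      * unfold N. lia.
      * lra.
      * lra.
      * intros j b Hj Hb. apply Gs_der; [lia|lra].
      * assert (H := Gs_cont (S n) Z a ltac:(lia) ltac:(lra)). apply continuous_R. intros e He.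
        destruct (proj1 (cont2_eps _ _ _) H e He) as [d Hd]. exists d. intros b Hb.
        apply Hd; [apply ball_center | exact Hb].
      * exact R2.
      * intros b Hb. apply HnearZ; [exact Hb|lia|lia].
      * exists B. revert HB. apply filter_imp. intros x Hx. simpl fst. simpl snd.
        rewrite <- Gs_0.
        rewrite (sum_n_m_ext _ (fun i => Gs i Z a / INR (fact i) * x ^ i)).
        -- rewrite Hlamv. exact Hx.
        -- intros i. rewrite Hlamv. reflexivity.
    + change (lamv O (proj1_sig Z) = G Z (0 + a * (1 - (0 / eps) ^ (2 * N)))).
      rewrite Hh0. exact Hl0.
    (* Contact of order n at the origin makes 0 a zero of the (n-1)-st derivative, and this zero is
       unique. *)
    + intros Hcon. destruct (Hcontact Z Hcon) as [c [_ [_ [Hflat _]]]].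
      assert (H := Hroot_unique Z 0 (HC4 Z HZ4) Hz3). rewrite Hflat, Rabs_R0 in H by lia.
      fold a in H. assert (Ha0 : a = 0).
      { destruct (Req_dec (0 - a) 0) as [|Hne]; [lra|]. assert (A := Rabs_pos_lt _ Hne). nra. }
      rewrite Hl0. simpl. rewrite Ha0. reflexivity.
    + apply sign_opp_mul; [exact Hdl|].
      destruct (HnearZ a ltac:(lra)) as [Hk _].
      assert (Hfact : 0 < / INR (fact n)).
      { apply Rinv_0_lt_compat, lt_0_INR, lt_O_fact. }
      assert (Hdn : 0 < delta ^ n \/ delta ^ n < 0).
      { destruct (Rtotal_order (delta ^ n) 0) as [H|[H|H]]; [right; exact H| |left; exact H].
        exfalso. rewrite H in Hsign0. lra. }
      (* The n-th derivative at a and X^n h at the origin each keep the sign they have for X0, so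
         the sign relation carries over. *)
      assert (Hneg : Gs n Z a * (delta ^ n * lie_iter (proj1_sig Z) n height 0 0) < 0).
      { revert Hk HlieZ Hsign0.
        set (p := Gs n Z a). set (q := lie_iter (proj1_sig Z) n height 0 0).
        set (q0 := lie_iter X0 n height 0 0). set (dn := delta ^ n) in *.
        intros Hk Hq Hs.
        assert (Hpk : 0 < p * kap).
        { destruct (Rlt_le_dec 0 kap).
          - rewrite (Rabs_right kap) in Hk by lra. apply Rabs_def2 in Hk. nra.
          - rewrite (Rabs_left1 kap) in Hk by lra. apply Rabs_def2 in Hk. nra. }
        assert (Hqq : 0 < q * q0).
        { destruct (Rlt_le_dec 0 q0).
          - rewrite (Rabs_right q0) in Hq by lra. apply Rabs_def2 in Hq. nra.
          - assert (q0 < 0) by (destruct (Req_dec q0 0); [contradiction|lra]).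
            rewrite (Rabs_left1 q0) in Hq by lra. apply Rabs_def2 in Hq. nra. }
        assert (H : (p * (dn * q)) * (kap * (dn * q0)) > 0).
        { replace (p * (dn * q) * (kap * (dn * q0))) with ((p * kap) * (q * q0) * (dn * dn)) by ring.
          apply Rmult_lt_0_compat; [apply Rmult_lt_0_compat; assumption|]. destruct Hdn; nra. }
        nra. }
      replace (Gs n Z a / INR (fact n) * (delta ^ n * lie_iter (proj1_sig Z) n height 0 0)) with
        (/ INR (fact n) * (Gs n Z a * (delta ^ n * lie_iter (proj1_sig Z) n height 0 0)))
        by (unfold Rdiv; ring).
      nra.
Qed.
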